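(* Consider the linear mixed-effects setting described in the context, assume (A0)–(A3), let $(\alpha,\gamma)\in\mathcal{A}_0\times\mathcal{G}_0$, and suppose the number of clusters $m$ is fixed. Let $a\in(0,1)$ and let $\chi^2_{m,u}$ denote the $(100u)$-th percentile of the chi-square distribution with $m$ degrees of freedom. Then for $k\in\gamma\cap\gamma_0$, \[ \bigg(\frac{m\hat{\sigma}_k^2(\alpha,\gamma)}{\chi^2_{m,1-a/2}},\ \frac{m\hat{\sigma}_k^2(\alpha,\gamma)}{\chi^2_{m,a/2}}\bigg) \] is an (asymptotically, as $N\to\infty$) $100(1-a)\%$ confidence interval for $\sigma_{k,0}^2$.
   Context: Data: $m\ge1$ clusters, cluster $i$ having $n_i$ observations; $N=\sum_{i=1}^m n_i$, $n_{\min}=\min_i n_i$. For cluster $i$: response $\bm{y}_i\in\mathbb{R}^{n_i}$, fixed-effects design $\bm{X}_i\in\mathbb{R}^{n_i\times p}$ with columns $\bm{x}_{i,j}$, random-effects design $\bm{Z}_i\in\mathbb{R}^{n_i\times q}$ with columns $\bm{z}_{i,k}$. $\bm{X}$ (row-stacking of $\bm X_i$) and $\bm{Z}=\mathrm{diag}(\bm{Z}_1,\dots,\bm{Z}_m)$ have full column rank. Data are generated as $\bm{y}_i=\bm{X}_i\bm{\beta}_0+\bm{Z}_i\bm{b}_i+\bm{\epsilon}_i$, with $\bm{b}_i=(b_{i,1},\dots,b_{i,q})'\sim N(\bm 0,\mathrm{diag}(\sigma_{1,0}^2,\dots,\sigma_{q,0}^2))$, $\bm\epsilon_i\sim N(\bm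 0,v_0^2\bm{I}_{n_i})$, all mutually independent, $v_0^2>0$, $\sigma_{k,0}^2\ge0$; $\theta_{k,0}=\sigma_{k,0}^2/v_0^2$, $\bm\mu_0=\bm X\bm\beta_0$. Candidate models $(\alpha,\gamma)\in\mathcal{A}\times\mathcal{G}\subset 2^{\{1,\dots,p\}}\times2^{\{1,\dots,q\}}$; $\bm X(\alpha)$ the columns indexed by $\alpha$. For $\bm\theta\in[0,\infty)^{|\gamma|}$, $\bm H(\gamma,\bm\theta)=\mathrm{diag}_i(\bm I_{n_i}+\sum_{k\in\gamma}\theta_k\bm z_{i,k}\bm z_{i,k}')$, $\bm M(\alpha,\gamma;\bm\theta)=\bm X(\alpha)(\bm X(\alpha)'\bm H^{-1}\bm X(\alpha))^{-1}\bm X(\alpha)'\bm H^{-1}$, $-2\log L(\bm\theta,v^2;\alpha,\gamma)=N\log(2\pi)+N\log v^2+\log\det\bm H+\bm y'\bm H^{-1}(\bm I_N-\bm M)\bm y/v^2$; ML estimators $(\hat{\bm\theta},\hat v^2)$ minimize it over $[0,\infty)^{|\gamma|}\times(0,\infty)$, and $\hat\sigma_k^2(\alpha,\gamma)=\hat\theta_k\hat v^2$. $\alpha$ is correct if $\bm\mu_0=\bm X(\alpha)\bm\beta(\alpha)$ for some $\bm\beta(\alpha)$; $\gamma$ is correct if $\{k:\theta_{k,0}>0\}\subset\gamma$; $\mathcal A_0,\mathcal G_0$ the sets of correct candidate models; $(\alpha_0,\gamma_0)$ the smallest correct model (minimal cardinalities), with $|\alpha_0|,|\gamma_0|>0$ fixed.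 Conditions: (A0) $p=c_p+o(n_{\min}^\tau)$, $q=c_q+o(n_{\min}^\tau)$, some $\tau\in[0,1/2)$, $c_p,c_q>0$. (A1) $\exists\,\xi\in(2\tau,1]$, $d_{i,j}>0$ bounded away from $0$ and $\infty$: $\bm x_{i,j}'\bm x_{i,j^*}=d_{i,j}n_i^\xi+o(n_i^\xi)$ if $j=j^*$, $o(n_i^{\xi-\tau})$ otherwise. (A2) $\exists\,\ell\in(2\tau,1]$, $c_{i,k}>0$ bounded away from $0$ and $\infty$: $\bm z_{i,k}'\bm z_{i,k^*}=c_{i,k}n_i^\ell+o(n_i^\ell)$ if $k=k^*$, $o(n_i^{\ell-\tau})$ otherwise. (A3) $\bm x_{i,j}'\bm z_{i,k}=o(n_i^{(\xi+\ell)/2-\tau})$. *)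

(* Defs.v *)
From HB Require Import structures.
From mathcomp Require Import all_boot all_order all_algebra.
From mathcomp Require Import all_classical all_reals all_analysis.
From mathcomp Require Import normal_distribution.
Set Implicit Arguments. Unset Strict Implicit. Unset Printing Implicit Defensive.
Import Order.TTheory GRing.Theory Num.Theory.
Import numFieldNormedType.Exports.
Local Open Scope classical_set_scope.
Local Open Scope ring_scope.

Section LMM.
Variable R : realType.

Definition stackX (m : nat) (n : 'I_m -> nat) (p : nat)
  (X : forall i : 'I_m, 'M[R]_(n i, p)) : 'M[R]_(\sum_(i < m) n i, p) :=
  \mxcol_(i < m) X i.

Definition blockZ (m : nat) (n : 'I_m -> nat) (q : nat)
  (Z : forall i : 'I_m, 'M[R]_(n i, q)) : 'M[R]_(\sum_(i < m) n i, \sum_(j < m) q) :=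
  \mxblock_(i < m, j < m) (if i == j then Z i else 0).

Definition Xsub (N p : nat) (X : 'M[R]_(N, p)) (a : {set 'I_p}) : 'M[R]_(N, #|a|) :=
  colsub (fun j : 'I_#|a| => enum_val j) X.

(* H(gamma, theta) = diag_i (I + sum_{k in gamma} theta_k z_{ik} z_{ik}') ;
   theta is given as a function on 'I_q, only its values on gamma are used. *)
Definition Hmat (m : nat) (n : 'I_m -> nat) (q : nat)
  (Z : forall i : 'I_m, 'M[R]_(n i, q)) (g : {set 'I_q}) (th : 'I_q -> R)
  : 'M[R]_(\sum_(i < m) n i) :=
  \mxdiag_(i < m) (1%:M + \sum_(k in g) th k *: (col k (Z i) *m (col k (Z i))^T)).

Definition Mmat (N r : nat) (Xa : 'M[R]_(N, r)) (H : 'M[R]_N) : 'M[R]_N :=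
  Xa *m invmx (Xa^T *m invmx H *m Xa) *m Xa^T *m invmx H.

Definition m2logL (m : nat) (n : 'I_m -> nat) (p q : nat)
  (X : forall i : 'I_m, 'M[R]_(n i, p)) (Z : forall i : 'I_m, 'M[R]_(n i, q))
  (a : {set 'I_p}) (g : {set 'I_q}) (y : 'cV[R]_(\sum_(i < m) n i))
  (th : 'I_q -> R) (v2 : R) : R :=
  let N := (\sum_(i < m) n i)%N in
  let H := Hmat Z g th in
  let M := Mmat (Xsub (stackX X) a) H in
  N%:R * ln (2 * pi) + N%:R * ln v2 + ln (\det H)
  + (y^T *m invmx H *m (1%:M - M) *m y) 0 0 / v2.

Definition is_ML (m : nat) (n : 'I_m -> nat) (p q : nat)
  (X : forall i : 'I_m, 'M[R]_(n i, p)) (Z : forall i : 'I_m, 'M[R]_(n i, q))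
  (a : {set 'I_p}) (g : {set 'I_q}) (y : 'cV[R]_(\sum_(i < m) n i))
  (th : 'I_q -> R) (v2 : R) : Prop :=
  [/\ (forall k, k \in g -> 0 <= th k), 0 < v2 &
      forall th' v2', (forall k, k \in g -> 0 <= th' k) -> 0 < v2' ->
        m2logL X Z a g y th v2 <= m2logL X Z a g y th' v2'].

Definition compk (q : nat) (f : 'I_q -> R) (k : nat) : R := oapp f 0 (insub k).

(* chi-square distribution with m degrees of freedom: cdf via its density
   (proportional to t^(m/2-1) e^(-t/2) on (0,oo)) *)
Definition chi2_dens (m : nat) (t : R) : R :=
  powR t (m%:R / 2 - 1) * expR (- t / 2).

Definition chi2_cdf (m : nat) (x : R) : R :=
  let A : set R := `[0, x]%classic in
  let B : set R := `[0, +oo[%classic in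
  fine (\int[lebesgue_measure]_(t in A) (chi2_dens m t)%:E)%E /
  fine (\int[lebesgue_measure]_(t in B) (chi2_dens m t)%:E)%E.

(* the data y = (y_1; ...; y_m), y_i = X_i beta0 + Z_i b_i + eps_i, with
   b_{i,k} = sqrt(sigma_{k,0}^2) xi_{i,k}, eps_{i,j} = sqrt(v_0^2) eta_{i,j},
   xi, eta independent standard normals *)
Definition ydata (T : Type) (m : nat) (n : 'I_m -> nat) (p q : nat)
  (X : forall i : 'I_m, 'M[R]_(n i, p)) (Z : forall i : 'I_m, 'M[R]_(n i, q))
  (beta0 : 'cV[R]_p) (sigma02 : nat -> R) (v02 : R)
  (xi : forall i : 'I_m, 'I_q -> T -> R) (eta : forall i : 'I_m, 'I_(n i) -> T -> R)
  (w : T) : 'cV[R]_(\sum_(i < m) n i) :=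
  \mxcol_(i < m) (X i *m beta0
      + Z i *m (\col_(k < q) (Num.sqrt (sigma02 k) * xi i k w))
      + \col_(j < n i) (Num.sqrt v02 * eta i j w)).

(* Gram-type condition (A1)/(A2) on the columns of the blocks Y_i, with
   exponent e and the common tau; the o(.) terms are uniform in i, j, j'. *)
Definition gram_cond (m : nat) (n : nat -> 'I_m -> nat) (p : nat -> nat)
  (Y : forall nu (i : 'I_m), 'M[R]_(n nu i, p nu)) (tau e : R) : Prop :=
  exists (dd : 'I_m -> nat -> R) (dl du : R),
  [/\ 2 * tau < e <= 1, 0 < dl, (forall i j, dl <= dd i j <= du) &
    forall eps : R, 0 < eps -> \forall nu \near \oo,
      forall (i : 'I_m) (j j' : 'I_(p nu)),
        let s := ((col j (Y nu i))^T *m col j' (Y nu i)) 0 0 in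
        if j == j'
        then `|s - dd i j * powR (n nu i)%:R e| <= eps * powR (n nu i)%:R e
        else `|s| <= eps * powR (n nu i)%:R (e - tau)].

(* (A3): x_{ij}' z_{ik} = o(n_i^((xi+l)/2 - tau)), uniformly *)
Definition cross_cond (m : nat) (n : nat -> 'I_m -> nat) (p q : nat -> nat)
  (X : forall nu (i : 'I_m), 'M[R]_(n nu i, p nu))
  (Z : forall nu (i : 'I_m), 'M[R]_(n nu i, q nu)) (tau e l : R) : Prop :=
  forall eps : R, 0 < eps -> \forall nu \near \oo,
    forall (i : 'I_m) (j : 'I_(p nu)) (k : 'I_(q nu)),
      `|((col j (X nu i))^T *m col k (Z nu i)) 0 0|
        <= eps * powR (n nu i)%:R ((e + l) / 2 - tau).

(* (A0)-type condition: r = c + o(n_min^tau), i.e. |r - c| <= eps n_i^tau for all i *)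
Definition dim_cond (m : nat) (n : nat -> 'I_m -> nat) (r : nat -> nat)
  (tau : R) : Prop :=
  exists2 c : R, 0 < c &
  forall eps : R, 0 < eps -> \forall nu \near \oo,
    forall i : 'I_m, `|(r nu)%:R - c| <= eps * powR (n nu i)%:R tau.

End LMM.

Definition noise_family (T : Type) (R : realType) (m : nat) (n : 'I_m -> nat) (q : nat)
  (xi : forall i : 'I_m, 'I_q -> T -> R) (eta : forall i : 'I_m, 'I_(n i) -> T -> R)
  (s : (('I_m * 'I_q) + {i : 'I_m & 'I_(n i)})%type) : T -> R :=
  match s with
  | inl ik => xi ik.1 ik.2
  | inr ij => eta (tag ij) (tagged ij)
  end.

Definition mutual_indep (d : measure_display) (T : measurableType d) (R : realType)
  (P : probability T R) (I : finType) (f : I -> T -> R) : Prop :=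
  forall (S : {set I}) (B : I -> set R), (forall i, measurable (B i)) ->
    P (\bigcap_(i in [set i | i \in S]) (f i @^-1` B i)) =
    (\prod_(i in S) P (f i @^-1` B i))%E.

Definition std_normal (d : measure_display) (T : measurableType d) (R : realType)
  (P : probability T R) (X : T -> R) : Prop :=
  measurable_fun setT X /\
  forall B : set R, measurable B -> P (X @^-1` B) = normal_prob 0 1 B.

(* Main.v *)
(* Column by column the mixed model has the penalized least squares form
   |y - X beta - Z u|^2 + sum u_ik^2 / theta_k, minimized by the generalized least squares
   estimate and the predictor (BLUP) u.  By (A0)-(A3) the Gram matrix of the scaled columns of
   [X Z] is diagonally dominant, so comparing the minimum with the value at the true effects
   bounds n_i^l |u_i - b_i|^2 by the squared projection of the noise plus the true penalty
   sum b_ik^2 / theta_k, uniformly in theta.  The first-order condition in theta_k reads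
   sum_i z_ik' H_i^-1 z_ik = sum_i u_ik^2 / (theta_k^2 v^2), whose left side is m / theta_k up
   to a vanishing relative error; hence m sigma_k^2 = sum_i b_ik^2 + o(1) in probability, and
   the right side is sigma_{k,0}^2 times a chi-square variable with m degrees of freedom.

   Theta_k might a priori be too small for the penalty to be bounded.  In the largest cluster
   the error is small even without a lower bound on theta_k, and the first-order condition
   then yields one, because b_ik is bounded away from 0 with high probability. *)
Require Import Defs.
From HB Require Import structures.
From mathcomp Require Import all_boot all_order all_algebra.
From mathcomp Require Import all_classical all_reals all_analysis.
From mathcomp Require Import measurable_realfun normal_distribution.
From mathcomp Require Import ring lra.
Set Implicit Arguments. Unset Strict Implicit. Unset Printing Implicit Defensive.
Import Order.TTheory GRing.Theory Num.Theory.
Local Open Scope ring_scope.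

(** * Linear algebra *)

(** No derivative of the likelihood is taken, since the optimum may sit on the boundary theta_j = 0.
    The optimum is compared with perturbed points: [ln det H] is controlled by rank-one updates, and
    the generalized least squares value, being a penalized minimum, is bounded above by inserting
    any convenient effects. Both halves of the first-order condition then appear as inequalities
    with an error linear in the perturbation. Only boundedness of v^2 enters, because theta_k v^2 is
    identified directly.

    The largest cluster is singled out because the n_i need not be comparable: adding c to theta on
    gamma_0 costs a trace of order c n_max^l and a penalty of order 1/c. With c = n_max^(-l/2) both
    are of order n_max^(l/2), which is certain to be negligible against n_i^l only when n_i = n_max.
    The noise costs O(p + q) = O(n_i^tau), negligible because l > 2 tau.

    The chi-square law comes from scaling: the weight e^(S/2) turns the Gaussian law into Lebesgue
    measure, so the tilted distribution function is a multiple of y^(m/2), and total mass one fixes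
    the constant without any Gamma function. *)

Section Dot.
Variable R : realFieldType.

Definition dot N (u v : 'cV[R]_N) : R := (u^T *m v) 0 0.

Lemma dotE N (u v : 'cV[R]_N) : dot u v = \sum_i u i 0 * v i 0.
Proof. by rewrite /dot mxE; apply: eq_bigr => i _; rewrite mxE. Qed.

Lemma dotC N (u v : 'cV[R]_N) : dot u v = dot v u.
Proof. by rewrite !dotE; apply: eq_bigr => i _; rewrite mulrC. Qed.

Lemma dotDr N (u v w : 'cV[R]_N) : dot u (v + w) = dot u v + dot u w.
Proof. by rewrite /dot mulmxDr mxE. Qed.

Lemma dotDl N (u v w : 'cV[R]_N) : dot (u + v) w = dot u w + dot v w.
Proof. by rewrite dotC dotDr !(dotC w). Qed.

Lemma dotZr N c (u v : 'cV[R]_N) : dot u (c *: v) = c * dot u v.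
Proof. by rewrite /dot -scalemxAr mxE. Qed.

Lemma dotZl N c (u v : 'cV[R]_N) : dot (c *: u) v = c * dot u v.
Proof. by rewrite dotC dotZr dotC. Qed.

Lemma dotNr N (u v : 'cV[R]_N) : dot u (- v) = - dot u v.
Proof. by rewrite -scaleN1r dotZr mulN1r. Qed.

Lemma dotBr N (u v w : 'cV[R]_N) : dot u (v - w) = dot u v - dot u w.
Proof. by rewrite dotDr dotNr. Qed.

Lemma dotBl N (u v w : 'cV[R]_N) : dot (u - v) w = dot u w - dot v w.
Proof. by rewrite dotC dotBr !(dotC w). Qed.

Lemma dot0r N (u : 'cV[R]_N) : dot u 0 = 0.
Proof. by rewrite /dot mulmx0 mxE. Qed.

Lemma dot_sumr N (I : Type) (r : seq I) (P : pred I) (u : 'cV[R]_N) (F : I -> 'cV[R]_N) :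
  dot u (\sum_(i <- r | P i) F i) = \sum_(i <- r | P i) dot u (F i).
Proof. by apply: (big_morph (dot u)); [exact: dotDr|exact: dot0r]. Qed.

Lemma dot_suml N (I : Type) (r : seq I) (P : pred I) (u : 'cV[R]_N) (F : I -> 'cV[R]_N) :
  dot (\sum_(i <- r | P i) F i) u = \sum_(i <- r | P i) dot (F i) u.
Proof. by rewrite dotC dot_sumr; apply: eq_bigr => i _; rewrite dotC. Qed.

Lemma dot_mulr N M (A : 'M[R]_(N, M)) u v : dot u (A *m v) = dot (A^T *m u) v.
Proof. by rewrite /dot trmx_mul trmxK mulmxA. Qed.

Lemma dot_ge0 N (u : 'cV[R]_N) : 0 <= dot u u.
Proof. by rewrite dotE; apply: sumr_ge0 => i _; rewrite -expr2 sqr_ge0. Qed.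

Lemma dot_eq0 N (u : 'cV[R]_N) : (dot u u == 0) = (u == 0).
Proof.
apply/eqP/eqP => [/eqP|->]; last exact: dot0r.
rewrite dotE psumr_eq0 => [|i _]; last by rewrite -expr2 sqr_ge0.
move=> /allP h; apply/matrixP => i j; rewrite ord1 mxE.
by apply/eqP; have := h i (mem_index_enum i); rewrite /= -expr2 sqrf_eq0.
Qed.

Lemma dot_subr_ge N (e v : 'cV[R]_N) : dot (e - v) (e - v) = dot e e - 2 * dot e v + dot v v.
Proof. by rewrite dotBr !dotBl (dotC v e); ring. Qed.

Lemma rank1_mul N (z x : 'cV[R]_N) : (z *m z^T) *m x = dot z x *: z.
Proof. by rewrite -mulmxA [z^T *m x]mx11_scalar -/(dot z x) mul_mx_scalar. Qed.

(** Eliminating the same bordered matrix in the two possible orders leaves either Schur complement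
    as its determinant. *)
Lemma det_1Drank1 N (u v : 'cV[R]_N) : \det (1%:M + u *m v^T) = 1 + dot v u.
Proof.
have E1 : block_mx 1%:M (- v^T) u 1%:M =
    block_mx 1%:M 0 u 1%:M *m block_mx 1%:M (- v^T) 0 (1%:M + u *m v^T).
  rewrite mulmx_block !(mul1mx, mulmx1, mul0mx, mulmx0, addr0, add0r).
  by rewrite !mulmxN ?mulmx1 addrC addrK.
have E2 : block_mx 1%:M (- v^T) u 1%:M =
    block_mx 1%:M (- v^T) 0 1%:M *m block_mx (1%:M + v^T *m u) 0 u 1%:M.
  rewrite mulmx_block !(mul1mx, mulmx1, mul0mx, mulmx0, addr0, add0r) mulNmx.
  by rewrite addrK.
have := congr1 determinant E1; rewrite E2 !det_mulmx !det_ublock !det_lblock !det1.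
by rewrite !mul1r !mulr1 det_mx11 mxE mxE mulr1n /dot => ->.
Qed.

Lemma det_rank1 N (A : 'M[R]_N) c (z : 'cV[R]_N) : A \in unitmx ->
  \det (A + c *: (z *m z^T)) = \det A * (1 + c * dot z (invmx A *m z)).
Proof.
move=> uA; have -> : A + c *: (z *m z^T) = A *m (1%:M + (c *: (invmx A *m z)) *m z^T).
  by rewrite mulmxDr mulmx1 -scalemxAl -scalemxAr !mulmxA mulmxV// mul1mx.
by rewrite det_mulmx det_1Drank1 dotZr.
Qed.

(** The determinant clause gives invertibility and a meaningful [ln det] at once; rank-one updates
    preserve it through [det_rank1]. *)
Definition spd N (A : 'M[R]_N) :=
  [/\ A^T = A, forall x, x != 0 -> 0 < dot x (A *m x) & 0 < \det A].

Lemma spd1 N : spd (1%:M : 'M[R]_N).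
Proof.
split; [exact: tr_scalar_mx| |by rewrite det1 ltr01].
by move=> x x0; rewrite mul1mx lt_neqAle dot_ge0 andbT eq_sym dot_eq0.
Qed.

Section Spd.
Variables (N : nat) (A : 'M[R]_N).
Hypothesis hA : spd A.

Lemma spd_unit : A \in unitmx.
Proof. by case: hA => _ _ d; rewrite unitmxE unitfE gt_eqF. Qed.

Lemma spd_ge0 x : 0 <= dot x (A *m x).
Proof.
case: hA => _ p _; have [->|/p/ltW//] := eqVneq x 0.
by rewrite mulmx0 dot0r.
Qed.

Lemma spd_sym x y : dot x (A *m y) = dot (A *m x) y.
Proof. by case: hA => s _ _; rewrite dot_mulr s. Qed.

(** Variational form of the inverse: expand the nonnegative quadratic form of [A] at x - A^-1 r.
    Equality at x = A^-1 r makes the right side a maximum over [x]. *)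
Lemma spd_inv_ge r x : 2 * dot r x - dot x (A *m x) <= dot r (invmx A *m r).
Proof.
set y := invmx A *m r.
have ry : r = A *m y by rewrite /y mulmxA mulmxV ?spd_unit// mul1mx.
have := spd_ge0 (x - y).
rewrite mulmxBr -ry dotBr !dotBl (spd_sym y x) -ry.
rewrite (dotC x r) (dotC y r); lra.
Qed.

Lemma spd_inv_ge0 r : 0 <= dot r (invmx A *m r).
Proof. by apply: le_trans (spd_inv_ge r 0); rewrite mulmx0 !dot0r mulr0 subr0. Qed.

Lemma spd_inv_eq0 r : dot r (invmx A *m r) = 0 -> r = 0.
Proof.
set y := invmx A *m r.
have ry : r = A *m y by rewrite /y mulmxA mulmxV ?spd_unit// mul1mx.
rewrite {1}ry -spd_sym.
case: hA => _ p _; have [y0|/p] := eqVneq y 0; last by move=> /gt_eqF/eqP.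
by move=> _; rewrite ry y0 mulmx0.
Qed.

Lemma spd_rank1 c (z : 'cV[R]_N) : 0 <= c -> spd (A + c *: (z *m z^T)).
Proof.
case: (hA) => s p d c0; split.
- by rewrite linearD linearZ/= trmx_mul trmxK s.
- move=> x x0; rewrite mulmxDl -scalemxAl rank1_mul dotDr !dotZr (dotC x z) -expr2.
  by rewrite ltr_wpDr ?p// mulr_ge0 ?sqr_ge0.
- rewrite det_rank1 ?spd_unit// mulr_gt0// ltr_wpDr//.
  by rewrite mulr_ge0 ?spd_inv_ge0.
Qed.

End Spd.

Lemma spd_invK N (A : 'M[R]_N) (r : 'cV[R]_N) : spd A -> A *m (invmx A *m r) = r.
Proof. by move=> hA; rewrite mulmxA mulmxV ?spd_unit// mul1mx. Qed.

(** The variational bound for [A] is evaluated at the maximizer y = B^-1 r of the larger matrix,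
    where y'Ay <= y'By = r'y. *)
Lemma spd_inv_mono N (A : 'M[R]_N) c (z r : 'cV[R]_N) : spd A -> 0 <= c ->
  dot r (invmx (A + c *: (z *m z^T)) *m r) <= dot r (invmx A *m r).
Proof.
move=> hA c0; have hB := spd_rank1 hA z c0.
set B := _ + _ in hB *; set y := invmx B *m r.
have ry : r = B *m y by rewrite spd_invK.
apply: le_trans (spd_inv_ge hA r y).
have : dot y (A *m y) <= dot r y.
  rewrite [X in _ <= dot X _]ry (dotC (B *m y)) /B mulmxDl dotDr lerDl -scalemxAl rank1_mul !dotZr.
  by rewrite (dotC y z) -expr2 mulr_ge0 ?sqr_ge0.
by lra.
Qed.

Lemma spd_sum N (A : 'M[R]_N) (I : Type) (l : seq I) (P : pred I) (c : I -> R) (z : I -> 'cV[R]_N) :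
  spd A -> (forall i, P i -> 0 <= c i) ->
  spd (A + \sum_(i <- l | P i) c i *: (z i *m (z i)^T)) /\
  forall r, dot r (invmx (A + \sum_(i <- l | P i) c i *: (z i *m (z i)^T)) *m r)
            <= dot r (invmx A *m r).
Proof.
move=> hA c0; elim: l A hA => [|i l IH] A hA.
  by rewrite big_nil addr0; split.
rewrite big_cons; case: ifPn => Pi; last exact: IH.
have hB := spd_rank1 hA (z i) (c0 i Pi).
have [h1 h2] := IH _ hB; rewrite addrA; split => // r.
exact: le_trans (h2 r) (spd_inv_mono _ _ hA (c0 i Pi)).
Qed.

(* [x = H^-1 (1 - M) y] is [H^-1] applied to the generalized least squares residual. *)
Lemma gls_solution N r (H : 'M[R]_N) (Xa : 'M[R]_(N, r)) (y : 'cV[R]_N) : spd H ->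
  (forall b : 'cV[R]_r, Xa *m b = 0 -> b = 0) ->
  let M := Xa *m invmx (Xa^T *m invmx H *m Xa) *m Xa^T *m invmx H in
  exists b x, [/\ Xa^T *m x = 0, H *m x = y - Xa *m b &
    (y^T *m invmx H *m (1%:M - M) *m y) 0 0 = dot y x].
Proof.
move=> hH inj M; set W := invmx H; set G := Xa^T *m W *m Xa.
have uG : G \in unitmx.
  (* A null vector of [G] gives a vector in the range of [Xa] with zero H^-1 norm, which injectivity
     excludes. *)
  rewrite unitmxE unitfE; apply/negP => /det0P[v v0 vG].
  case/eqP: v0; apply: trmx_inj; rewrite trmx0; apply: inj.
  apply: (spd_inv_eq0 hH).
  have -> : dot (Xa *m v^T) (W *m (Xa *m v^T)) = (v *m G *m v^T) 0 0.
    by rewrite /dot trmx_mul trmxK /G !mulmxA.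
  by rewrite vG mul0mx mxE.
exists (invmx G *m Xa^T *m W *m y), (W *m (1%:M - M) *m y); split.
- rewrite !mulmxA mulmxBr mulmx1 mulmxBl.
  have -> : Xa^T *m W *m M = Xa^T *m W.
    by rewrite /M !mulmxA -/W -/G mulmxV// mul1mx.
  by rewrite subrr.
- rewrite !mulmxA mulmxV ?spd_unit// mul1mx mulmxBl mul1mx.
  by rewrite /M ?mulmxA.
- by rewrite /dot !mulmxA.
Qed.

End Dot.

(** * The profile likelihood *)

(** The inequality ln t <= t - 1 at t = 1 / (1 + x). *)
Lemma ln1p_ge (R : realType) (x : R) : 0 <= x -> x / (1 + x) <= ln (1 + x).
Proof.
move=> x0; have p : 0 < 1 + x by lra.
have ip : 0 < (1 + x)^-1 by rewrite invr_gt0.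
have : ln (1 + ((1 + x)^-1 - 1)) <= (1 + x)^-1 - 1 by apply: le_ln1Dx; lra.
rewrite subrKC.
rewrite lnV ?posrE//; have -> : x / (1 + x) = 1 - (1 + x)^-1 by field; rewrite gt_eqF.
by lra.
Qed.
 
Section LnDet.
Variables (R : realType) (N : nat).

(** Each update contributes ln(1 + c z'A^-1 z) <= c z'A^-1 z, and earlier updates only shrink the
    inverse, so every form may be taken at the initial matrix. *)
Lemma lndet_sum_le (A : 'M[R]_N) (I : Type) (l : seq I) (P : pred I) (c : I -> R)
    (z : I -> 'cV[R]_N) : spd A -> (forall i, P i -> 0 <= c i) ->
  ln (\det (A + \sum_(i <- l | P i) c i *: (z i *m (z i)^T))) <=
  ln (\det A) + \sum_(i <- l | P i) c i * dot (z i) (invmx A *m z i).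
Proof.
move=> hA c0; elim: l A hA => [|i l IH] A hA; first by rewrite !big_nil !addr0.
rewrite !big_cons; case: ifPn => Pi; last exact: IH.
have hB := spd_rank1 hA (z i) (c0 i Pi).
rewrite [in leLHS]addrA; apply: le_trans (IH _ hB) _.
rewrite addrA lerD//; last first.
  by apply: ler_sum => j Pj; rewrite ler_wpM2l ?c0// spd_inv_mono// c0.
have [_ _ dA] := hA.
have h0 : 0 <= c i * dot (z i) (invmx A *m z i) by rewrite mulr_ge0 ?c0 ?spd_inv_ge0.
rewrite det_rank1 ?spd_unit// lnM ?posrE//; last by lra.
by rewrite lerD2l le_ln1Dx//; lra.
Qed.

(** For a lower bound the forms are taken at the final matrix [F], whose inverse is the smallest;
    the logarithms are kept because linearizing them goes the wrong way. *)
Lemma lndet_sum_ge (A : 'M[R]_N) (I : Type) (l : seq I) (P : pred I) (c : I -> R)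
    (z : I -> 'cV[R]_N) : spd A -> (forall i, P i -> 0 <= c i) ->
  let F := A + \sum_(i <- l | P i) c i *: (z i *m (z i)^T) in
  ln (\det A) + \sum_(i <- l | P i) ln (1 + c i * dot (z i) (invmx F *m z i))
    <= ln (\det F).
Proof.
move=> hA c0; elim: l A hA => [|i l IH] A hA /=; first by rewrite !big_nil !addr0.
rewrite !big_cons; case Pi: (P i); last exact: (IH A hA).
have hB := spd_rank1 hA (z i) (c0 i Pi).
have := IH _ hB; have := (spd_sum l z hB c0).
rewrite /= -(addrA A); set F := _ + (_ + _) => -[hF mono] le.
apply: le_trans _ le; rewrite addrA lerD2r.
have [_ _ dA] := hA.
have hF0 : 0 <= c i * dot (z i) (invmx F *m z i) by rewrite mulr_ge0 ?c0 ?spd_inv_ge0.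
have hFA : c i * dot (z i) (invmx F *m z i) <= c i * dot (z i) (invmx A *m z i).
  rewrite ler_wpM2l ?c0//; apply: le_trans (mono _) _.
  by rewrite spd_inv_mono ?c0.
rewrite det_rank1 ?spd_unit// lnM ?posrE//; last by lra.
by rewrite lerD2l ler_ln ?posrE; lra.
Qed.

End LnDet.

Section Profile.
Variables (R : realType) (N r : nat) (I K : finType) (z : I * K -> 'cV[R]_N).
Variables (g : {set K}) (Xa : 'M[R]_(N, r)) (y : 'cV[R]_N).

(** The block-diagonal H as a sum of rank-one terms: [z s] is a full-length column carried by one
    cluster, and all clusters share the parameter of the effect [s.2]. *)
Definition cov_mx (th : K -> R) : 'M[R]_N :=
  1%:M + \sum_(s | s.2 \in g) th s.2 *: (z s *m (z s)^T).
Definition gls_ss (th : K -> R) : R :=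
  (y^T *m invmx (cov_mx th) *m (1%:M - Mmat Xa (cov_mx th)) *m y) 0 0.
Definition profile_obj (th : K -> R) (v2 : R) : R :=
  N%:R * ln v2 + ln (\det (cov_mx th)) + gls_ss th / v2.
Definition nonneg (th : K -> R) := forall k, k \in g -> 0 <= th k.

Lemma cov_mx_add th c : cov_mx (fun k => th k + c k) =
  cov_mx th + \sum_(s | s.2 \in g) c s.2 *: (z s *m (z s)^T).
Proof.
rewrite /cov_mx -addrA -big_split/=; congr (_ + _).
by apply: eq_bigr => s _; rewrite scalerDl.
Qed.

Lemma cov_mx_spd th : nonneg th -> spd (cov_mx th).
Proof. by move=> th0; case: (spd_sum (index_enum _) z (spd1 R N) (fun s => th0 s.2)). Qed.

Lemma cov_mx_mul th x : cov_mx th *m x = x + \sum_(s | s.2 \in g) (th s.2 * dot (z s) x) *: z s.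
Proof.
rewrite /cov_mx mulmxDl mul1mx mulmx_suml; congr (_ + _).
by apply: eq_bigr => s _; rewrite -scalemxAl rank1_mul scalerA.
Qed.

Lemma cov_mx_quad th x : dot x (cov_mx th *m x) = dot x x + \sum_(s | s.2 \in g) th s.2 * dot (z s) x ^+ 2.
Proof.
rewrite cov_mx_mul dotDr dot_sumr; congr (_ + _); apply: eq_bigr => s _.
by rewrite dotZr (dotC x) expr2 mulrA.
Qed.

Lemma lndet_cov_le th c : nonneg th -> nonneg c ->
  ln (\det (cov_mx (fun k => th k + c k))) <= ln (\det (cov_mx th)) +
   \sum_(s | s.2 \in g) c s.2 * dot (z s) (invmx (cov_mx th) *m z s).
Proof. by move=> th0 c0; rewrite cov_mx_add lndet_sum_le//; [exact: cov_mx_spd|move=> s; exact: c0]. Qed.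

Lemma lndet_cov_ge th c : nonneg th -> nonneg c ->
  ln (\det (cov_mx th)) + \sum_(s | s.2 \in g)
     ln (1 + c s.2 * dot (z s) (invmx (cov_mx (fun k => th k + c k)) *m z s)) <=
  ln (\det (cov_mx (fun k => th k + c k))).
Proof. by move=> th0 c0; rewrite cov_mx_add; apply: lndet_sum_ge; [exact: cov_mx_spd|move=> s; exact: c0]. Qed.

Lemma cov_mx_inv_le th x : nonneg th -> dot x (invmx (cov_mx th) *m x) <= dot x x.
Proof.
move=> th0; have [_] := spd_sum (index_enum _) z (spd1 R N) (fun s => th0 s.2).
by move=> /(_ x); rewrite invmx1 mul1mx.
Qed.

(** With x = H^-1 z and d = z'x one has d = x'Hx, and keeping only the term of [s] in this quadratic
    form leaves th d^2 <= d. *)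
Lemma cov_mx_inv_leV th s : nonneg th -> s.2 \in g -> 0 < th s.2 ->
  th s.2 * dot (z s) (invmx (cov_mx th) *m z s) <= 1.
Proof.
move=> th0 sg ths; set x := invmx _ *m _; set d := dot _ _.
have hH := cov_mx_spd th0.
have xHx : dot x (cov_mx th *m x) = d by rewrite spd_invK// dotC.
have : th s.2 * d ^+ 2 <= d.
  rewrite -[X in _ <= X]xHx cov_mx_quad (bigD1 s)//= addrCA lerDl addr_ge0 ?dot_ge0//.
  by apply: sumr_ge0 => t /andP[tg _]; rewrite mulr_ge0 ?sqr_ge0 ?th0.
have : 0 <= d by exact: spd_inv_ge0.
rewrite le_eqVlt => /predU1P[<-|d0]; first by rewrite mulr0 ler01.
by rewrite expr2 mulrA -ler_pdivlMr// divff ?gt_eqF.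
Qed.

Hypothesis injX : forall b : 'cV[R]_r, Xa *m b = 0 -> b = 0.

(** Here x = H^-1 (y - Xa b). Since H x is x plus the terms th (z'x) z, the numbers th (z'x) are the
    predicted effects and [x] is the residual after removing them. *)
Lemma gls_exists th : nonneg th -> exists b x, [/\ Xa^T *m x = 0,
  x = y - Xa *m b - \sum_(s | s.2 \in g) (th s.2 * dot (z s) x) *: z s &
  gls_ss th = dot x x + \sum_(s | s.2 \in g) th s.2 * dot (z s) x ^+ 2].
Proof.
move=> th0; have hH := cov_mx_spd th0.
have [b [x [h1 h2 h3]]] := gls_solution y hH injX.
exists b, x; split => //.
  by rewrite -h2 cov_mx_mul addrK.
rewrite /gls_ss /Mmat h3 -cov_mx_quad h2 dotBr dot_mulr h1 (dotC 0) dot0r subr0.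
exact: dotC.
Qed.

(* Mixed-model form of the profile sum of squares: the penalized least squares value at any
   fixed and random effects is an upper bound.  A coordinate with [th = 0] contributes
   [u ^+ 2 / 0 = 0], whence the condition on [u]. *)
Lemma gls_ss_le th b (u : I * K -> R) rho : nonneg th ->
  (forall s, s.2 \in g -> th s.2 = 0 -> u s = 0) ->
  rho = y - Xa *m b - \sum_(s | s.2 \in g) u s *: z s ->
  gls_ss th <= dot rho rho + \sum_(s | s.2 \in g) u s ^+ 2 / th s.2.
Proof.
move=> th0 u0 rhoE.
have [b' [x [h1 h2 ->]]] := gls_exists th0.
set q := _ + _.
have Eq : q = dot (y - Xa *m b) x.
  rewrite /q dotBl (dotC (Xa *m b)) dot_mulr h1 (dotC 0) dot0r subr0.
  have -> : y = Xa *m b' + cov_mx th *m x.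
    rewrite cov_mx_mul; set S := \sum_(_ | _) _ in h2 *.
    by rewrite {1}h2 subrK addrC subrK.
  rewrite dotDl (dotC (Xa *m b')) dot_mulr h1 (dotC 0) dot0r add0r.
  by rewrite dotC cov_mx_quad.
(* The first copy is read as the linear form (y - Xa b)'x and the second as the quadratic form of
   [x]; what remains is two completed squares, |rho - x|^2 and (u - th z'x)^2 / th. *)
have -> : q = 2 * q - q by ring.
rewrite {1}Eq; have -> : y - Xa *m b = rho + \sum_(s | s.2 \in g) u s *: z s.
  by rewrite rhoE subrK.
rewrite dotDl dot_suml /q mulrDr.
have r0 := dot_ge0 (rho - x).
rewrite dot_subr_ge in r0.
suff : \sum_(s | s.2 \in g) (2 * dot (u s *: z s) x) - \sum_(s | s.2 \in g) th s.2 * dot (z s) x ^+ 2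
   <= \sum_(s | s.2 \in g) u s ^+ 2 / th s.2 by rewrite -mulr_sumr; lra.
rewrite -sumrB; apply: ler_sum => s sg; rewrite dotZl.
have := th0 _ sg; rewrite le_eqVlt => /predU1P[t0|t0].
  by rewrite u0// -t0 !mul0r mulr0 subr0 expr0n mul0r.
set d := dot _ _; set t := th _ in t0 *.
rewrite -subr_ge0; have -> : u s ^+ 2 / t - (2 * (u s * d) - t * d ^+ 2) = (u s - t * d) ^+ 2 / t.
  by field; rewrite gt_eqF.
by rewrite mulr_ge0 ?sqr_ge0// invr_ge0 ltW.
Qed.

End Profile.

(** * Finite-sample bounds for maximum likelihood estimators *)

(** Stands for the limit h -> 0 when a finite perturbation gives an inequality with an error linear
    in [h]. *)
Lemma le_of_small (R : realFieldType) (a c d : R) (x : R) : 0 < x ->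
  (forall h, 0 < h -> h < x -> a - c * h <= d) -> a <= d.
Proof.
move=> x0 H; rewrite leNgt; apply/negP => da.
have p : 0 < 1 + `|c| by rewrite ltr_pwDl.
pose h := Num.min (x / 2) ((a - d) / 2 / (1 + `|c|)).
have h0 : 0 < h by rewrite lt_min !divr_gt0//; lra.
have := H _ h0; have -> : h < x by rewrite /h gt_min; apply/orP; left; lra.
move=> /(_ isT).
have : c * h <= (1 + `|c|) * h by rewrite ler_pM2r//; have := ler_norm c; lra.
have : (1 + `|c|) * h <= (a - d) / 2.
  by rewrite mulrC -ler_pdivlMr// /h ge_min lexx orbT.
by lra.
Qed.

Section MLBounds.
Variables (R : realType) (N r : nat) (I K : finType) (z : I * K -> 'cV[R]_N).
Variables (g G0 : {set K}) (Xa : 'M[R]_(N, r)) (y eps : 'cV[R]_N) (bb : 'cV[R]_r).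
Variables (b : I * K -> R) (nl : I -> R) (S kap K2 : R).
Variables (th : K -> R) (v2 : R).
Hypothesis sG0 : G0 \subset g.
Hypothesis bG0 : forall s, s.2 \notin G0 -> b s = 0.
Hypothesis yE : y = Xa *m bb + \sum_(s | s.2 \in g) b s *: z s + eps.
Hypothesis injX : forall b : 'cV[R]_r, Xa *m b = 0 -> b = 0.
Hypothesis nl0 : forall i, 0 < nl i.
Hypothesis S0 : 0 < S.
Hypothesis kap0 : 0 < kap.

(** The norm in which the design is well conditioned: in the application [nl i] is n_i^l and [S] is
    the sum of the n_i^xi, the orders of the squared columns. *)
Definition energy (d : 'cV[R]_r) (w : I * K -> R) :=
  S * dot d d + \sum_(s | s.2 \in g) nl s.1 * w s ^+ 2.
Definition lincomb (d : 'cV[R]_r) (w : I * K -> R) :=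
  Xa *m d + \sum_(s | s.2 \in g) w s *: z s.

Hypothesis gram : forall d w, kap * energy d w <= dot (lincomb d w) (lincomb d w).
(** Young's inequality for the noise, with [K2] its squared projection; the weight kap / 2 is the
    share that [energy_bound] can absorb into [gram]. *)
Hypothesis noise : forall d w,
  2 * dot eps (lincomb d w) <= kap * energy d w / 2 + 2 * K2 / kap.
Hypothesis th0 : nonneg g th.
Hypothesis v20 : 0 < v2.
Hypothesis opt : forall th' v2', nonneg g th' -> 0 < v2' ->
  profile_obj z g Xa y th v2 <= profile_obj z g Xa y th' v2'.

Lemma energy_term d w s : s.2 \in g -> nl s.1 * w s ^+ 2 <= energy d w.
Proof.
move=> sg; rewrite /energy (bigD1 s)//= addrCA lerDl addr_ge0//.
  by rewrite mulr_ge0 ?dot_ge0 ?(ltW S0).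
by apply: sumr_ge0 => t _; rewrite mulr_ge0 ?sqr_ge0 ?(ltW (nl0 _)).
Qed.

Lemma energy_bound d w E :
  dot (eps - lincomb d w) (eps - lincomb d w) <= dot eps eps + E ->
  energy d w <= 2 / kap * (2 * K2 / kap + E).
Proof.
rewrite dot_subr_ge => h.
have g0 := gram d w; have n0 := noise d w.
rewrite -(ler_pM2l kap0) mulrA (mulrCA kap) divff ?gt_eqF// mulr1.
by lra.
Qed.

(** Only theta is moved and [v2] is kept, so the terms in ln v2 cancel. *)
Lemma gls_ss_diff th' : nonneg g th' ->
  gls_ss z g Xa y th - gls_ss z g Xa y th' <=
  v2 * (ln (\det (cov_mx z g th')) - ln (\det (cov_mx z g th))).
Proof.
move=> /opt/(_ v20); rewrite /profile_obj => h.
rewrite -ler_pdivrMl// mulrC mulrBl; lra.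
Qed.

(** Lowering the variance to v' < v2 saves at least N (1 - v'/v2) in the logarithm and costs gls
    (1/v' - 1/v2); optimality compares the two, and v' tends to v2. *)
Lemma v2_le : N%:R * v2 <= gls_ss z g Xa y th.
Proof.
have key v' : 0 < v' -> v' < v2 -> N%:R * v' <= gls_ss z g Xa y th.
  move=> v'0 v'v; have := opt th0 v'0; rewrite /profile_obj.
  set Q := gls_ss _ _ _ _ _ => h.
  have r0 : 0 < v' / v2 by rewrite divr_gt0.
  have : ln (1 + (v' / v2 - 1)) <= v' / v2 - 1 by apply: le_ln1Dx; lra.
  rewrite subrKC ln_div ?posrE// => h1.
  have h2 : N%:R * (1 - v' / v2) <= Q * (v'^-1 - v2^-1).
    have : N%:R * (1 - v' / v2) <= N%:R * (ln v2 - ln v') by rewrite ler_wpM2l ?ler0n//; lra.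
    by rewrite mulrBr (mulrBr Q); lra.
  have e1 : 1 - v' / v2 = (v2 - v') / v2 by field; rewrite gt_eqF.
  have e2 : v'^-1 - v2^-1 = (v2 - v') / v2 / v' by field; rewrite !gt_eqF.
  have p : 0 < (v2 - v') / v2 by rewrite divr_gt0// subr_gt0.
  rewrite -(ler_pM2r p); move: h2; rewrite e1 e2 => /(ler_wpM2r (ltW v'0)).
  have -> : Q * ((v2 - v') / v2 / v') * v' = Q * ((v2 - v') / v2) by field; rewrite !gt_eqF.
  by rewrite mulrAC.
apply: (@le_of_small _ _ N%:R _ _ v20) => h h0 hv.
by rewrite -mulrBr key//; lra.
Qed.

(** Zero random effects carry no penalty, so this bound holds however small theta is. *)
Lemma v2_le_resid : N%:R * v2 <= dot (y - Xa *m bb) (y - Xa *m bb).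
Proof.
apply: le_trans v2_le _.
have := @gls_ss_le _ _ _ _ _ z g Xa y injX th bb (fun=> 0) (y - Xa *m bb) th0 (fun _ _ _ => erefl).
rewrite big1 => [|s _]; last by rewrite scale0r.
rewrite big1 => [|s _]; last by rewrite expr0n mul0r.
by rewrite subr0 addr0; apply.
Qed.

Section Blup.
Variables (bh : 'cV[R]_r) (x : 'cV[R]_N).
Let u s := th s.2 * dot (z s) x.
Hypothesis xE : x = y - Xa *m bh - \sum_(s | s.2 \in g) u s *: z s.
Hypothesis QE : gls_ss z g Xa y th = dot x x + \sum_(s | s.2 \in g) th s.2 * dot (z s) x ^+ 2.

Lemma gls_ss_blup : gls_ss z g Xa y th = dot x x + \sum_(s | s.2 \in g) u s ^+ 2 / th s.2.
Proof.
rewrite QE; congr (_ + _); apply: eq_bigr => s sg; rewrite /u exprMn.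
have := th0 sg; rewrite le_eqVlt => /predU1P[<-|t0]; first by rewrite invr0 mulr0 mul0r.
by field; rewrite gt_eqF.
Qed.

Lemma x_resid : x = eps - lincomb (bh - bb) (fun s => u s - b s).
Proof.
rewrite {1}xE yE /lincomb mulmxBr.
have -> : \sum_(s | s.2 \in g) (u s - b s) *: z s =
    \sum_(s | s.2 \in g) u s *: z s - \sum_(s | s.2 \in g) b s *: z s.
  by rewrite -sumrB; apply: eq_bigr => s _; rewrite scalerBl.
move: (Xa *m bb) (Xa *m bh) (\sum_(s | _) u s *: _) (\sum_(s | _) b s *: _) => p q v w.
by apply/matrixP => i j; rewrite !mxE; ring.
Qed.

(** The true effects serve as trial values. They vanish off [G0], so th' must be positive only
    there. *)
Lemma gls_ss_le_true th' : nonneg g th' -> (forall k, k \in G0 -> 0 < th' k) ->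
  gls_ss z g Xa y th' <= dot eps eps + \sum_(s | s.2 \in G0) b s ^+ 2 / th' s.2.
Proof.
move=> th'0 pos.
have -> : \sum_(s | s.2 \in G0) b s ^+ 2 / th' s.2 = \sum_(s | s.2 \in g) b s ^+ 2 / th' s.2.
  rewrite [in RHS](bigID (fun s => s.2 \in G0))/= [X in _ + X]big1 ?addr0.
    by apply: eq_bigl => s; case: (boolP (s.2 \in G0)); rewrite ?andbF// => /(fintype.subsetP sG0) ->.
  by move=> s /andP[_ /bG0 ->]; rewrite expr0n mul0r.
apply: (@gls_ss_le _ _ _ _ _ z g Xa y injX th' bb b) => //.
  move=> s sg t0; apply: bG0; apply/negP => /pos; by rewrite t0 ltxx.
rewrite yE; move: (Xa *m bb) (\sum_(_ | _) _ *: _) => v w.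
by apply/matrixP => i j; rewrite !mxE; ring.
Qed.

(** The residual [x] is the noise minus the design applied to the estimation errors ([x_resid]);
    dropping the nonnegative penalty reduces the claim to [energy_bound]. *)
Lemma blup_error E s :
  gls_ss z g Xa y th <= dot eps eps + E -> s.2 \in g ->
  nl s.1 * (u s - b s) ^+ 2 <= 2 / kap * (2 * K2 / kap + E).
Proof.
move=> h sg; apply: le_trans (energy_term (bh - bb) (fun s => u s - b s) sg) _.
apply: energy_bound; rewrite -x_resid; apply: le_trans _ h.
rewrite QE lerDl; apply: sumr_ge0 => t tg.
by rewrite mulr_ge0 ?sqr_ge0 ?th0.
Qed.

(* Here [th] may vanish on [G0], so [th] is compared with [th + c] on [G0]; concavity of
   [ln det] bounds the price by a trace, of order [c] times the squared column norms. *)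
Lemma blup_error_crude c s : 0 < c -> s.2 \in g ->
  nl s.1 * (u s - b s) ^+ 2 <= 2 / kap * (2 * K2 / kap +
    (v2 * (c * \sum_(s | s.2 \in G0) dot (z s) (z s)) + \sum_(s | s.2 \in G0) b s ^+ 2 / c)).
Proof.
move=> c0; apply: blup_error.
pose cc k := if k \in G0 then c else 0.
have cc0 : nonneg g cc by move=> k _; rewrite /cc; case: ifP => // _; exact: ltW.
pose th' k := th k + cc k.
have th'0 : nonneg g th' by move=> k kg; rewrite addr_ge0 ?th0 ?cc0.
have := gls_ss_diff th'0.
have := lndet_cov_le z th0 cc0; rewrite -/th'.
have -> : \sum_(s | s.2 \in g) cc s.2 * dot (z s) (invmx (cov_mx z g th) *m z s) =
    \sum_(s | s.2 \in G0) c * dot (z s) (invmx (cov_mx z g th) *m z s).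
  rewrite (bigID (fun s => s.2 \in G0))/= [X in _ + X]big1 ?addr0.
    apply: eq_big => [t|t /andP[_ tG]]; last by rewrite /cc tG.
    by case: (boolP (t.2 \in G0)); rewrite ?andbF// => /(fintype.subsetP sG0) ->.
  by move=> t /andP[_ /negPf tG]; rewrite /cc tG mul0r.
have : \sum_(s | s.2 \in G0) c * dot (z s) (invmx (cov_mx z g th) *m z s) <=
   c * \sum_(s | s.2 \in G0) dot (z s) (z s).
  by rewrite -mulr_sumr ler_wpM2l ?(ltW c0)//; apply: ler_sum => t _; exact: cov_mx_inv_le.
move=> h1 h2 h3.
have h4 : v2 * (ln (\det (cov_mx z g th')) - ln (\det (cov_mx z g th))) <=
   v2 * (c * \sum_(s | s.2 \in G0) dot (z s) (z s)) by rewrite ler_wpM2l ?(ltW v20)//; lra.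
have h5 : gls_ss z g Xa y th' <= dot eps eps + \sum_(s | s.2 \in G0) b s ^+ 2 / th' s.2.
  apply: gls_ss_le_true => // k kG; rewrite /th' /cc kG ltr_wpDl// th0//.
  exact: (fintype.subsetP sG0).
have h6 : \sum_(s | s.2 \in G0) b s ^+ 2 / th' s.2 <= \sum_(s | s.2 \in G0) b s ^+ 2 / c.
  apply: ler_sum => t tG; rewrite ler_wpM2l ?sqr_ge0// lef_pV2 ?posrE//.
    by rewrite /th' /cc tG lerDr th0// (fintype.subsetP sG0).
  by rewrite /th' /cc tG ltr_wpDl// th0// (fintype.subsetP sG0).
by lra.
Qed.

(** Once theta is bounded below on [G0], the true effects are affordable at [th] itself and no
    determinant has to be compared. *)
Lemma blup_error_fine t0 s : 0 < t0 -> (forall k, k \in G0 -> t0 <= th k) -> s.2 \in g ->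
  nl s.1 * (u s - b s) ^+ 2 <= 2 / kap * (2 * K2 / kap + \sum_(s | s.2 \in G0) b s ^+ 2 / t0).
Proof.
move=> t00 tt; apply: blup_error.
apply: le_trans (gls_ss_le_true th0 _) _ => [k /tt|]; first exact: lt_le_trans.
rewrite lerD2l; apply: ler_sum => t /tt tG.
by rewrite ler_wpM2l ?sqr_ge0// lef_pV2 ?posrE// (lt_le_trans t00).
Qed.

(** * First-order condition in one variance component *)

Section Coordinate.
Variable k : K.
Hypotheses (kg : k \in g) (tk : 0 < th k).
Let s_ i := dot (z (i, k)) (invmx (cov_mx z g th) *m z (i, k)).
Let B0 := \sum_i u (i, k) ^+ 2.

Lemma sum_pair_col (F : I * K -> R) :
  (forall s, s.2 != k -> F s = 0) -> \sum_(s | s.2 \in g) F s = \sum_i F (i, k).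
Proof.
move=> F0; rewrite (bigID (fun s => s.2 == k))/= [X in _ + X]big1 ?addr0; last first.
  by move=> s /andP[_ /F0].
rewrite (reindex (fun i => (i, k)))/=.
  by apply: eq_bigl => i; rewrite kg eqxx.
by exists fst => [i _//|[i j]]; rewrite inE/= => /andP[_ /eqP->].
Qed.

(** The predictor for [th] is kept as trial value at [th'], so only the penalty of the coordinate
    [k] changes. This replaces differentiating the profile. *)
Lemma gls_ss_shift th' : nonneg g th' -> 0 < th' k -> (forall j, j != k -> th' j = th j) ->
  gls_ss z g Xa y th' - gls_ss z g Xa y th <= B0 * ((th' k)^-1 - (th k)^-1).
Proof.
move=> th'0 tk' e.
have : gls_ss z g Xa y th' <= dot x x + \sum_(s | s.2 \in g) u s ^+ 2 / th' s.2.
  apply: (@gls_ss_le _ _ _ _ _ z g Xa y injX th' bh u) => // s sg t0.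
  have [sk|sk] := eqVneq s.2 k; first by move: tk'; rewrite -sk t0 ltxx.
  by rewrite /u -e// t0 mul0r.
rewrite gls_ss_blup => h.
suff <- : \sum_(s | s.2 \in g) (u s ^+ 2 / th' s.2 - u s ^+ 2 / th s.2) = B0 * ((th' k)^-1 - (th k)^-1).
  by rewrite sumrB; lra.
rewrite sum_pair_col => [|s sk]; last by rewrite e// subrr.
by rewrite mulr_suml; apply: eq_bigr => i _; rewrite mulrBr.
Qed.

Let hk (h : R) j := if j == k then h else 0.

Lemma s_ge0 i : 0 <= s_ i.
Proof. by apply: spd_inv_ge0; apply: cov_mx_spd. Qed.

Lemma s_le i : th k * s_ i <= 1.
Proof. exact: (@cov_mx_inv_leV _ _ _ _ z g th (i, k) th0 kg tk). Qed.

(* [blup_le] and [score_le] are the two halves of the first-order condition in [th k]. *)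
Lemma blup_le : B0 <= #|I|%:R * (th k * v2).
Proof.
apply: (@le_of_small _ _ (v2 * #|I|%:R) _ 1) => // h h0 _.
have h00 : nonneg g (hk h) by move=> j _; rewrite /hk; case: ifP => // _; exact: ltW.
pose th' j := th j + hk h j.
have th'0 : nonneg g th' by move=> j jg; rewrite addr_ge0 ?th0 ?h00.
have tk'E : th' k = th k + h by rewrite /th' /hk eqxx.
have tk' : 0 < th' k by rewrite tk'E addr_gt0.
have h1 : gls_ss z g Xa y th' - gls_ss z g Xa y th <= B0 * ((th k + h)^-1 - (th k)^-1).
  rewrite -tk'E; apply: gls_ss_shift => // j /negPf jk.
  by rewrite /th' /hk jk addr0.
have := gls_ss_diff th'0.
have := lndet_cov_le z th0 h00; rewrite -/th' sum_pair_col => [|[i j]/= /negPf jk]; last first.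
  by rewrite /hk jk mul0r.
have hkk : hk h k = h by rewrite /hk eqxx.
rewrite /= hkk -mulr_sumr => h2 h3.
have h4 : \sum_i s_ i <= #|I|%:R / th k.
  rewrite -sum1_card natr_sum mulr_suml; apply: ler_sum => i _.
  by rewrite ler_pdivlMr// mulrC s_le.
have h5 : v2 * (ln (\det (cov_mx z g th')) - ln (\det (cov_mx z g th))) <= v2 * (h * (#|I|%:R / th k)).
  rewrite ler_wpM2l ?(ltW v20)//; apply: (@le_trans _ _ (h * \sum_i s_ i)).
    by rewrite lerBlDl.
  by rewrite ler_wpM2l ?(ltW h0).
have h6 : B0 * ((th k)^-1 - (th k + h)^-1) <= v2 * (h * (#|I|%:R / th k)) by lra.
have tkh : 0 < th k + h by rewrite addr_gt0.
have e1 : (th k)^-1 - (th k + h)^-1 = h / th k / (th k + h) by field; rewrite !gt_eqF.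
(* Multiplying by this factor clears the reciprocals and leaves B0 <= v2 #|I| (th k + h). *)
have p : 0 < (th k + h) * th k / h by rewrite divr_gt0// mulr_gt0.
move: h6; rewrite -(ler_pM2r p) e1.
have -> : B0 * (h / th k / (th k + h)) * ((th k + h) * th k / h) = B0 by field; rewrite !gt_eqF.
have -> : v2 * (h * (#|I|%:R / th k)) * ((th k + h) * th k / h) = v2 * #|I|%:R * (th k + h).
  by field; rewrite !gt_eqF.
by lra.
Qed.

Lemma score_le : v2 * th k ^+ 2 * \sum_i s_ i <= B0.
Proof.
apply: (@le_of_small _ _ (v2 * th k * \sum_i s_ i + B0 / th k) _ (th k)) => // h h0 hk1.
have h00 : nonneg g (hk h) by move=> j _; rewrite /hk; case: ifP => // _; exact: ltW.
pose th' j := th j - hk h j.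
have th'0 : nonneg g th'.
  move=> j jg; rewrite /th' /hk; case: eqP => [->|_]; last by rewrite subr0 th0.
  by rewrite subr_ge0 ltW.
have tk'E : th' k = th k - h by rewrite /th' /hk eqxx.
have tk' : 0 < th' k by rewrite tk'E subr_gt0.
have h1 : gls_ss z g Xa y th' - gls_ss z g Xa y th <= B0 * ((th k - h)^-1 - (th k)^-1).
  rewrite -tk'E; apply: gls_ss_shift => // j /negPf jk.
  by rewrite /th' /hk jk subr0.
have := gls_ss_diff th'0.
have := lndet_cov_ge z th'0 h00.
(* The decreased point plus the step is [th] again, so the forms in [lndet_cov_ge] are evaluated at
   the optimum. *)
have -> : (fun j => th' j + hk h j) = th by apply/funext => j; rewrite /th' subrK.
rewrite sum_pair_col => [|[i j]/= /negPf jk]; last by rewrite /hk jk mul0r addr0 ln1.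
have hkk : hk h k = h by rewrite /hk eqxx.
rewrite /= hkk => h2 h3.
(* From ln(1 + h s) >= h s / (1 + h s), where th s <= 1 bounds the denominator by (th + h) / th. *)
have h4 : h * th k / (th k + h) * \sum_i s_ i <= \sum_i ln (1 + h * s_ i).
  rewrite mulr_sumr; apply: ler_sum => i _; apply: le_trans (ln1p_ge _); last first.
    by rewrite mulr_ge0 ?s_ge0 ?(ltW h0).
  have si := s_le i; have s0 := s_ge0 i.
  have q : 0 < 1 + h * s_ i by rewrite ltr_pwDl// mulr_ge0// ltW.
  have tkh : 0 < th k + h by rewrite addr_gt0.
  have -> : h * th k / (th k + h) * s_ i = (h * s_ i) * (th k / (th k + h)).
    by field; rewrite gt_eqF.
  rewrite ler_wpM2l ?mulr_ge0 ?(ltW h0)// ler_pdivrMr// mulrC ler_pdivlMr//.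
  have : h * (th k * s_ i) <= h * 1 by rewrite ler_wpM2l// ltW.
  lra.
have h5 : v2 * (ln (\det (cov_mx z g th')) - ln (\det (cov_mx z g th))) <=
    - (v2 * (h * th k / (th k + h) * \sum_i s_ i)).
  by rewrite -mulrN ler_wpM2l ?(ltW v20)//; move: h2; rewrite -/(s_ _); lra.
have h6 : v2 * (h * th k / (th k + h) * \sum_i s_ i) <= B0 * ((th k - h)^-1 - (th k)^-1) by lra.
have tkh : 0 < th k + h by rewrite addr_gt0.
have e1 : (th k - h)^-1 - (th k)^-1 = h / th k / (th k - h).
  by field; rewrite !gt_eqF// subr_gt0.
have p : 0 < (th k + h) * (th k - h) / h by rewrite divr_gt0// mulr_gt0// subr_gt0.
move: h6; rewrite -(ler_pM2r p) e1.
have -> : B0 * (h / th k / (th k - h)) * ((th k + h) * (th k - h) / h) = B0 + B0 / th k * h.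
  by field; rewrite !gt_eqF// subr_gt0.
have -> : v2 * (h * th k / (th k + h) * \sum_i s_ i) * ((th k + h) * (th k - h) / h) =
   v2 * th k ^+ 2 * \sum_i s_ i - (v2 * th k * \sum_i s_ i) * h.
  by field; rewrite !gt_eqF.
by lra.
Qed.

(** The vector H^-1 z is a combination of columns with coefficient 1 - th s on its own column.
    Coercivity bounds its squared length below by kap n (1 - th s)^2, while z'H^-1 z bounds it above
    by s (1 - th s); cancelling one factor and using th s <= 1 gives the claim. *)
Lemma s_lower i : 1 - (th k * kap * nl i)^-1 <= th k * s_ i.
Proof.
pose xx := invmx (cov_mx z g th) *m z (i, k).
have hH := cov_mx_spd z th0.
have Hx : cov_mx z g th *m xx = z (i, k) by rewrite spd_invK.
have sE : s_ i = dot xx (cov_mx z g th *m xx) by rewrite Hx dotC.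
(* Coefficients of [xx], read from H xx = z as xx = z minus the terms th (z'xx) z. *)
pose w s : R := (s == (i, k))%:R - th s.2 * dot (z s) xx.
have xxE : xx = lincomb 0 w.
  rewrite /lincomb mulmx0 add0r.
  have -> : \sum_(s | s.2 \in g) w s *: z s = z (i, k) - \sum_(s | s.2 \in g) (th s.2 * dot (z s) xx) *: z s.
    transitivity (\sum_(s | s.2 \in g) ((s == (i, k))%:R *: z s - (th s.2 * dot (z s) xx) *: z s)).
      by apply: eq_bigr => s _; rewrite scalerBl.
    rewrite sumrB; congr (_ - _); rewrite (bigD1 (i, k))//= eqxx scale1r big1 ?addr0//.
    by move=> s /andP[_ /negPf ->]; rewrite scale0r.
  by have := cov_mx_mul z g th xx; rewrite Hx => {1}->; rewrite addrK.
have h1 : kap * (nl i * (1 - th k * s_ i) ^+ 2) <= dot xx xx.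
  rewrite [in leRHS]xxE; apply: le_trans (gram 0 w).
  rewrite ler_pM2l//; apply: le_trans (@energy_term 0 w (i, k) kg).
  by rewrite /w/= eqxx lexx.
have h2 : dot xx xx + th k * s_ i ^+ 2 <= s_ i.
  rewrite [leRHS]sE cov_mx_quad lerD2l (bigD1 (i, k))//= lerDl.
  by apply: sumr_ge0 => s /andP[sg _]; rewrite mulr_ge0 ?sqr_ge0 ?th0.
have si := s_le i; have s0 := s_ge0 i.
set a := th k * s_ i in h1 si *.
have ae : th k * s_ i ^+ 2 = a * s_ i by rewrite expr2 mulrA.
have h3 : kap * nl i * (1 - a) ^+ 2 <= s_ i * (1 - a).
  by rewrite -mulrA; apply: le_trans h1 _; rewrite ae in h2; lra.
have kn : 0 < kap * nl i by rewrite mulr_gt0.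
have [->|a1] := eqVneq a 1.
  by rewrite lerBlDr lerDl invr_ge0 !mulr_ge0// ltW// nl0.
have a1' : 0 < 1 - a by rewrite subr_gt0 lt_neqAle a1.
move: h3; rewrite expr2 mulrA ler_pM2r// => h3.
have h4 : th k * kap * nl i * (1 - a) <= 1.
  by rewrite -2!mulrA mulrA -mulrA; apply: le_trans si; rewrite /a ler_pM2l// mulrA.
have q : 0 < th k * kap * nl i by rewrite !mulr_gt0// nl0.
have : 1 - a <= (th k * kap * nl i)^-1 by rewrite -ler_pdivlMl// in h4; rewrite mulr1 in h4.
by lra.
Qed.

Lemma blup_ge : #|I|%:R * (th k * v2) <= B0 + v2 / kap * \sum_i (nl i)^-1.
Proof.
rewrite -lerBlDr; apply: le_trans score_le.
have -> : #|I|%:R * (th k * v2) - v2 / kap * \sum_i (nl i)^-1 =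
   v2 * th k * \sum_i (1 - (th k * kap * nl i)^-1).
  rewrite sumrB sumr_const -mulr_natl mulr1 mulrBr; congr (_ - _); first by ring.
  rewrite !mulr_sumr; apply: eq_bigr => i _; field.
  by rewrite !gt_eqF.
have -> : v2 * th k ^+ 2 * \sum_i s_ i = v2 * th k * \sum_i (th k * s_ i).
  by rewrite -mulr_sumr; ring.
rewrite ler_wpM2l ?mulr_ge0 ?(ltW v20) ?(ltW tk)//; apply: ler_sum => i _.
exact: s_lower.
Qed.

End Coordinate.
End Blup.
End MLBounds.

(** * The mixed model *)

Lemma sum_pair_half (R : realFieldType) (S : finType) (P : pred S) (F : S -> R) :
  \sum_(s | P s) \sum_(t | P t) (F s + F t) / 2 = #|P|%:R * \sum_(s | P s) F s.
Proof.
have E s : \sum_(t | P t) (F s + F t) / 2 = #|P|%:R * F s / 2 + (\sum_(t | P t) F t) / 2.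
  by rewrite -mulr_suml big_split/= sumr_const -[F s *+ _]mulr_natl mulrDl.
rewrite (eq_bigr _ (fun s _ => E s)) big_split/= sumr_const -[_ *+ #|P|]mulr_natl.
by rewrite -mulr_suml -mulr_sumr; field.
Qed.
Lemma sum_pair_diag (R : realFieldType) (S : finType) (F : S -> R) :
  \sum_s \sum_t (s == t)%:R * F s = \sum_s F s.
Proof.
apply: eq_bigr => s _; rewrite (bigD1 s)//= eqxx mul1r big1 ?addr0// => t /negPf.
by rewrite eq_sym => ->; rewrite mul0r.
Qed.

(** Each off-diagonal product is split by |A_s A_t| <= (A_s^2 + A_t^2) / 2; summed over all pairs
    this charges every square at most rho times the number of columns. *)
Lemma gram_dominance (R : realFieldType) n (S : finType) (V : S -> 'cV[R]_n)
    (a x : S -> R) (rho d : R) : 0 <= rho -> (forall s, 0 <= a s) ->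
  (forall s, d * a s ^+ 2 <= dot (V s) (V s)) ->
  (forall s t, s != t -> `|dot (V s) (V t)| <= rho * (a s * a t)) ->
  (d - rho * #|S|%:R) * \sum_s (a s * x s) ^+ 2 <=
    dot (\sum_s x s *: V s) (\sum_s x s *: V s).
Proof.
move=> rho0 a0 diag off; pose A s := a s * x s.
have -> : (d - rho * #|S|%:R) * \sum_s (a s * x s) ^+ 2 =
    \sum_s \sum_t ((s == t)%:R * (d * A s ^+ 2) - rho * ((A s ^+ 2 + A t ^+ 2) / 2)).
  under [RHS]eq_bigr => s _ do rewrite sumrB -mulr_sumr.
  rewrite sumrB sum_pair_diag -!mulr_sumr (sum_pair_half predT (fun s => A s ^+ 2)).
  by rewrite -/A mulrA -mulrBl.
rewrite dot_suml; apply: ler_sum => s _.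
rewrite dot_sumr; apply: ler_sum => t _; rewrite dotZl dotZr.
have [<-|st] := eqVneq s t.
  rewrite mul1r; have : 0 <= rho * A s ^+ 2 by rewrite mulr_ge0 ?sqr_ge0.
  have : x s ^+ 2 * (d * a s ^+ 2) <= x s ^+ 2 * dot (V s) (V s).
    by rewrite ler_wpM2l ?sqr_ge0.
  rewrite /A; lra.
rewrite mul0r sub0r.
have h1 : `|x s * (x t * dot (V s) (V t))| <= rho * (`|A s| * `|A t|).
  rewrite !normrM (ger0_norm (a0 s)) (ger0_norm (a0 t)).
  have -> : rho * (a s * `|x s| * (a t * `|x t|)) = `|x s| * (`|x t| * (rho * (a s * a t))) by ring.
  by rewrite !ler_wpM2l ?normr_ge0 ?off.
have h2 : rho * (`|A s| * `|A t|) <= rho * ((A s ^+ 2 + A t ^+ 2) / 2).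
  rewrite ler_wpM2l// -(real_normK (num_real (A s))) -(real_normK (num_real (A t))).
  by have := sqr_ge0 (`|A s| - `|A t|); lra.
by move: h1; rewrite ler_norml => /andP[+ _]; lra.
Qed.

Section Model.
Variables (R : realType) (m : nat) (n : 'I_m -> nat) (p q : nat).
Variables (X : forall i : 'I_m, 'M[R]_(n i, p)) (Z : forall i : 'I_m, 'M[R]_(n i, q)).
Variables (a : {set 'I_p}) (g : {set 'I_q}).

Definition zcol (s : 'I_m * 'I_q) : 'cV[R]_(\sum_(i < m) n i) :=
  \mxcol_(i < m) (if i == s.1 then col s.2 (Z i) else 0).

Lemma dot_mxcol (U V : forall i : 'I_m, 'cV[R]_(n i)) :
  dot (\mxcol_i U i) (\mxcol_i V i) = \sum_i dot (U i) (V i).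
Proof. by rewrite /dot tr_mxcol mul_mxrow_mxcol summxE. Qed.

Lemma sum_pair_g (V : nmodType) (F : 'I_m * 'I_q -> V) :
  \sum_(s | s.2 \in g) F s = \sum_i \sum_(k in g) F (i, k).
Proof. by rewrite pair_big_dep/=; apply: eq_big => [[i k]|[i k] _]. Qed.

Lemma mxcol_sum_zcol (w : 'I_m * 'I_q -> R) :
  \sum_(s | s.2 \in g) w s *: zcol s =
  \mxcol_i (\sum_(k in g) w (i, k) *: col k (Z i)).
Proof.
rewrite sum_pair_g; apply/matrixP => j c.
rewrite [RHS]mxE summxE (bigD1 (tagnat.sig1 j))//= [X in _ + X]big1 ?addr0 => [|i /negPf ij].
  rewrite !summxE; apply: eq_bigr => k _.
  by rewrite mxE [zcol _ _ _]mxE/= eqxx [RHS]mxE.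
rewrite summxE big1// => k _.
by rewrite mxE [zcol _ _ _]mxE/= eq_sym ij mxE mulr0.
Qed.

Lemma HmatE th : Hmat Z g th = cov_mx zcol g th.
Proof.
(* The two matrices are compared through their action on vectors, where a block-diagonal product
   acts cluster by cluster. *)
have colP (B C : 'M[R]_(\sum_(i < m) n i)) : (forall v : 'cV_(\sum_(i < m) n i), B *m v = C *m v) -> B = C.
  move=> h; apply/matrixP => i j; have := h (col j 1%:M).
  by rewrite !colE !mul1mx -!colE => /matrixP/(_ i 0); rewrite !mxE.
apply: colP => v; rewrite -(submxcolK v); set V := submxcol v.
rewrite cov_mx_mul mxcol_sum_zcol mul_mxdiag_mxcol -mxcolD.
apply: eq_mxcol => i; rewrite mulmxDl mul1mx mulmx_suml; congr (_ + _).
apply: eq_bigr => k kg; rewrite -scalemxAl rank1_mul scalerA; congr (_ * _ *: _).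
rewrite dot_mxcol (bigD1 i)//= eqxx big1 ?addr0// => j /negPf ji.
by rewrite ji dotC dot0r.
Qed.

Lemma m2logLE y th v2 : m2logL X Z a g y th v2 =
  (\sum_(i < m) n i)%:R * ln (2 * pi) + profile_obj zcol g (Xsub (stackX X) a) y th v2.
Proof. by rewrite /m2logL /profile_obj HmatE /gls_ss !addrA. Qed.

Lemma is_ML_profile y th v2 : is_ML X Z a g y th v2 ->
  [/\ nonneg g th, 0 < v2 & forall th' v2', nonneg g th' -> 0 < v2' ->
  profile_obj zcol g (Xsub (stackX X) a) y th v2 <= profile_obj zcol g (Xsub (stackX X) a) y th' v2'].
Proof.
move=> [h1 h2 h3]; split=> // th' v2' p1 p2.
by have := h3 _ _ p1 p2; rewrite !m2logLE lerD2l.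
Qed.

Lemma Xsub_mul (d : 'cV[R]_#|a|) :
  Xsub (stackX X) a *m d = \mxcol_i (\sum_(j < #|a|) d j 0 *: col (enum_val j) (X i)).
Proof.
apply/matrixP => i c; rewrite !mxE summxE; apply: eq_bigr => j _.
by rewrite !mxE mulrC ord1.
Qed.

Variables (xe le tau rho dl : R).
Hypothesis n1 : forall i, (0 < n i)%N.
Let sx i := (n i)%:R `^ xe.
Let sz i := (n i)%:R `^ le.
Hypothesis rho0 : 0 <= rho.
Hypothesis gx : forall i j, dl * sx i <= dot (col j (X i)) (col j (X i)).
Hypothesis gz : forall i j, dl * sz i <= dot (col j (Z i)) (col j (Z i)).
Hypothesis gxx : forall i j j', j != j' ->
  `|dot (col j (X i)) (col j' (X i))| <= rho * (n i)%:R `^ (xe - tau).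
Hypothesis gzz : forall i j j', j != j' ->
  `|dot (col j (Z i)) (col j' (Z i))| <= rho * (n i)%:R `^ (le - tau).
Hypothesis gxz : forall i j j',
  `|dot (col j (X i)) (col j' (Z i))| <= rho * (n i)%:R `^ ((xe + le) / 2 - tau).
Hypothesis dims : forall i, rho * (p%:R + q%:R) * (n i)%:R `^ (- tau) <= dl / 2.

Let S := \sum_i sx i.

(** Dominance is applied in each cluster with weights n_i^(xe/2) and n_i^(le/2): the off-diagonal
    orders of (A1)-(A3) are products of two weights times n_i^(-tau), and [dims] outweighs the at
    most p + q columns. The fixed effects are common, so their weights add up to [S]. *)
Lemma gram_model (d : 'cV[R]_#|a|) (w : 'I_m * 'I_q -> R) :
  dl / 2 * energy g (fun i => sz i) S d w <=
  dot (lincomb zcol g (Xsub (stackX X) a) d w) (lincomb zcol g (Xsub (stackX X) a) d w).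
Proof.
rewrite /lincomb mxcol_sum_zcol Xsub_mul -mxcolD dot_mxcol.
rewrite /energy sum_pair_g/= /S mulr_suml -big_split/= mulr_sumr; apply: ler_sum => i _.
have n0 : 0 < (n i)%:R :> R by rewrite ltr0n.
have powD u v : (n i)%:R `^ u * (n i)%:R `^ v = (n i)%:R `^ (u + v) :> R.
  by rewrite powRD// (gt_eqF n0) implybT.
pose V (s : 'I_#|a| + 'I_q) := match s with inl j => col (enum_val j) (X i) | inr k => col k (Z i) end.
pose A (s : 'I_#|a| + 'I_q) := match s with inl j => (n i)%:R `^ (xe / 2) | inr k => (n i)%:R `^ (le / 2) end.
(* Coefficients vanish off [g], so the random-effect columns need no reindexing. *)
pose x (s : 'I_#|a| + 'I_q) := match s with inl j => d j 0 | inr k => if k \in g then w (i, k) else 0 end.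
have sqx (e : R) : ((n i)%:R `^ (e / 2)) ^+ 2 = (n i)%:R `^ e.
  by rewrite expr2 powD; congr (_ `^ _); field.
have := @gram_dominance R _ _ V A x (rho * (n i)%:R `^ (- tau)) dl.
have -> : \sum_s x s *: V s = \sum_(j < #|a|) d j 0 *: col (enum_val j) (X i)
    + \sum_(k in g) w (i, k) *: col k (Z i).
  rewrite big_sumType/=; congr (_ + _).
  rewrite [RHS]big_mkcond/=; apply: eq_bigr => k _; case: ifP => //.
  by rewrite scale0r.
have -> : \sum_s (A s * x s) ^+ 2 = sx i * dot d d + \sum_(k in g) sz i * w (i, k) ^+ 2.
  rewrite big_sumType/=; congr (_ + _).
    rewrite dotE mulr_sumr; apply: eq_bigr => j _.
    by rewrite exprMn sqx expr2.
  rewrite [RHS]big_mkcond/=; apply: eq_bigr => k _; case: ifP => _.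
    by rewrite exprMn sqx.
  by rewrite mulr0 expr0n.
move=> h; apply: le_trans (h _ _ _ _).
- rewrite ler_wpM2r//.
    rewrite addr_ge0 ?mulr_ge0 ?powR_ge0 ?dot_ge0//.
    by apply: sumr_ge0 => k _; rewrite mulr_ge0 ?powR_ge0 ?sqr_ge0.
  rewrite card_sum !card_ord natrD.
  have c : #|a|%:R <= p%:R :> R by rewrite ler_nat -[leqRHS]card_ord max_card.
  have : rho * (n i)%:R `^ (- tau) * (#|a|%:R + q%:R) <= rho * (n i)%:R `^ (- tau) * (p%:R + q%:R).
    by rewrite ler_wpM2l ?mulr_ge0 ?powR_ge0// lerD2r.
  have := dims i; rewrite mulrAC; lra.
- by rewrite mulr_ge0 ?powR_ge0.
- by case=> s; rewrite /A powR_ge0.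
- by case=> s; rewrite /A sqx /V; [exact: gx|exact: gz].
- case=> s [] t st; rewrite /A /V -mulrA !powD.
  + apply: le_trans (gxx _ _) _; last by rewrite [_ - _]addrC -splitr.
    by apply: contra st => /eqP/enum_val_inj ->.
  + by apply: le_trans (gxz _ _ _) _; rewrite [_ - _]addrC mulrDl.
  + by rewrite dotC; apply: le_trans (gxz _ _ _) _; rewrite [_ - _]addrC mulrDl [le / 2 + _]addrC.
  + apply: le_trans (gzz _ _) _; last first.
      by rewrite [_ - _]addrC -splitr.
    by apply: contra st => /eqP ->.
Qed.

End Model.

Lemma dot_sum_le (R : realFieldType) n (S : finType) (P : pred S) (V : S -> 'cV[R]_n) :
  dot (\sum_(s | P s) V s) (\sum_(s | P s) V s) <= #|P|%:R * \sum_(s | P s) dot (V s) (V s).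
Proof.
rewrite -sum_pair_half.
rewrite dot_suml; apply: ler_sum => s _.
rewrite dot_sumr; apply: ler_sum => t _.
by have := dot_ge0 (V s - V t); rewrite dot_subr_ge; lra.
Qed.

Section Noise.
Variables (R : realType) (m : nat) (n : 'I_m -> nat) (p q : nat).
Variables (X : forall i : 'I_m, 'M[R]_(n i, p)) (Z : forall i : 'I_m, 'M[R]_(n i, q)).
Variables (a : {set 'I_p}) (g : {set 'I_q}).
Variables (S : R) (sz : 'I_m -> R) (eps : 'cV[R]_(\sum_(i < m) n i)).

(** All columns are included, not only those of the candidate, so one moment bound serves every
    model; the normalization gives each term a bounded mean. *)
Definition noise_sq : R := \sum_j dot (col j (stackX X)) eps ^+ 2 / S
  + \sum_(s : 'I_m * 'I_q) dot (zcol Z s) eps ^+ 2 / sz s.1.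

Hypothesis S0 : 0 < S.
Hypothesis sz0 : forall i, 0 < sz i.

Lemma amgm (k s w r : R) : 0 < k -> 0 < s ->
  2 * (w * r) <= k * (s * w ^+ 2) / 2 + 2 * (r ^+ 2 / s) / k.
Proof.
move=> k0 s0; rewrite -subr_ge0.
have -> : k * (s * w ^+ 2) / 2 + 2 * (r ^+ 2 / s) / k - 2 * (w * r) =
  (k * s * w - 2 * r) ^+ 2 / (2 * s * k) by field; rewrite !gt_eqF.
by rewrite divr_ge0 ?sqr_ge0// !mulr_ge0// ltW.
Qed.

(** [amgm] is applied coordinate by coordinate; the sum over the candidate's columns is then
    enlarged to all columns. *)
Lemma noise_model (k : R) (d : 'cV[R]_#|a|) (w : 'I_m * 'I_q -> R) : 0 < k ->
  2 * dot eps (lincomb (zcol Z) g (Xsub (stackX X) a) d w) <=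
  k * energy g sz S d w / 2 + 2 * noise_sq / k.
Proof.
move=> k0; rewrite /lincomb /energy /noise_sq.
have -> : Xsub (stackX X) a *m d = \sum_(j < #|a|) d j 0 *: col (enum_val j) (stackX X).
  apply/matrixP => i c; rewrite !mxE summxE; apply: eq_bigr => j _.
  by rewrite !mxE ord1 mulrC.
rewrite dotDr !dot_sumr.
pose f j := dot (col j (stackX X)) eps; pose h s := dot (zcol Z s) eps.
have h1 : \sum_(j < #|a|) f (enum_val j) ^+ 2 / S <= \sum_j f j ^+ 2 / S.
  rewrite -(big_enum_val (fun j => f j ^+ 2 / S)) [leRHS](bigID (mem a))/= lerDl.
  by apply: sumr_ge0 => j _; rewrite divr_ge0 ?sqr_ge0 ?ltW.
have h2 : \sum_(s | s.2 \in g) h s ^+ 2 / sz s.1 <= \sum_s h s ^+ 2 / sz s.1.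
  rewrite [leRHS](bigID (fun s => s.2 \in g))/= lerDl.
  by apply: sumr_ge0 => j _; rewrite divr_ge0 ?sqr_ge0 ?ltW.
have h3 : 2 * \sum_(j < #|a|) dot eps (d j 0 *: col (enum_val j) (stackX X)) <=
   k * (S * dot d d) / 2 + 2 * (\sum_(j < #|a|) f (enum_val j) ^+ 2 / S) / k.
  rewrite dotE !(mulr_sumr, mulr_suml) -big_split/=; apply: ler_sum => j _.
  by rewrite dotZr dotC -/(f _) -expr2; apply: amgm.
have h4 : 2 * \sum_(s | s.2 \in g) dot eps (w s *: zcol Z s) <=
   k * (\sum_(s | s.2 \in g) sz s.1 * w s ^+ 2) / 2 + 2 * (\sum_(s | s.2 \in g) h s ^+ 2 / sz s.1) / k.
  rewrite !(mulr_sumr, mulr_suml) -big_split/=; apply: ler_sum => s _.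
  by rewrite dotZr dotC -/(h _); apply: amgm.
have h5 : 2 * (\sum_(j < #|a|) f (enum_val j) ^+ 2 / S) / k <= 2 * (\sum_j f j ^+ 2 / S) / k.
  by rewrite ler_pM2r ?invr_gt0// ler_pM2l.
have h6 : 2 * (\sum_(s | s.2 \in g) h s ^+ 2 / sz s.1) / k <= 2 * (\sum_s h s ^+ 2 / sz s.1) / k.
  by rewrite ler_pM2r ?invr_gt0// ler_pM2l.
rewrite (mulrDr 2 (\sum_j f j ^+ 2 / S)) mulrDl; lra.
Qed.

End Noise.

Lemma dot_zcol (R : realType) (m : nat) (n : 'I_m -> nat) (q : nat)
    (Z : forall i : 'I_m, 'M[R]_(n i, q)) s :
  dot (zcol Z s) (zcol Z s) = dot (col s.2 (Z s.1)) (col s.2 (Z s.1)).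
Proof.
rewrite dot_mxcol (bigD1 s.1)//= eqxx big1 ?addr0// => i /negPf ->.
by rewrite dot0r.
Qed.

Lemma sum_fst (R : realType) (m q : nat) (G0 : {set 'I_q}) (f : 'I_m -> R) :
  \sum_(s | s.2 \in G0) f s.1 = #|G0|%:R * \sum_i f i.
Proof.
rewrite sum_pair_g mulr_sumr; apply: eq_bigr => i _ /=.
by rewrite sumr_const mulr_natl.
Qed.

Lemma cardr_snd (R : realType) (m q : nat) (G0 : {set 'I_q}) :
  #|[pred s : 'I_m * 'I_q | s.2 \in G0]|%:R = m%:R * #|G0|%:R :> R.
Proof.
have := @sum_fst R m q G0 (fun=> 1).
rewrite [X in _ = _ * X]sumr_const card_ord mulrC => <-.
by rewrite -sum1_card natr_sum; apply: eq_bigl => s; rewrite inE.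
Qed.

(** * Deterministic consistency on the good event *)

Section Consistency.
Variables (R : realType) (m : nat) (n : 'I_m -> nat) (p q : nat).
Variables (X : forall i : 'I_m, 'M[R]_(n i, p)) (Z : forall i : 'I_m, 'M[R]_(n i, q)).
Variables (a : {set 'I_p}) (g G0 : {set 'I_q}).
Variables (xe le tau rho dl du D L eta r : R) (g0 : nat).
Variables (y eps : 'cV[R]_(\sum_(i < m) n i)) (bb : 'cV[R]_#|a|) (b : 'I_m * 'I_q -> R).
Variables (th : 'I_q -> R) (v2 : R).
Hypothesis m0 : (0 < m)%N.
Hypothesis n1 : forall i, (0 < n i)%N.
Let sx i := (n i)%:R `^ xe.
Let sz i := (n i)%:R `^ le.
Let S := \sum_i sx i.
Hypothesis rho0 : 0 <= rho.
Hypothesis gx : forall i j, dl * sx i <= dot (col j (X i)) (col j (X i)).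
Hypothesis gz : forall i j, dl * sz i <= dot (col j (Z i)) (col j (Z i)) <= du * sz i.
Hypothesis gxx : forall i j j', j != j' ->
  `|dot (col j (X i)) (col j' (X i))| <= rho * (n i)%:R `^ (xe - tau).
Hypothesis gzz : forall i j j', j != j' ->
  `|dot (col j (Z i)) (col j' (Z i))| <= rho * (n i)%:R `^ (le - tau).
Hypothesis gxz : forall i j j',
  `|dot (col j (X i)) (col j' (Z i))| <= rho * (n i)%:R `^ ((xe + le) / 2 - tau).
Hypothesis dims : forall i, rho * (p%:R + q%:R) * (n i)%:R `^ (- tau) <= dl / 2.
Hypothesis tau_le : 2 * tau < le <= 1.
Hypothesis tau0 : 0 <= tau.
Hypothesis dl0 : 0 < dl.
Hypothesis du0 : 0 < du.
Hypothesis L0 : 0 < L.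
Hypothesis D0 : 0 < D.
Hypothesis eta0 : 0 < eta.
Hypothesis r0 : 0 < r <= 1.
Hypothesis pq : forall i, p%:R + m%:R * q%:R + 1 <= D * (n i)%:R `^ tau.
Hypothesis sG0 : G0 \subset g.
Hypothesis cG0 : (#|G0| <= g0)%N.
Hypothesis bG0 : forall s, s.2 \notin G0 -> b s = 0.
Hypothesis yE : y = Xsub (stackX X) a *m bb + \sum_s b s *: zcol Z s + eps.
Hypothesis ml : is_ML X Z a g y th v2.
Hypothesis bL : forall s, `|b s| <= L.
Hypothesis beta : forall s, s.2 \in G0 -> eta <= `|b s|.
Hypothesis epsL : dot eps eps <= L * (\sum_(i < m) n i)%:R.
Hypothesis noiseL : noise_sq X Z S sz eps <= L * (p%:R + m%:R * q%:R + 1).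

(** [kap] is the coercivity constant of [gram_model]. [V] bounds [v2] through |W + eps|^2 <= 2 |W|^2
    + 2 |eps|^2 with W the true random part. [C1] and [C2] are the constants of [blup_error_crude]
    and [blup_error_fine] after n_i^(l/2) is factored out. [t0] is the lower bound on theta that
    follows from eta^2 / 4 <= m theta V. *)
Let kap := dl / 2.
Let V := 2 * L + 2 * (m%:R * g0%:R) * (L ^+ 2 * du * g0%:R).
Let C1 := 2 / kap * (2 * (L * D) / kap + (V * (du * (m%:R * g0%:R)) + (m%:R * g0%:R) * L ^+ 2)).
Let t0 := eta ^+ 2 / 4 / (m%:R * V).
Let C2 := 2 / kap * (2 * (L * D) / kap + (m%:R * g0%:R) * L ^+ 2 / t0).

Hypothesis small1 : forall i, C1 * (n i)%:R `^ (- (le / 2)) <= eta ^+ 2 / 4.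
Hypothesis small2 : forall i, C2 * (n i)%:R `^ (- (le / 2)) <= r ^+ 2.
Hypothesis small3 : forall i, V / kap * (n i)%:R `^ (- (le / 2)) <= r.

(** In the factor 2 + 2L, the part 1 + 2L comes from u^2 - b^2 = w (2b + w) with |w| <= r <= 1 and
    |b| <= L; the remaining 1 is the slack of the trace in [blup_ge]. *)
Lemma ml_consistent k : k \in G0 ->
  `|m%:R * (th k * v2) - \sum_i b (i, k) ^+ 2| <= m%:R * (2 + 2 * L) * r.
Proof.
have n0 i : 0 < (n i)%:R :> R by rewrite ltr0n.
have n1' i : 1 <= (n i)%:R :> R by rewrite ler1n.
have powD i u v : (n i)%:R `^ u * (n i)%:R `^ v = (n i)%:R `^ (u + v) :> R.
  by rewrite powRD// (gt_eqF (n0 i)) implybT.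
have pow0 i u : 0 < (n i)%:R `^ u :> R by rewrite powR_gt0.
have kap0 : 0 < kap by rewrite divr_gt0.
have m0' : 0 < m%:R :> R by rewrite ltr0n.
pose i0 := Ordinal m0.
have S0 : 0 < S.
  rewrite /S (bigD1 i0)//= ltr_pwDl//; first exact: pow0.
  by apply: sumr_ge0 => i _; exact: powR_ge0.
have gramH (d : 'cV[R]_#|a|) w : kap * energy g sz S d w <= _ := gram_model (a := a) g n1 rho0 gx (fun i j => proj1 (andP (gz i j))) gxx gzz gxz dims d w.
have noiseH (d : 'cV[R]_#|a|) w : _ <= kap * energy g sz S d w / 2 + 2 * noise_sq X Z S sz eps / kap := noise_model (a := a) X Z g eps S0 (fun i => pow0 i le) d w kap0.
move=> kG0; pose z := zcol Z; pose Xa := Xsub (stackX X) a.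
have yE0 : y = Xa *m bb + \sum_s b s *: z s + eps by exact: yE.
rewrite -/z -/Xa in gramH noiseH.
have kg : k \in g by exact: (fintype.subsetP sG0).
(* Coercivity with zero random effects makes the candidate design injective. *)
have injX (d : 'cV[R]_#|a|) : Xa *m d = 0 -> d = 0.
  move=> Xd; have := gramH d (fun=> 0); rewrite /lincomb /energy Xd.
  have -> : \sum_(s : 'I_m * 'I_q | s.2 \in g) 0 *: z s = 0.
    by apply: big1 => s _; rewrite scale0r.
  have -> : \sum_(s : 'I_m * 'I_q | s.2 \in g) sz s.1 * 0 ^+ 2 = 0 :> R.
    by apply: big1 => s _; rewrite expr0n mulr0.
  rewrite !addr0 dot0r pmulr_rle0// pmulr_rle0// => h.
  by apply/eqP; rewrite -dot_eq0 eq_le h dot_ge0.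
have [th0 v20 opt] := is_ML_profile ml; rewrite -/z -/Xa in opt.
have yE' : y = Xa *m bb + \sum_(s | s.2 \in g) b s *: z s + eps.
  rewrite yE0; congr (_ + _ + _); rewrite [LHS](bigID (fun s => s.2 \in g))/=.
  rewrite [X in _ + X]big1 ?addr0// => s sg; rewrite bG0 ?scale0r//.
  by apply: contra sg; exact: (fintype.subsetP sG0).
have N0 : (0 < \sum_(i < m) n i)%N by rewrite (bigD1 i0)//= addn_gt0 n1.
have szle i : sz i <= (n i)%:R.
  by rewrite /sz -[leRHS]powRr1// ler_powR//; case/andP: tau_le.
have g0R : #|G0|%:R <= g0%:R :> R by rewrite ler_nat.
have V0 : 0 < V.
  by rewrite /V ltr_pwDl//; [rewrite mulr_gt0|rewrite !mulr_ge0// ltW].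
have bsq s : b s ^+ 2 <= L ^+ 2.
  by rewrite -real_normK ?num_real// lerXn2r ?nnegrE// ltW.
have sumbsq : \sum_(s | s.2 \in G0) b s ^+ 2 <= (m%:R * g0%:R) * L ^+ 2.
  apply: (@le_trans _ _ (\sum_(s : 'I_m * 'I_q | s.2 \in G0) L ^+ 2)).
    by apply: ler_sum.
  rewrite (sum_fst G0 (fun=> L ^+ 2)) sumr_const card_ord -[_ *+ m]mulr_natl mulrCA mulrA.
  by rewrite ler_wpM2r ?sqr_ge0// ler_wpM2l.
have v2V : v2 <= V.
  have := v2_le_resid bb injX th0 v20 opt.
  have -> : y - Xa *m bb = \sum_(s | s.2 \in G0) b s *: z s + eps.
    rewrite yE0 addrAC [Xa *m bb + _]addrC addrK addrC [RHS]addrC; congr (_ + _).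
    rewrite [LHS](bigID (fun s => s.2 \in G0))/= [X in _ + X]big1 ?addr0// => s sg.
    by rewrite bG0// scale0r.
  set W := \sum_(s | s.2 \in G0) b s *: z s.
  have hW : dot W W <= (m%:R * g0%:R) * (L ^+ 2 * du * g0%:R) * (\sum_(i < m) n i)%:R.
    apply: le_trans (dot_sum_le _ _) _; rewrite cardr_snd -mulrA.
    apply: ler_pM.
    - by rewrite mulr_ge0.
    - by apply: sumr_ge0 => s _; exact: dot_ge0.
    - by rewrite ler_wpM2l.
    apply: (@le_trans _ _ (L ^+ 2 * du * \sum_(s : 'I_m * 'I_q | s.2 \in G0) sz s.1)).
      rewrite mulr_sumr; apply: ler_sum => s _; rewrite dotZl dotZr mulrA -expr2 -mulrA.
      apply: ler_pM; rewrite ?sqr_ge0 ?dot_ge0//.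
      by rewrite /z dot_zcol; case/andP: (gz s.1 s.2).
    rewrite (sum_fst G0 sz) -[leRHS]mulrA ler_wpM2l ?(mulr_ge0 (sqr_ge0 L) (ltW du0))//.
    apply: ler_pM; rewrite ?ler0n//; first by apply: sumr_ge0 => i _; exact: powR_ge0.
    by rewrite natr_sum; apply: ler_sum.
  have hWe : dot (W + eps) (W + eps) <= 2 * dot W W + 2 * dot eps eps.
    have := dot_ge0 (W - eps); rewrite dot_subr_ge dotDl !dotDr (dotC eps W); lra.
  move=> hv; have NR : 0 < (\sum_(i < m) n i)%:R :> R by rewrite ltr0n.
  have eL : dot eps eps <= L * (\sum_(i < m) n i)%:R := epsL.
  have VE : V = 2 * L + 2 * (m%:R * g0%:R * (L ^+ 2 * du * g0%:R)) by rewrite /V; ring.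
  rewrite -(ler_pM2l NR) VE; apply: le_trans hv _; apply: le_trans hWe _.
  set c := m%:R * g0%:R * _ in hW *; set Nr := (\sum_(i < m) n i)%:R in hW eL *.
  clearbody c Nr; lra.
have [bh [x [_ xE QE]]] := gls_exists z y injX th0.
pose u s := th s.2 * dot (z s) x.
have K2D i : noise_sq X Z S sz eps <= L * D * (n i)%:R `^ tau.
  by apply: le_trans noiseL _; rewrite -mulrA ler_pM2l.
have tau2 : tau <= le / 2 by case/andP: tau_le; lra.
have [imax _ imaxP] := arg_maxnP (fun i => n i) (isT : xpredT i0).
have nm i : (n i)%:R <= (n imax)%:R :> R by rewrite ler_nat; exact: imaxP.
have le0 : 0 < le by case/andP: tau_le => h _; apply: le_lt_trans h; rewrite mulr_ge0.
pose nh i : R := (n i)%:R `^ (le / 2).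
have nh0 i : 0 < nh i by exact: pow0.
have nhV i : (n i)%:R `^ (- (le / 2)) = (nh i)^-1 by rewrite powRN.
have nhsq i : sz i = nh i * nh i by rewrite powD -splitr.
have pw i e : e <= le / 2 -> (n i)%:R `^ e <= nh i by move=> h; rewrite ler_powR.
have t00 : 0 < t0 by rewrite !divr_gt0 ?mulr_gt0// exprn_gt0.
(* In the largest cluster the crude bound already forces [u] close to [b]; since [b] is
   bounded away from 0 this bounds [th j] from below, and then [blup_error_fine] controls
   every cluster. *)
have step1 j : j \in G0 -> eta ^+ 2 / 4 <= u (imax, j) ^+ 2.
  move=> jG; have jg : j \in g by exact: (fintype.subsetP sG0).
  (* [nh imax] is n_max^(l/2); its inverse is the shift that balances trace and penalty. *)
  have := blup_error_crude sG0 bG0 yE' injX (fun i => pow0 i le) S0 kap0 gramH noiseH th0 v20 opt xE QE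
    (c := (nh imax)^-1) (s := (imax, j)).
  rewrite invr_gt0 nh0 => /(_ isT jg); rewrite -/(u _)/= -/(sz imax) nhsq => h1.
  (* Columns of every cluster enter the trace; maximality of [imax] bounds them all by n_max^l. *)
  have hz : \sum_(s | s.2 \in G0) dot (z s) (z s) <= du * (m%:R * g0%:R) * (nh imax * nh imax).
    apply: (@le_trans _ _ (du * \sum_(s : 'I_m * 'I_q | s.2 \in G0) (fun=> sz imax) s.1)).
      rewrite mulr_sumr; apply: ler_sum => s _; rewrite /z dot_zcol.
      case/andP: (gz s.1 s.2) => _ h; apply: le_trans h _; rewrite ler_pM2l//.
      by rewrite ge0_ler_powR ?nnegrE// ltW.
    rewrite (sum_fst G0 (fun=> sz imax)) sumr_const card_ord -[_ *+ m]mulr_natl -nhsq.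
    rewrite -[leRHS]mulrA ler_pM2l// -[leRHS]mulrA [leRHS]mulrCA.
    by rewrite ler_wpM2r// mulr_ge0// ltW// pow0.
  have hz' : v2 * ((nh imax)^-1 * \sum_(s | s.2 \in G0) dot (z s) (z s)) <= V * (du * (m%:R * g0%:R)) * nh imax.
    rewrite -mulrA; apply: ler_pM; rewrite ?(ltW v20)//.
      rewrite mulr_ge0 ?invr_ge0 ?(ltW (nh0 _))//.
      by apply: sumr_ge0 => s _; exact: dot_ge0.
    by rewrite ler_pdivrMl// mulrCA.
  have hb : \sum_(s | s.2 \in G0) b s ^+ 2 / (nh imax)^-1 <= m%:R * g0%:R * L ^+ 2 * nh imax.
    by rewrite invrK -mulr_suml ler_pM2r.
  have hK : noise_sq X Z S sz eps <= L * D * nh imax.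
    by apply: le_trans (K2D imax) _; rewrite ler_pM2l ?mulr_gt0// pw.
  have hC : nh imax * (u (imax, j) - b (imax, j)) ^+ 2 <= C1.
    rewrite -(ler_pM2l (nh0 imax)) mulrA; apply: le_trans h1 _; rewrite /C1.
    have -> : nh imax * (2 / kap * (2 * (L * D) / kap + (V * (du * (m%:R * g0%:R)) + m%:R * g0%:R * L ^+ 2)))
      = 2 / kap * (2 * (L * D * nh imax) / kap + (V * (du * (m%:R * g0%:R)) * nh imax +
        m%:R * g0%:R * L ^+ 2 * nh imax)) by field; rewrite gt_eqF.
    rewrite ler_pM2l ?divr_gt0//; apply: lerD; last exact: lerD.
    by rewrite ler_pM2r ?invr_gt0// ler_pM2l.
  have hw : (u (imax, j) - b (imax, j)) ^+ 2 <= (eta / 2) ^+ 2.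
    have -> : (eta / 2) ^+ 2 = eta ^+ 2 / 4 by field.
    apply: le_trans (small1 imax); rewrite nhV.
    by rewrite ler_pdivlMr// mulrC.
  have {}hw : `|u (imax, j) - b (imax, j)| <= eta / 2.
    by rewrite -(@ler_pXn2r _ 2)// ?nnegrE ?divr_ge0 ?(ltW eta0)// real_normK ?num_real.
  have hb' : eta <= `|b (imax, j)| by exact: beta.
  have hu : eta / 2 <= `|u (imax, j)|.
    have := ler_normB (u (imax, j)) (u (imax, j) - b (imax, j)).
    by rewrite opprB addrC subrK; lra.
  rewrite -[leRHS]real_normK ?num_real//.
  have -> : eta ^+ 2 / 4 = (eta / 2) ^+ 2 by field.
  by rewrite ler_pXn2r// nnegrE divr_ge0 ?(ltW eta0).
have thpos j : j \in G0 -> 0 < th j.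
  move=> jG; have jg : j \in g by exact: (fintype.subsetP sG0).
  rewrite lt_neqAle th0// andbT eq_sym; apply/eqP => tj.
  have := step1 _ jG; rewrite /u/= tj mul0r expr0n/=.
  by rewrite leNgt divr_gt0// exprn_gt0.
have step1' j : j \in G0 -> t0 <= th j.
  move=> jG; have jg : j \in g by exact: (fintype.subsetP sG0).
  (* The upper half of the first-order condition, u^2 <= m theta v2, turns a lower bound on the
     prediction into one on theta. *)
  have := blup_le injX th0 v20 opt xE QE jg (thpos _ jG); rewrite card_ord -/(u _) => h.
  rewrite /t0 ler_pdivrMr ?mulr_gt0//.
  apply: le_trans (step1 _ jG) _.
  apply: (@le_trans _ _ (\sum_i u (i, j) ^+ 2)).
    by rewrite (bigD1 imax)//= lerDl; apply: sumr_ge0 => i _; exact: sqr_ge0.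
  apply: le_trans h _; rewrite mulrCA ler_pM2l ?thpos//.
  by rewrite ler_pM2l.
have step2 i : (u (i, k) - b (i, k)) ^+ 2 <= r ^+ 2.
  have := blup_error_fine sG0 bG0 yE' injX (fun i => pow0 i le) S0 kap0 gramH noiseH th0 xE QE
    t00 step1' (s := (i, k)) kg.
  rewrite -/(u _)/= -/(sz i) nhsq => h1.
  apply: le_trans (small2 i); rewrite nhV ler_pdivlMr// mulrC.
  rewrite -(ler_pM2l (nh0 i)) mulrA; apply: le_trans h1 _; rewrite /C2.
  have -> : nh i * (2 / kap * (2 * (L * D) / kap + m%:R * g0%:R * L ^+ 2 / t0)) =
    2 / kap * (2 * (L * D * nh i) / kap + m%:R * g0%:R * L ^+ 2 / t0 * nh i).
    by field; rewrite !gt_eqF.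
  rewrite ler_pM2l ?divr_gt0//; apply: lerD.
    rewrite ler_pM2r ?invr_gt0// ler_pM2l//.
    by apply: le_trans (K2D i) _; rewrite ler_pM2l ?mulr_gt0// pw.
  have nh1 : 1 <= nh i by rewrite -[leLHS](powRr0 (n i)%:R) pw// divr_ge0// ltW.
  rewrite -mulr_suml; apply: (@le_trans _ _ (m%:R * g0%:R * L ^+ 2 / t0)).
    by rewrite ler_pM2r ?invr_gt0.
  by rewrite ler_peMr// divr_ge0 ?(ltW t00)// mulr_ge0 ?sqr_ge0.
case/andP: r0 => rp r1.
have hdiff : `|\sum_i u (i, k) ^+ 2 - \sum_i b (i, k) ^+ 2| <= m%:R * ((1 + 2 * L) * r).
  rewrite -sumrB; apply: le_trans (ler_norm_sum _ _ _) _.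
  apply: (@le_trans _ _ (\sum_(i < m) (1 + 2 * L) * r)); last first.
    by rewrite sumr_const card_ord -[_ *+ m]mulr_natl.
  apply: ler_sum => i _; have := step2 i; have := bL (i, k).
  set w := u _ - _ => hb hw.
  have {}hw : `|w| <= r.
    by rewrite -(@ler_pXn2r _ 2)// ?nnegrE ?(ltW rp)// real_normK ?num_real.
  have -> : u (i, k) ^+ 2 - b (i, k) ^+ 2 = w * (2 * b (i, k) + w) by rewrite /w; ring.
  rewrite normrM mulrC; apply: ler_pM => //.
  apply: le_trans (ler_normD _ _) _; rewrite normrM ger0_norm//; lra.
have := blup_le injX th0 v20 opt xE QE kg (thpos _ kG0).
have := blup_ge injX (fun i => pow0 i le) S0 kap0 gramH th0 v20 opt xE QE kg (thpos _ kG0).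
rewrite card_ord -/(u _) => hge hle.
(* Since n_i >= 1, n_i^(-l) <= n_i^(-l/2), and [small3] applies. *)
have hs : v2 / kap * \sum_i (sz i)^-1 <= m%:R * r.
  apply: (@le_trans _ _ (\sum_(i < m) r)); last by rewrite sumr_const card_ord -[_ *+ m]mulr_natl.
  rewrite mulr_sumr; apply: ler_sum => i _; apply: le_trans (small3 i); rewrite nhV.
  have nh1 : 1 <= nh i by rewrite -[leLHS](powRr0 (n i)%:R) pw// divr_ge0// ltW.
  apply: ler_pM.
  - by rewrite divr_ge0 ?ltW.
  - by rewrite invr_ge0 ltW// pow0.
  - by rewrite ler_pM2r ?invr_gt0.
  - by rewrite lef_pV2 ?posrE ?pow0// nhsq ler_peMr// ltW.
have -> : m%:R * (2 + 2 * L) * r = m%:R * ((1 + 2 * L) * r) + m%:R * r by ring.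
move: hdiff; rewrite !ler_norml => /andP[d1 d2].
have p0 : 0 <= m%:R * r by rewrite mulr_ge0// ltW.
move: hge hle hs; rewrite -/(\sum_i u (i, k) ^+ 2).
set s1 := v2 / kap * _; move: d1 d2 p0.
move: (\sum_i u (i, k) ^+ 2) (\sum_i b (i, k) ^+ 2) (m%:R * (th k * v2)) (m%:R * r) => U B Th mr.
move: (m%:R * _) => A d1 d2 p0 hge hle hs.
by apply/andP; split; lra.
Qed.
End Consistency.

Import numFieldNormedType.Exports.
Local Open Scope classical_set_scope.

(** * Independence and normal moments *)

Section Push.
Context d1 d2 (T1 : measurableType d1) (T2 : measurableType d2) (R : realType).
Local Open Scope ereal_scope.

Definition mfun_of (f : T1 -> T2) (mf : measurable_fun setT f) : {mfun T1 >-> T2} :=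
  HB.pack f (isMeasurableFun.Build _ _ _ _ f mf).

Variables (m : {measure set T1 -> \bar R}) (f : {mfun T1 >-> T2}).
(** Pushforward with measurability bundled into [f], so that it is canonically a measure and
    combines with [mscale] and [mrestr]. *)
Definition push (A : set T2) : \bar R := m (f @^-1` A).

Let mpre A : measurable A -> measurable (f @^-1` A).
Proof. by move=> mA; rewrite -[X in measurable X]setTI; exact: measurable_funP. Qed.
Let push0 : push set0 = 0. Proof. by rewrite /push preimage_set0 measure0. Qed.
Let push_ge0 A : 0 <= push A. Proof. exact: measure_ge0. Qed.
Let push_sigma : semi_sigma_additive push.
Proof.
move=> F mF tF mUF; rewrite /push preimage_bigcup.
apply: measure_semi_sigma_additive.
- by move=> n; exact: mpre.
- apply/trivIsetP => /= i j _ _ ij; rewrite -preimage_setI.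
  by move/trivIsetP : tF => /(_ _ _ _ _ ij) ->//; rewrite preimage_set0.
- by rewrite -preimage_bigcup; exact: mpre.
Qed.
HB.instance Definition _ := isMeasure.Build _ _ _ push push0 push_ge0 push_sigma.

Lemma ge0_integral_push (h : T2 -> \bar R) : measurable_fun setT h -> (forall y, 0 <= h y) ->
  \int[push]_y h y = \int[m]_x h (f x).
Proof. by move=> mh h0; rewrite ge0_integral_pushforward. Qed.
End Push.

Lemma mulrl_measurable (R : realType) (t : R) :
  measurable_fun [set: measurableTypeR R] (( *%R t) : measurableTypeR R -> measurableTypeR R).
Proof.
have : measurable_fun [set: R] ( *%R t : R -> R) by apply: measurable_funM.
exact.
Qed.

Section NormalIntegral.
Variable R : realType.
Notation mu := (@lebesgue_measure R).
Local Open Scope ereal_scope.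

(** The Radon-Nikodym density of the normal law agrees almost everywhere with [normal_pdf], because
    both integrate to the same measure. *)
Lemma integral_normal_prob (f : R -> \bar R) :
  measurable_fun [set: R] f -> (forall x, 0 <= f x) ->
  \int[normal_prob (0 : R)%R 1%R]_x f x = \int[mu]_x (f x * (normal_pdf 0%R 1%R x)%:E).
Proof.
move=> mf f0; have dom := normal_prob_dominates (0 : R)%R 1%R.
rewrite -(Radon_Nikodym_SigmaFinite.change_of_variables dom)//.
apply: ae_eq_integral => //.
- apply: emeasurable_funM => //; apply: (measurable_int mu).
  exact: Radon_Nikodym_SigmaFinite.f_integrable.
- apply: emeasurable_funM => //.
  by apply/measurable_EFinP; exact: measurable_normal_pdf.
- apply: ae_eqe_mul2l => /=.
  apply: integral_ae_eq => //=.
  + exact: Radon_Nikodym_SigmaFinite.f_integrable.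
  + by apply/measurable_EFinP; exact: measurable_normal_pdf.
  + by move=> E _ mE; rewrite -Radon_Nikodym_SigmaFinite.f_integral.
Qed.

Lemma lebesgue_scale (t : R) (t0 : (0 < t)%R) (A : set (measurableTypeR R)) : measurable A ->
  mu A = mscale (NngNum (ltW t0)) (push mu (mfun_of (mulrl_measurable t))) A.
Proof.
move=> mA; apply: lebesgue_measure_unique => //= _ [[a b]] _ <-.
rewrite /mscale/= /push/=.
have -> : ( *%R t) @^-1` `]a, b] = `](t^-1 * a)%R, (t^-1 * b)%R]%classic.
  apply/seteqP; split => x /=; rewrite !in_itv/= => /andP[h1 h2]; apply/andP.
    by rewrite ltr_pdivrMl// ler_pdivlMl.
  by rewrite ltr_pdivrMl// in h1; rewrite ler_pdivlMl// in h2.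
rewrite !lebesgue_measure_itv/= !lte_fin ltr_pM2l ?invr_gt0//.
case: ifPn => _; last by rewrite mule0.
by rewrite -!EFinB -EFinM -mulrBr mulrA divff ?gt_eqF// mul1r.
Qed.

Lemma integral_scale (t : R) (f : R -> \bar R) : (0 < t)%R ->
  measurable_fun [set: R] f -> (forall x, 0 <= f x) ->
  \int[mu]_x f x = t%:E * \int[mu]_x f (t * x)%R.
Proof.
move=> t0 mf f0.
rewrite (eq_measure_integral (mscale (NngNum (ltW t0)) (push mu (mfun_of (mulrl_measurable t))))); last first.
  by move=> A mA _; exact: lebesgue_scale.
rewrite ge0_integral_mscale//; congr (_ * _).
by rewrite ge0_integral_push.
Qed.

End NormalIntegral.

(** * Sums of functions of independent variables *)

Section Independence.
Context d (T : measurableType d) (R : realType) (P : probability T R).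
Variables (I : finType) (f : I -> T -> R).
Hypothesis indep : mutual_indep P f.
Hypothesis mf : forall i, measurable_fun setT (f i).
Variables (G : I -> R -> R).
Hypothesis mG : forall i, measurable_fun setT (G i).
Local Open Scope ereal_scope.

(** Linear [G] serves the second moments of the noise, squares serve the chi-square law. *)
Definition partial_sum (s : seq I) (w : T) : R := (\sum_(i <- s) G i (f i w))%R.

Definition cylinder (J : {set I}) (B : I -> set R) : set T :=
  \bigcap_(i in [set i | i \in J]) (f i @^-1` B i).

Lemma mpreim (h : T -> R) A : measurable_fun setT h -> measurable A -> measurable (h @^-1` A).
Proof. by move=> mh mA; rewrite -[X in measurable X]setTI; exact: mh. Qed.

Lemma measurable_partial_sum s : measurable_fun setT (partial_sum s).
Proof.
elim: s => [|i s IH].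
  by rewrite (_ : partial_sum _ = cst 0%R)//; apply/funext => w; rewrite /partial_sum big_nil.
rewrite (_ : partial_sum _ = (fun w => G i (f i w)) \+ partial_sum s)%R.
  by apply: measurable_funD => //; exact: measurableT_comp.
by apply/funext => w; rewrite /partial_sum big_cons.
Qed.

Lemma measurable_cylinder J B : (forall i, measurable (B i)) -> measurable (cylinder J B).
Proof. by move=> mB; apply: fin_bigcap_measurable => // i _; exact: mpreim. Qed.

Lemma cylinder_cons (i : I) (J : {set I}) (B : I -> set R) : i \notin J ->
  cylinder (i |: J)%SET B = f i @^-1` B i `&` cylinder J B.
Proof.
move=> iJ; apply/seteqP; split => w /=.
  move=> h; split; first by apply: h; exact: finset.setU11.
  by move=> j /= jJ; apply: h; exact: finset.setU1r.
move=> [h1 h2] j /= /finset.setU1P[->//|]; exact: h2.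
Qed.

Lemma cylinder_eq (J : {set I}) (B B' : I -> set R) : (forall i, i \in J -> B i = B' i) -> cylinder J B = cylinder J B'.
Proof. by move=> h; apply: eq_bigcapr => i /= /h ->. Qed.

(** Overriding [B] at [i] by [V] turns the intersection into a single cylinder, to which mutual
    independence applies. *)
Lemma cylinder_prob (i : I) (J : {set I}) (B : I -> set R) V : i \notin J -> (forall i, measurable (B i)) -> measurable V ->
  P (f i @^-1` V `&` cylinder J B) = P (f i @^-1` V) * P (cylinder J B).
Proof.
move=> iJ mB mV; pose B' j := if j == i then V else B j.
have mB' j : measurable (B' j) by rewrite /B'; case: ifP.
have -> : f i @^-1` V `&` cylinder J B = cylinder (i |: J)%SET B'.
  rewrite cylinder_cons// {1}/B' eqxx; congr (_ `&` _); apply: cylinder_eq => j jJ.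
  by rewrite /B'; case: eqP => // ji; move: iJ; rewrite -ji jJ.
rewrite /cylinder indep// big_setU1//= {1}/B' eqxx; congr (_ * _).
rewrite indep//; apply: eq_bigr => j jJ.
by rewrite /B'; case: eqP => // ji; move: iJ; rewrite -ji jJ.
Qed.

(** Induction with an arbitrary cylinder carried along: the head variable joins the cylinder, so the
    induction hypothesis settles rectangles, and uniqueness of product measures extends the identity
    to the preimage of [A] under addition. *)
Lemma partial_sum_cylinder (s : seq I) (J : {set I}) (B : I -> set R) A : uniq s -> (forall i, i \in J -> i \notin s) ->
  (forall i, measurable (B i)) -> measurable A ->
  P (partial_sum s @^-1` A `&` cylinder J B) = P (partial_sum s @^-1` A) * P (cylinder J B).
Proof.
move=> + + mB; elim: s J A B mB => [|i s IH] J A B mB /=.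
  move=> _ _ mA; have [A0|A0] := pselect (A 0%R).
    have -> : partial_sum [::] @^-1` A = setT.
      by apply/seteqP; split => // w _ /=; rewrite /partial_sum big_nil.
    by rewrite setTI probability_setT mul1e.
  have -> : partial_sum [::] @^-1` A = set0.
    by apply/seteqP; split => // w /=; rewrite /partial_sum big_nil.
  by rewrite set0I measure0 mul0e.
move=> /andP[is_ us] sJ mA.
have sJ' j : j \in J -> j \notin s by move=> /sJ; rewrite inE negb_or => /andP[].
have iJ : i \notin J by apply/negP => /sJ; rewrite inE eqxx.
set E := cylinder J B.
have mE : measurable E by exact: measurable_cylinder.
have rect C V : measurable C -> measurable V ->
    P ((partial_sum s @^-1` C `&` f i @^-1` V) `&` E) = P (partial_sum s @^-1` C) * (P (f i @^-1` V) * P E).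
  move=> mC mV; rewrite -setIA -cylinder_prob//.
  pose B' j := if j == i then V else B j.
  have mB' j : measurable (B' j) by rewrite /B'; case: ifP.
  have -> : f i @^-1` V `&` E = cylinder (i |: J)%SET B'.
    rewrite cylinder_cons// {1}/B' eqxx; congr (_ `&` _); apply: cylinder_eq => j jJ.
    by rewrite /B'; case: eqP => // ji; move: iJ; rewrite -ji jJ.
  by apply: IH => // j /finset.setU1P[->//|/sJ'].
have rectT C V : measurable C -> measurable V ->
    P (partial_sum s @^-1` C `&` f i @^-1` V) = P (partial_sum s @^-1` C) * P (f i @^-1` V).
  move=> mC mV; have e1 : cylinder [set i]%SET (fun=> V) = f i @^-1` V.
    apply/seteqP; split => w /=; first by apply; exact: finset.set11.
    by move=> h j /= /finset.set1P ->.
  rewrite -e1; by apply: IH => // j /finset.set1P ->.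
have mUV : measurable_fun setT (fun w => (partial_sum s w, f i w)).
  by apply: measurable_fun_pair => //; exact: measurable_partial_sum.
have fE : P E \is a fin_num by exact: fin_num_measure.
(* The mass of [E] is placed as a scalar on one marginal; the joint law restricted to [E] and the
   rescaled full joint law then equal the same product measure. *)
pose c : {nonneg R} := NngNum (fine_ge0 (measure_ge0 P E)).
have cE : c%:num%:E = P E by rewrite /= fineK.
pose m1 := distribution P (mfun_of (measurable_partial_sum s)).
pose m2 := mscale c (distribution P (mfun_of (mf i))).
have h1 D : measurable D -> (m1 \x m2) D = push (mrestr P mE) (mfun_of mUV) D.
  move=> mD; apply: product_measure_unique => // C V mC mV.
  by rewrite /push/= /mrestr/= rect//= /m2 /mscale/= fineK// (muleC _ (P E)).
have h2 D : measurable D -> (m1 \x m2) D = mscale c (push P (mfun_of mUV)) D.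
  move=> mD; apply: product_measure_unique => // C V mC mV.
  rewrite /mscale/= /push/=.
  transitivity ((fine (P E))%:E * P (partial_sum s @^-1` C `&` f i @^-1` V)); first by [].
  by rewrite rectT// /m2 /mscale/= fineK// muleCA.
pose D := (fun x : R * R => G i x.2 + x.1)%R @^-1` A.
have mD : measurable D.
  rewrite -[D]setTI; apply: (measurable_funD _ _) => //.
  by apply: measurableT_comp => //.
have := h1 _ mD; rewrite h2// /mscale/= /push/= /mrestr/= fineK// /D.
rewrite (_ : _ @^-1` (_ @^-1` A) = partial_sum (i :: s) @^-1` A); last first.
  by apply/seteqP; split => w /=; rewrite /partial_sum big_cons.
by rewrite muleC => ->.
Qed.

Hypothesis nf : forall i B, measurable B -> P (f i @^-1` B) = normal_prob 0%R 1%R B.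

Notation N01 := (normal_prob (0 : R)%R 1%R).

(* [normal_prob] lives on [measurableTypeR R], whose display differs from that of [R]. *)
Lemma expect_normal i (h : R -> \bar R) : measurable_fun [set: R] h -> (forall x, 0 <= h x) ->
  \int[distribution P (mfun_of (mf i))]_x h x = \int[N01]_x h x.
Proof.
move=> mh h0; rewrite ge0_integral_pushforward//=.
have mf' : measurable_fun [set: T] (f i : T -> measurableTypeR R) by have := mf i; exact.
rewrite [RHS](eq_measure_integral (push P (mfun_of mf'))); last first.
  by move=> A mA _; rewrite /push/= nf.
by rewrite ge0_integral_push.
Qed.

Lemma law_partial_sum_pair i (s : seq I) (h : R * R -> \bar R) : uniq (i :: s) ->
  measurable_fun setT h -> (forall x, 0 <= h x) ->
  \int[P]_w h (partial_sum s w, f i w) =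
  \int[(distribution P (mfun_of (measurable_partial_sum s))) \x (distribution P (mfun_of (mf i)))]_x h x.
Proof.
move=> /= /andP[is_ us] mh h0.
have mUV : measurable_fun setT (fun w => (partial_sum s w, f i w)).
  by apply: measurable_fun_pair => //; exact: measurable_partial_sum.
rewrite -(ge0_integral_push P (mfun_of mUV) mh h0)/=.
apply: eq_measure_integral => D mD _; apply/esym.
apply: (product_measure_unique (m' := push P (mfun_of mUV))) => // C V mC mV /=.
have e1 : cylinder [set i]%SET (fun=> V) = f i @^-1` V.
  apply/seteqP; split => w /=; first by apply; exact: finset.set11.
  by move=> h' j /= /finset.set1P ->.
transitivity (P (partial_sum s @^-1` C `&` f i @^-1` V)); first by [].
rewrite -e1 partial_sum_cylinder//; last by move=> j /finset.set1P ->.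
by rewrite e1.
Qed.

(** The new coordinate is integrated first, as second moments require; [expect_partial_sum_pair2]
    keeps it outermost, where it can be rescaled. *)
Lemma expect_partial_sum_pair1 i (s : seq I) (h : R * R -> \bar R) : uniq (i :: s) ->
  measurable_fun setT h -> (forall x, 0 <= h x) ->
  \int[P]_w h (partial_sum s w, f i w) = \int[P]_w \int[N01]_r h (partial_sum s w, r).
Proof.
move=> us mh h0; rewrite law_partial_sum_pair// fubini_tonelli1//.
rewrite ge0_integral_pushforward//=.
- apply: eq_integral => w _; rewrite /fubini_F expect_normal//.
  by apply: measurableT_comp => //; exact: measurable_fun_pair.
- exact: measurable_partial_sum.
- exact: measurable_fun_fubini_tonelli_F.
- by move=> x _; exact: integral_ge0.
Qed.

Lemma expect_partial_sum_pair2 i (s : seq I) (h : R * R -> \bar R) : uniq (i :: s) ->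
  measurable_fun setT h -> (forall x, 0 <= h x) ->
  \int[P]_w h (partial_sum s w, f i w) = \int[N01]_r \int[P]_w h (partial_sum s w, r).
Proof.
move=> us mh h0; rewrite law_partial_sum_pair// fubini_tonelli2//.
rewrite expect_normal//.
- apply: eq_integral => r _; rewrite /fubini_G ge0_integral_pushforward//=; first exact: measurable_partial_sum.
  by apply: measurableT_comp => //; exact: measurable_fun_pair.
- exact: measurable_fun_fubini_tonelli_G.
- by move=> x; exact: integral_ge0.
Qed.

End Independence.

(** * Second moments of normal combinations *)

Section NormalMoments.
Variable R : realType.
Local Open Scope ereal_scope.
Notation mu := (@lebesgue_measure R).
Notation N01 := (normal_prob (0 : R)%R 1%R).

Lemma lebesgue_integralN (h : R -> \bar R) : measurable_fun [set: R] h -> (forall x, 0 <= h x) ->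
  \int[mu]_x h x = \int[mu]_x h (- x)%R.
Proof.
move=> mh h0.
have mN : measurable_fun [set: measurableTypeR R] (-%R : measurableTypeR R -> measurableTypeR R).
  by have : measurable_fun [set: R] (-%R : R -> R) by []; exact.
rewrite [LHS](eq_measure_integral (push mu (mfun_of mN))); last first.
  by move=> A mA _; exact/esym/lebesgue_measureN.
by rewrite ge0_integral_push.
Qed.

Lemma normal_pdfN (x : R) : normal_pdf 0%R 1%R (- x)%R = normal_pdf 0%R 1%R x.
Proof. by rewrite normal_pdfE ?oner_eq0//= /normal_fun !subr0 sqrrN. Qed.

Lemma normal_integral_sym (h : R -> \bar R) : measurable_fun [set: R] h -> (forall x, 0 <= h x) ->
  \int[N01]_x h (- x)%R = \int[N01]_x h x.
Proof.
move=> mh h0.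
have mN : measurable_fun [set: R] (fun x : R => h (- x)%R) by exact: measurableT_comp.
rewrite !integral_normal_prob//.
pose p (x : R) : \bar R := h x * (normal_pdf 0%R 1%R x)%:E.
have mp : measurable_fun [set: R] p.
  apply: emeasurable_funM => //.
  by apply/measurable_EFinP; exact: measurable_normal_pdf.
have p0 x : 0 <= p x by rewrite mule_ge0// lee_fin normal_pdf_ge0.
rewrite [RHS](lebesgue_integralN mp p0); apply: eq_integral => x _.
by rewrite /p normal_pdfN.
Qed.

(** The value is left abstract; Markov bounds use only its finiteness. *)
Definition normal_m2 : \bar R := \int[N01]_x (x ^+ 2)%:E.

Lemma normal_m2_ge0 : 0 <= normal_m2.
Proof. by apply: integral_ge0 => x _; rewrite lee_fin sqr_ge0. Qed.

(** The inequality x^2 / 4 <= exp(x^2 / 4) dominates the integrand by a multiple of the normal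
    density of variance 2; [C] is 4 times the ratio of the peaks. *)
Lemma normal_m2_lt : normal_m2 < +oo.
Proof.
pose s2 : R := Num.sqrt 2.
have s20 : (s2 != 0)%R by rewrite sqrtr_eq0 -ltNge.
pose C : R := (4 * normal_peak 1 / normal_peak s2)%R.
have C0 : (0 <= C)%R by rewrite !mulr_ge0 ?invr_ge0 ?normal_peak_ge0.
rewrite /normal_m2 integral_normal_prob//; last 2 first.
  - by apply/measurable_EFinP; exact: measurable_funX.
  - by move=> x; rewrite lee_fin sqr_ge0.
apply: (@le_lt_trans _ _ (\int[mu]_x (C%:E * (normal_pdf 0%R s2 x)%:E))).
  apply: ge0_le_integral => //.
  - by move=> x _; rewrite mule_ge0// lee_fin ?sqr_ge0 ?normal_pdf_ge0.
  - apply: emeasurable_funM; apply/measurable_EFinP; last exact: measurable_normal_pdf.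
    exact: measurable_funX.
  - apply: emeasurable_funM => //; apply/measurable_EFinP; exact: measurable_normal_pdf.
  - move=> x _; rewrite -!EFinM lee_fin !normal_pdfE ?oner_eq0// /C /normal_fun.
    rewrite !subr0 expr1n sqr_sqrtr//.
    have h1 : (x ^+ 2 / 4 <= expR (x ^+ 2 / 4))%R.
      by apply: le_trans (expR_ge1Dx _); rewrite lerDr.
    have h2 : (expR (- x ^+ 2 / (1 *+ 2)) * expR (x ^+ 2 / 4) = expR (- x ^+ 2 / (2 *+ 2)))%R.
      by rewrite -expRD; congr expR; field.
    rewrite [leRHS](_ : _ = normal_peak 1 * (4 * expR (- x ^+ 2 / (2 *+ 2))))%R; last first.
      by field; rewrite gt_eqF ?normal_peak_gt0.
    rewrite mulrCA ler_wpM2l ?normal_peak_ge0// -h2 mulrC [leRHS]mulrCA.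
    rewrite ler_wpM2l ?expR_ge0//; lra.
rewrite ge0_integralZl//; last 2 first.
  - by apply/measurable_EFinP; exact: measurable_normal_pdf.
  - by move=> x _; rewrite lee_fin normal_pdf_ge0.
by rewrite integral_normal_pdf mule1 ltry.
Qed.

Lemma N01_integralD (h1 h2 : R -> \bar R) :
  measurable_fun [set: R] h1 -> measurable_fun [set: R] h2 ->
  (forall x, 0 <= h1 x) -> (forall x, 0 <= h2 x) ->
  \int[N01]_x (h1 x + h2 x) = \int[N01]_x h1 x + \int[N01]_x h2 x.
Proof. by move=> m1 m2 p1 p2; apply: ge0_integralD. Qed.

Lemma N01_integralZ (h : R -> \bar R) (t : R) : (0 <= t)%R ->
  measurable_fun [set: R] h -> (forall x, 0 <= h x) ->
  \int[N01]_x (t%:E * h x) = t%:E * \int[N01]_x h x.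
Proof. by move=> t0 mh p; apply: ge0_integralZl. Qed.

(** The cross term is removed by averaging the integrals at r and -r, which keeps every integrand
    nonnegative. *)
Lemma normal_quad (s c : R) :
  \int[N01]_r ((s + c * r) ^+ 2)%:E = (s ^+ 2)%:E + (c ^+ 2)%:E * normal_m2.
Proof.
have mq (c' : R) : measurable_fun [set: R] (fun r : R => ((s + c' * r) ^+ 2)%:E).
  by apply/measurable_EFinP; apply: measurable_funX; apply: measurable_funD => //; exact: measurable_funM.
set q := \int[N01]_r _.
have qN : \int[N01]_r ((s - c * r) ^+ 2)%:E = q.
  rewrite /q -[RHS]normal_integral_sym//; last by move=> x; rewrite lee_fin sqr_ge0.
  by apply: eq_integral => x _; rewrite mulrN.
have q0 : 0 <= q by apply: integral_ge0 => x _; rewrite lee_fin sqr_ge0.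
have -> : q = (2^-1)%:E * (q + q).
  rewrite -[X in X + X](mul1e q) -ge0_muleDl// muleA -EFinD -EFinM.
  by rewrite (_ : (2^-1 * (1 + 1) = 1)%R) ?mul1e//; field.
have mqN := mq (- c)%R.
have -> : q + q = \int[N01]_r (((s + c * r) ^+ 2)%:E + ((s - c * r) ^+ 2)%:E).
  rewrite N01_integralD ?qN// => [|x|x]; rewrite ?lee_fin ?sqr_ge0//.
  by under eq_fun do rewrite -mulNr.
rewrite -N01_integralZ; last 3 first.
  - by rewrite invr_ge0.
  - apply: emeasurable_funD => //; by under eq_fun do rewrite -mulNr.
  - by move=> x; rewrite adde_ge0// lee_fin sqr_ge0.
have m2 : measurable_fun [set: R] (fun r : R => (r ^+ 2)%:E).
  by apply/measurable_EFinP; exact: measurable_funX.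
transitivity (\int[N01]_r ((cst (s ^+ 2)%:E r) + (c ^+ 2)%:E * (r ^+ 2)%:E)).
  by apply: eq_integral => r _; rewrite /=; congr EFin; field.
rewrite N01_integralD; last 4 first.
- exact: measurable_cst.
- by apply: emeasurable_funM => //; exact: measurable_cst.
- by move=> x; rewrite lee_fin sqr_ge0.
- by move=> x; rewrite -EFinM lee_fin mulr_ge0// sqr_ge0.
rewrite N01_integralZ ?sqr_ge0// => [|x]; last by rewrite lee_fin sqr_ge0.
by rewrite integral_cst//= probability_setT mule1.
Qed.

End NormalMoments.

Section SecondMoment.
Context d (T : measurableType d) (R : realType) (P : probability T R).
Variables (I : finType) (f : I -> T -> R).
Hypothesis indep : mutual_indep P f.
Hypothesis nf : forall i, std_normal P (f i).
Local Open Scope ereal_scope.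

Lemma second_moment (c : I -> R) :
  \int[P]_w ((\sum_i c i * f i w) ^+ 2)%:E = (\sum_i c i ^+ 2)%:E * normal_m2 R.
Proof.
have mf i : measurable_fun setT (f i) by case: (nf i).
have lf i : forall B, measurable B -> P (f i @^-1` B) = normal_prob 0%R 1%R B by case: (nf i).
pose G i (v : R) := (c i * v)%R.
have mG i : measurable_fun setT (G i) by exact: measurable_funM.
suff H (s : seq I) : uniq s ->
    \int[P]_w ((partial_sum f G s w) ^+ 2)%:E = (\sum_(i <- s) c i ^+ 2)%:E * normal_m2 R.
  by apply: H; exact: index_enum_uniq.
elim: s => [|i s IH] us.
  rewrite big_nil mul0e integral0_eq// => w _.
  by rewrite /partial_sum big_nil expr0n.
pose h (x : R * R) : \bar R := ((x.1 + c i * x.2) ^+ 2)%:E.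
have mh : measurable_fun setT h.
  apply/measurable_EFinP; apply: measurable_funX; apply: measurable_funD => //.
  exact: measurable_funM.
have h0 x : 0 <= h x by rewrite lee_fin sqr_ge0.
transitivity (\int[P]_w h (partial_sum f G s w, f i w)).
  by apply: eq_integral => w _; rewrite /h /partial_sum big_cons /G addrC.
rewrite (expect_partial_sum_pair1 indep mf mG lf us mh h0) /h/=.
under eq_integral do rewrite normal_quad.
have us' : uniq s by case/andP: us.
rewrite ge0_integralD//=; last 3 first.
- by move=> x _; rewrite lee_fin sqr_ge0.
- by apply/measurable_EFinP; apply: measurable_funX; exact: measurable_partial_sum.
- by move=> x _; rewrite mule_ge0 ?normal_m2_ge0// lee_fin sqr_ge0.
rewrite integral_cst//= probability_setT mule1 IH// big_cons addrC EFinD.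
by rewrite ge0_muleDl ?normal_m2_ge0// lee_fin ?sqr_ge0// sumr_ge0// => j _; rewrite sqr_ge0.
Qed.

End SecondMoment.

(** * The chi-square distribution *)

Section ChiSquareCdf.
Variables (R : realType) (F : R -> R) (v : R) (n : nat).
Notation mu := (@lebesgue_measure R).
Let g (y : R) := y `^ (n%:R / 2).
Hypothesis n0 : (0 < n)%N.
Hypothesis v0 : 0 <= v.
(* [v * g] is the tilted distribution function. *)
Hypothesis Fincr : forall a b, 0 < a -> a <= b ->
  expR (- b / 2) * (v * (g b - g a)) <= F b - F a <= expR (- a / 2) * (v * (g b - g a)).
Hypothesis F0 : forall b, 0 < b -> 0 <= F b <= v * g b.
Hypothesis F1 : F x @[x --> +oo] --> (1 : R).

Let D (x : R) := v * (n%:R / 2) * chi2_dens n x.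

(** The one-sided bounds [Fincr] in a form valid for both signs of y - x, as a two-sided derivative
    demands. *)
Lemma cdf_increment (x y : R) : 0 < x -> 0 < y ->
  `|F y - F x - expR (- x / 2) * (v * (g y - g x))| <=
  `|expR (- y / 2) - expR (- x / 2)| * (v * `|g y - g x|).
Proof.
move=> x0 y0; have ng : 0 <= n%:R / 2 :> R by rewrite divr_ge0.
have ex (a b : R) : a <= b -> expR (- b / 2) <= expR (- a / 2) by move=> ab; rewrite ler_expR; lra.
have := Fincr y0 (b := x); have := Fincr x0 (b := y); have := ex x y; have := ex y x.
move: (expR (- x / 2)) (expR (- y / 2)) => X Y exy eyx Fx Fy.
have [xy|/ltW yx] := leP x y.
- have gxy : 0 <= g y - g x by rewrite subr_ge0 ge0_ler_powR// nnegrE ltW.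
  have /andP[h1 h2] := Fx xy.
  have e : Y - X <= 0 by rewrite subr_le0 eyx.
  rewrite (ler0_norm e) (ger0_norm gxy) ler0_norm; last by rewrite subr_le0.
  by rewrite mulNr mulrBl; lra.
- have gxy : 0 <= g x - g y by rewrite subr_ge0 ge0_ler_powR// nnegrE ltW.
  have /andP[h1 h2] := Fy yx.
  have e : 0 <= Y - X by rewrite subr_ge0 exy.
  rewrite (ger0_norm e) (distrC (g y)) (ger0_norm gxy).
  have -> : g y - g x = - (g x - g y) by rewrite opprB.
  rewrite !mulrN opprK ler0_norm; last lra.
  by rewrite mulrBl; lra.
Qed.

(** The difference quotient of F differs from exp(-x/2) v times that of g by at most the increment
    of the exponential times a convergent quotient, hence by a vanishing amount. *)
Lemma is_derive_cdf (x : R) : 0 < x -> is_derive x 1 F (D x).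
Proof.
move=> x0.
have dg : is_derive x 1 g (n%:R / 2 * x `^ (n%:R / 2 - 1)) by exact: is_derive1_powR.
have [dgx gE] := dg.
have cE : {for x, continuous (fun y : R => expR (- y / 2))}.
  apply: continuous_comp; last exact: continuous_expR.
  apply: cvgM; last exact: cvg_cst. by apply: (@cvgN _ R^o); exact: cvg_id.
pose q (h : R) := h^-1 *: (g (h *: 1 + x) - g x).
pose Q (h : R) := h^-1 *: (F (h *: 1 + x) - F x).
have qD : q h @[h --> 0^'] --> n%:R / 2 * x `^ (n%:R / 2 - 1) by rewrite -gE; exact: dgx.
have cx : (fun h : R => h *: 1 + x) @ 0^' --> x.
  have c0' : (h *: (1 : R) + x) @[h --> (0 : R)] --> (0 : R) *: (1 : R) + x.
    by apply: cvgD; [apply: cvgZr_tmp; exact: cvg_id|exact: cvg_cst].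
  rewrite scale0r add0r in c0'.
  by apply: cvg_trans c0'; apply: cvg_app; exact: cvg_within.
have cEx : expR (- (h *: 1 + x) / 2) @[h --> 0^'] --> expR (- x / 2).
  exact: (cvg_comp _ _ cx cE).
have QD : Q h @[h --> 0^'] --> D x.
  have e1 : expR (- x / 2) * (v * q h) @[h --> 0^'] --> D x.
    have -> : D x = expR (- x / 2) * (v * (n%:R / 2 * x `^ (n%:R / 2 - 1))).
      by rewrite /D /chi2_dens; ring.
    by apply: cvgM; [exact: cvg_cst|apply: cvgM; [exact: cvg_cst|]].
  have e2 : `|expR (- (h *: 1 + x) / 2) - expR (- x / 2)| * (v * `|q h|) @[h --> 0^']
      --> `|expR (- x / 2) - expR (- x / 2)| * (v * `|n%:R / 2 * x `^ (n%:R / 2 - 1)|).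
    apply: cvgM; first exact: (cvg_norm (cvgB cEx (cvg_cst _))).
    apply: cvgM; first exact: cvg_cst.
    exact: (cvg_norm qD).
  rewrite subrr normr0 mul0r in e2.
  have e3 : Q h - expR (- x / 2) * (v * q h) @[h --> 0^'] --> (0 : R).
    apply: norm_cvg0; apply: (squeeze_cvgr (f := fun=> 0)) e2; last exact: cvg_cst.
    near=> h; rewrite normr_ge0/=.
    have h0 : h != 0 by near: h; exact: nbhs_dnbhs_neq.
    have hx : 0 < h *: 1 + x by near: h; apply: (cvgr_gt _ cx).
    have := cdf_increment x0 hx; rewrite -(ler_pM2l (_ : 0 < `|h^-1|)) ?normr_gt0 ?invr_eq0//.
    rewrite -normrM /Q /q /GRing.scale/= normrM.
    have -> : h^-1 * (F (h * 1 + x) - F x) - expR (- x / 2) * (v * (h^-1 * (g (h * 1 + x) - g x))) =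
      h^-1 * (F (h * 1 + x) - F x - expR (- x / 2) * (v * (g (h * 1 + x) - g x))) by ring.
    rewrite normrM => hh; apply: le_trans hh _.
    by rewrite normrM le_eqVlt; apply/orP; left; apply/eqP; ring.
  rewrite -[D x]add0r.
  have -> : Q = (fun h => (Q h - expR (- x / 2) * (v * q h)) + expR (- x / 2) * (v * q h)).
    by apply/funext => h; rewrite subrK.
  exact: cvgD.
have dF : derivable F x 1 by apply/cvg_ex; exists (D x).
by apply: DeriveDef => //; apply: cvg_lim.
Unshelve. all: end_near. Qed.

Lemma continuous_cdf (x : R) : 0 < x -> {for x, continuous F}.
Proof.
move=> x0; have [dF _] := is_derive_cdf x0.
exact/differentiable_continuous/derivable1_diffP.
Qed.

Lemma continuous_dens (x : R) : 0 < x -> {for x, continuous D}.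
Proof.
move=> x0.
have c1 : {for x, continuous (fun y : R => y `^ (n%:R / 2 - 1))}.
  have [dg _] := @is_derive1_powR R (n%:R / 2 - 1) x x0.
  exact/differentiable_continuous/derivable1_diffP.
have c2 : {for x, continuous (fun y : R => expR (- y / 2))}.
  apply: continuous_comp; last exact: continuous_expR.
  by apply: cvgM; [apply: (@cvgN _ R^o); exact: cvg_id|exact: cvg_cst].
apply: cvgM; first exact: cvg_cst.
exact: cvgM.
Qed.

Lemma D_ge0 x : 0 <= D x.
Proof. by rewrite !mulr_ge0 ?powR_ge0 ?expR_ge0// invr_ge0. Qed.

Lemma measurable_D : measurable_fun [set: R] D.
Proof.
apply: measurable_funM => //; apply: measurable_funM.
  exact: measurable_powR.
by apply: measurableT_comp => //; apply: measurable_funM => //; exact: measurableT_comp.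
Qed.

Lemma integral_dens_itv (a b : R) : 0 < a -> a < b ->
  (\int[mu]_(x in `[a, b]) (D x)%:E = (F b)%:E - (F a)%:E)%E.
Proof.
move=> a0 ab; apply: continuous_FTC2 => //.
- apply/continuous_within_itvP => //; split.
  + by move=> x; rewrite in_itv/= => /andP[ax _]; apply: continuous_dens; exact: lt_trans ax.
  + by apply: cvg_at_right_filter; exact: continuous_dens.
  + by apply: cvg_at_left_filter; apply: continuous_dens; exact: lt_trans ab.
- split.
  + by move=> x; rewrite in_itv/= => /andP[ax _]; have [] := is_derive_cdf (lt_trans a0 ax).
  + by apply: cvg_at_right_filter; exact: continuous_cdf.
  + by apply: cvg_at_left_filter; apply: continuous_cdf; exact: lt_trans ab.
- move=> x; rewrite in_itv/= => /andP[ax _]; rewrite derive1E.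
  by have [_ ->] := is_derive_cdf (lt_trans a0 ax).
Qed.

Lemma integral_dens_y (a : R) : 0 < a ->
  (\int[mu]_(x in `[a, +oo[) (D x)%:E = 1 - (F a)%:E)%E.
Proof.
move=> a0; apply: (ge0_continuous_FTC2y (F := F)) => //.
- by move=> x _; exact: D_ge0.
- apply/continuous_within_itvcyP; split.
  + by move=> x; rewrite in_itv/= andbT => ax; apply: continuous_dens; exact: lt_trans ax.
  + by apply: cvg_at_right_filter; exact: continuous_dens.
- by move=> x ax; have [] := is_derive_cdf (lt_trans a0 ax).
- by apply: cvg_at_right_filter; exact: continuous_cdf.
- move=> x; rewrite in_itv/= andbT => ax; rewrite derive1E.
  by have [_ ->] := is_derive_cdf (lt_trans a0 ax).
Qed.

(* Squared so that [g (eps_seq b k)] is [O(1/k)] already for [n = 1]. *)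
Let eps_seq (b : R) (k : nat) := b * (k.+2%:R^-1) ^+ 2.

Lemma eps_seq_gt0 b k : 0 < b -> 0 < eps_seq b k.
Proof. by move=> b0; rewrite mulr_gt0// exprn_gt0// invr_gt0. Qed.

Lemma eps_seq_lt b k : 0 < b -> eps_seq b k < b.
Proof.
move=> b0; rewrite /eps_seq gtr_pMr// exprVn invf_lt1 ?exprn_gt0//.
by rewrite exprn_egt1// ltr1n.
Qed.

Lemma eps_seq_le b k : 0 < b -> eps_seq b k <= b * k.+2%:R^-1.
Proof.
move=> b0; rewrite /eps_seq ler_pM2l// expr2 ler_piMr ?invr_ge0//.
by rewrite invf_le1// ler1n.
Qed.

Lemma cvg_harmonic2 : (k.+2%:R^-1 : R) @[k --> \oo] --> (0 : R).
Proof.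
have := @cvg_harmonic R; rewrite -(cvg_shiftS _).
exact.
Qed.

Lemma cvg_cdf_eps b : 0 < b -> F (eps_seq b k) @[k --> \oo] --> (0 : R).
Proof.
move=> b0; have e : v * g b * (k.+2%:R^-1) @[k --> \oo] --> (0 : R).
  rewrite -[X in _ --> X](mulr0 (v * g b)); apply: cvgM; first exact: cvg_cst.
  exact: cvg_harmonic2.
apply: (squeeze_cvgr (f := fun=> 0)) e; last exact: cvg_cst.
near=> k; have /andP[-> h]/= := F0 (eps_seq_gt0 k b0).
apply: le_trans h _; rewrite -mulrA ler_wpM2l// /g /eps_seq.
have k0 : 0 <= k.+2%:R^-1 :> R by rewrite invr_ge0.
rewrite powRM ?exprn_ge0 ?(ltW b0)// ler_wpM2l ?powR_ge0//.
rewrite -[X in X `^ _]powR_mulrn// -powRrM mulrCA divff// mulr1 powR_mulrn//.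
rewrite -(prednK n0) exprS ler_piMr// exprn_ile1//.
by rewrite invf_le1// ler1n.
Unshelve. all: end_near. Qed.

(** The density is unbounded near 0 when n = 1, so the fundamental theorem is used on intervals
    starting at [eps_seq b k] and monotone convergence reaches 0. *)
Lemma integral_dens_0 (b : R) : 0 < b -> (\int[mu]_(x in `[0%R, b]) (D x)%:E = (F b)%:E)%E.
Proof.
move=> b0; have mD : measurable_fun [set: R] (fun x => (D x)%:E).
  by apply/measurable_EFinP; exact: measurable_D.
rewrite -integral_itv_obnd_cbnd; last exact: measurable_funTS.
have U : \bigcup_k `[eps_seq b k, b]%classic = `]0, b]%classic.
  apply/seteqP; split => x.
    move=> [k _]/=; rewrite !in_itv/= => /andP[h ->]; rewrite andbT.
    exact: lt_le_trans (eps_seq_gt0 k b0) h.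
  rewrite /= in_itv/= => /andP[x0 xb].
  have := cvg_harmonic2; have xb0 : 0 < x / b by rewrite divr_gt0.
  move=> /cvgr_lt/(_ _ xb0)[k _ /(_ k (leqnn k))/= hk].
  exists k => //=; rewrite in_itv/= xb andbT; apply: le_trans (eps_seq_le k b0) _.
  by rewrite mulrC -ler_pdivlMr// ltW.
have cv : (\int[mu]_(x in `[eps_seq b k, b]) (D x)%:E)%E @[k --> \oo] --> (F b)%:E.
  rewrite (_ : (fun k => _) = (fun k => (F b - F (eps_seq b k))%:E)); last first.
    by apply/funext => k; rewrite (integral_dens_itv (eps_seq_gt0 _ b0) (eps_seq_lt _ b0)).
  apply: cvg_EFin; first by near=> k.
  rewrite -[X in _ --> X](subr0 (F b)).
  by apply: cvgB; [exact: cvg_cst|exact: cvg_cdf_eps].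
have H := @ge0_nondecreasing_set_cvg_integral _ (measurableTypeR R) R (fun k => `[eps_seq b k, b]%classic) (fun x => (D x)%:E) mu.
rewrite U in H; apply: (cvg_unique _ (H _ _ _ _) cv) => //.
- move=> k l kl; apply/subsetPset => x /=; rewrite !in_itv/= => /andP[h ->]; rewrite andbT.
  apply: le_trans h; rewrite /eps_seq ler_pM2l// lerXn2r ?nnegrE ?invr_ge0//.
  by rewrite lef_pV2 ?posrE// ler_nat.
- by move=> k; exact: measurable_funTS.
- by move=> k x _; rewrite lee_fin D_ge0.
Unshelve. all: end_near. Qed.

(** The constant [v] is unknown, but total mass one forces v n / 2 to be the reciprocal of the
    integral of [chi2_dens], the normalization in [chi2_cdf]. *)
Lemma chi2_cdf_unique (x : R) : 0 < x -> F x = chi2_cdf n x.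
Proof.
move=> x0; pose c := v * (n%:R / 2).
have mdens : measurable_fun [set: R] (fun x => (chi2_dens n x)%:E : \bar R).
  apply/measurable_EFinP; apply: measurable_funM; first exact: measurable_powR.
  by apply: measurableT_comp => //; apply: measurable_funM => //; exact: measurableT_comp.
have dens0 y : (0 <= (chi2_dens n y)%:E :> \bar R)%E.
  by rewrite lee_fin mulr_ge0 ?powR_ge0 ?expR_ge0.
have c0 : 0 <= c by rewrite mulr_ge0// divr_ge0.
have DE (A : set R) : measurable A -> (\int[mu]_(t in A) (D t)%:E = c%:E * \int[mu]_(t in A) (chi2_dens n t)%:E)%E.
  move=> mA; rewrite -ge0_integralZl//; last exact: measurable_funTS.
have h1 := integral_dens_0 x0.
have hT : (\int[mu]_(t in `[0%R, +oo[) (D t)%:E = 1)%E.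
  rewrite (_ : `[0, +oo[%classic = `[0, x[%classic `|` `[x, +oo[%classic); last first.
    by rewrite -itv_bndbnd_setU// bnd_simp ltW.
  rewrite ge0_integral_setU//=; last 3 first.
  - by apply/measurable_EFinP/measurable_funTS; exact: measurable_D.
  - by move=> t _; rewrite lee_fin D_ge0.
  - rewrite disj_set2E; apply/eqP; rewrite -subset0 => t/=.
    by rewrite !in_itv/= andbT => -[/andP[_ tx]]; rewrite leNgt tx.
  rewrite integral_itv_bndo_bndc; last by apply/measurable_EFinP/measurable_funTS; exact: measurable_D.
  by rewrite h1 integral_dens_y// addeC subeK.
rewrite /chi2_cdf/=; move: h1 hT; rewrite !DE//.
set A := (\int[mu]_(t in `[0%R, x]) _)%E; set B := (\int[mu]_(t in `[0%R, +oo[) _)%E => hA hB.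
have cn0 : c != 0 by apply/eqP => ce; move: hB; rewrite ce mul0e => /eqP; rewrite eqe eq_sym oner_eq0.
have inv (E : \bar R) (r : R) : (c%:E * E = r%:E)%E -> fine E = r / c.
  move=> h; have -> : E = (c^-1%:E * (c%:E * E))%E by rewrite muleA -EFinM mulVf// mul1e.
  by rewrite h -EFinM/= mulrC.
by rewrite (inv _ _ hA) (inv _ _ hB) mul1r invrK divfK.
Qed.

End ChiSquareCdf.

Lemma ge0_integralZ d (T : measurableType d) (R : realType) (P : {measure set T -> \bar R})
    (t : R) (h : T -> \bar R) : 0 <= t -> measurable_fun setT h -> (forall x, (0 <= h x)%E) ->
  (\int[P]_x (t%:E * h x) = t%:E * \int[P]_x h x)%E.
Proof. by move=> t0 mh p; apply: ge0_integralZl. Qed.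

(** * Tilted law of a sum of squares *)

Section ChiSquareLaw.
Context d (T : measurableType d) (R : realType) (P : probability T R).
Variables (I : finType) (f : I -> T -> R).
Hypothesis indep : mutual_indep P f.
Hypothesis nf : forall i, std_normal P (f i).
Notation mu := (@lebesgue_measure R).
Notation N01 := (normal_prob (0 : R)%R 1%R).

Definition sqsum (s : seq I) (w : T) : R := partial_sum f (fun _ v => v ^+ 2) s w.

Let mf i : measurable_fun setT (f i). Proof. by case: (nf i). Qed.
Let lf i : forall B, measurable B -> P (f i @^-1` B) = N01 B. Proof. by case: (nf i). Qed.
Let mG (i : I) : measurable_fun setT (fun v : R => v ^+ 2). Proof. exact: measurable_funX. Qed.

Lemma measurable_sqsum s : measurable_fun setT (sqsum s).
Proof. exact: (measurable_partial_sum mf mG). Qed.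

Lemma sqsum_ge0 s w : 0 <= sqsum s w.
Proof. by apply: sumr_ge0 => i _; exact: sqr_ge0. Qed.

Local Open Scope ereal_scope.

(* The factor [expR (S / 2)] cancels the Gaussian weight, so that the tilted law of a sum of
   [n] squares scales like the Lebesgue measure of a ball in dimension [n]. *)
Definition tilt (s : seq I) (h : R -> \bar R) : \bar R :=
  \int[P]_w (h (sqsum s w) * (expR (sqsum s w / 2))%:E).

Lemma tilt_ge0 s h : (forall x, 0 <= h x) -> 0 <= tilt s h.
Proof. by move=> h0; apply: integral_ge0 => w _; rewrite mule_ge0// lee_fin expR_ge0. Qed.

Lemma measurable_tilt s (h : R -> \bar R) : measurable_fun [set: R] h -> (forall x, 0 <= h x) ->
  measurable_fun [set: R] (fun r => tilt s (fun x => h (x + r ^+ 2)%R)).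
Proof.
move=> mh h0.
pose k (x : T * R) := h (sqsum s x.1 + x.2 ^+ 2)%R * (expR (sqsum s x.1 / 2))%:E.
have mS1 : measurable_fun [set: T * R] (fun x => sqsum s x.1).
  by apply: measurableT_comp => //; exact: measurable_sqsum.
apply: (measurable_fun_fubini_tonelli_G (m1 := P) k) => [|x].
  apply: emeasurable_funM.
    apply: measurableT_comp => //; apply: measurable_funD => //.
    exact: measurable_funX.
  apply/measurable_EFinP; apply: measurableT_comp => //.
  exact: measurable_funM.
by rewrite /k mule_ge0// lee_fin expR_ge0.
Qed.

(** The tilt of the new square cancels its Gaussian exponential, so that coordinate is integrated
    against Lebesgue measure times the peak. *)
Lemma tilt_cons i s (h : R -> \bar R) : uniq (i :: s) ->
  measurable_fun [set: R] h -> (forall x, 0 <= h x) ->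
  tilt (i :: s) h = \int[mu]_r ((normal_peak 1)%:E * tilt s (fun x => h (x + r ^+ 2)%R)).
Proof.
move=> us mh h0.
have mE : measurable_fun [set: R] (fun r : R => (expR (r / 2))%:E).
  by apply/measurable_EFinP; apply: measurableT_comp => //; exact: measurable_funM.
pose H (x : R * R) := h (x.1 + x.2 ^+ 2)%R * (expR ((x.1 + x.2 ^+ 2) / 2))%:E.
have mD : measurable_fun setT (fun x : R * R => x.1 + x.2 ^+ 2)%R.
  by apply: measurable_funD => //; exact: measurable_funX.
have mH : measurable_fun setT H.
  apply: emeasurable_funM; first exact: measurableT_comp.
  exact: (measurableT_comp mE mD).
have H0 x : 0 <= H x by rewrite mule_ge0// lee_fin expR_ge0.
transitivity (\int[P]_w H (sqsum s w, f i w)).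
  by apply: eq_integral => w _; rewrite /H /sqsum /partial_sum/= big_cons addrC.
rewrite (expect_partial_sum_pair2 indep mf (fun i => mG i) lf us mH H0).
have HE r : \int[P]_w H (partial_sum f (fun _ v => v ^+ 2)%R s w, r) =
    (expR (r ^+ 2 / 2))%:E * tilt s (fun x => h (x + r ^+ 2)%R).
  rewrite /tilt -ge0_integralZ; last 3 first.
  - exact: expR_ge0.
  - apply: emeasurable_funM.
      apply: measurableT_comp => //; apply: measurable_funD => //; exact: measurable_sqsum.
    apply: (measurableT_comp mE); exact: measurable_sqsum.
  - by move=> w; rewrite mule_ge0// lee_fin expR_ge0.
  apply: eq_integral => w _; rewrite /H/= -/(sqsum s w) mulrDl expRD EFinM.
  by rewrite [RHS]muleC -muleA.
have mt := measurable_tilt s mh h0.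
under eq_integral do rewrite HE.
have mr2 : measurable_fun [set: R] (fun r : R => (expR (r ^+ 2 / 2))%:E).
  have m2 : measurable_fun [set: R] (fun r : R => r ^+ 2)%R by exact: measurable_funX.
  exact: (measurableT_comp mE m2).
rewrite integral_normal_prob//; last 2 first.
- exact: emeasurable_funM.
- by move=> r; rewrite mule_ge0 ?tilt_ge0// lee_fin expR_ge0.
apply: eq_integral => r _; rewrite normal_pdfE ?oner_eq0//= /normal_fun subr0.
rewrite muleAC -EFinM; congr (_%:E * _).
rewrite mulrCA -expRD expr1n [X in expR X](_ : _ = 0%R) ?expR0 ?mulr1//.
by field.
Qed.

(** The substitution r -> t r in each coordinate yields one factor t per square. *)
Lemma tilt_scale s (t : R) (h : R -> \bar R) : uniq s -> (0 < t)%R ->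
  measurable_fun [set: R] h -> (forall x, 0 <= h x) ->
  tilt s (fun x => h (x / t ^+ 2)%R) = (t ^+ size s)%:E * tilt s h.
Proof.
move=> + t0; elim: s h => [|i s IH] h us mh h0.
  rewrite expr0 mul1e; apply: eq_integral => w _.
  by rewrite /sqsum /partial_sum big_nil mul0r.
have us' : uniq s by case/andP: us.
have mD (c : R) : measurable_fun [set: R] (fun x : R => h (x + c)%R).
  by apply: measurableT_comp => //; exact: measurable_funD.
have mDt : measurable_fun [set: R] (fun x : R => h (x / t ^+ 2)%R).
  by apply: measurableT_comp => //; exact: measurable_funM.
rewrite !tilt_cons// (integral_scale t0); last 2 first.
- apply: emeasurable_funM => //; exact: (measurable_tilt s mDt).
- by move=> x; rewrite mule_ge0 ?tilt_ge0// lee_fin normal_peak_ge0.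
rewrite (exprS t (size s)) EFinM -muleA; congr (_ * _).
rewrite -ge0_integralZ; last 3 first.
- by rewrite exprn_ge0// ltW.
- by apply: emeasurable_funM => //; exact: measurable_tilt.
- by move=> x; rewrite mule_ge0 ?tilt_ge0// lee_fin normal_peak_ge0.
apply: eq_integral => r _; rewrite muleCA; congr (_ * _).
rewrite -(IH (fun x => h (x + r ^+ 2)%R))//.
apply: eq_integral => w _; congr (h _ * _).
by field; rewrite gt_eqF.
Qed.

End ChiSquareLaw.

Section ChiSquareDistribution.
Context d (T : measurableType d) (R : realType) (P : probability T R).
Variables (I : finType) (f : I -> T -> R).
Hypothesis indep : mutual_indep P f.
Hypothesis nf : forall i, std_normal P (f i).
Variable s : seq I.
Hypothesis us : uniq s.
Hypothesis s0 : (0 < size s)%N.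
Let S := sqsum f s.

Let mS : measurable_fun setT S. Proof. exact: measurable_sqsum nf s. Qed.

Let mSA (A : set R) : measurable A -> measurable (S @^-1` A).
Proof. by move=> mA; rewrite -[X in measurable X]setTI; exact: mS. Qed.

Local Open Scope ereal_scope.

Let ind (A : set R) (x : R) : \bar R := (\1_A x)%:E.

Let mind A : measurable A -> measurable_fun [set: R] (ind A).
Proof. by move=> mA; apply/measurable_EFinP; exact: measurable_indic. Qed.

Let ind0 A x : 0 <= ind A x. Proof. by rewrite lee_fin. Qed.

Let mindS A : measurable A -> measurable_fun [set: T] (fun w => ind A (S w)).
Proof. by move=> mA; exact: (measurableT_comp (mind mA) mS). Qed.

Let mexpS : measurable_fun [set: T] (fun w => (expR (S w / 2))%:E : \bar R).
Proof.
by apply/measurable_EFinP; apply: measurableT_comp => //; exact: measurable_funM.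
Qed.

Let int_indS A : measurable A -> \int[P]_w ind A (S w) = P (S @^-1` A).
Proof. by move=> mA; rewrite -[X in P X]setIT -integral_indic//; exact: mSA. Qed.

Lemma tilt_indic_le (A : set R) (b : R) : measurable A -> (forall x, A x -> (x <= b)%R) ->
  tilt P f s (ind A) <= (expR (b / 2))%:E * P (S @^-1` A).
Proof.
move=> mA Ab; rewrite -int_indS// -ge0_integralZ; last 3 first.
- exact: expR_ge0.
- exact: mindS.
- by [].
apply: ge0_le_integral => //.
- by move=> w _; rewrite mule_ge0// lee_fin expR_ge0.
- by apply: emeasurable_funM => //; exact: mindS.
- by apply: emeasurable_funM => //; exact: mindS.
move=> w _; rewrite muleC /ind indicE -/S; have [AS|_] := boolP (S w \in A).
  by rewrite !mule1 lee_fin ler_expR ler_pM2r ?invr_gt0//; apply: Ab; rewrite inE in AS.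
by rewrite !mule0.
Qed.

Lemma tilt_indic_ge (A : set R) (a : R) : measurable A -> (forall x, A x -> (a <= x)%R) ->
  (expR (a / 2))%:E * P (S @^-1` A) <= tilt P f s (ind A).
Proof.
move=> mA Aa; rewrite -int_indS// -ge0_integralZ; last 3 first.
- exact: expR_ge0.
- exact: mindS.
- by [].
apply: ge0_le_integral => //.
- by move=> w _; rewrite mule_ge0// lee_fin expR_ge0.
- by apply: emeasurable_funM => //; exact: mindS.
- by apply: emeasurable_funM => //; exact: mindS.
move=> w _; rewrite [leRHS]muleC /ind indicE -/S; have [AS|_] := boolP (S w \in A).
  by rewrite !mule1 lee_fin ler_expR ler_pM2r ?invr_gt0//; apply: Aa; rewrite inE in AS.
by rewrite !mule0.
Qed.

(** A power of the normal peak times the volume of the unit ball in dimension [size s]. *)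
Let V : \bar R := tilt P f s (ind `]-oo, 1%R]).

Lemma tilt1_fin : V \is a fin_num.
Proof.
rewrite ge0_fin_numE; last exact: tilt_ge0.
apply: (@le_lt_trans _ _ ((expR (1 / 2))%:E * P (S @^-1` `]-oo, 1%R]))).
  by apply: tilt_indic_le => // x; rewrite /= in_itv.
apply: (@le_lt_trans _ _ ((expR (1 / 2))%:E * 1)).
  by rewrite lee_pmul2l ?lte_fin ?expR_gt0// probability_le1//; exact: mSA.
by rewrite mule1 ltry.
Qed.

(** The event S <= y is the unit one dilated by t = sqrt y, so [tilt_scale] gives the factor t^(size
    s). *)
Lemma tilt_le (y : R) : (0 < y)%R ->
  tilt P f s (ind `]-oo, y]) = (fine V * y `^ ((size s)%:R / 2))%:E.
Proof.
move=> y0; pose t := (y `^ 2^-1)%R.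
have t0 : (0 < t)%R by exact: powR_gt0.
have t2 : (t ^+ 2 = y)%R.
  by rewrite -powR_mulrn ?(ltW t0)// -powRrM mulVf// powRr1// ltW.
have -> : ind `]-oo, y] = (fun x => ind `]-oo, 1%R] (x / t ^+ 2)%R).
  apply/funext => x; rewrite /ind !indicE t2; congr ((nat_of_bool _)%:R%:E).
  by apply/idP/idP; rewrite !inE/= !in_itv/= ler_pdivrMr// mul1r.
rewrite (tilt_scale indep nf us t0); [|exact: mind|by []].
rewrite -/V -[V]fineK ?tilt1_fin//= -EFinM mulrC; congr (_ * _)%:E.
by rewrite /t -powR_mulrn ?powR_ge0// -powRrM mulrC.
Qed.

Let F (y : R) : R := fine (P (S @^-1` `]-oo, y])).

Let FE y : P (S @^-1` `]-oo, y]) = (F y)%:E.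
Proof. by rewrite /F fineK// fin_num_measure//; exact: mSA. Qed.

Lemma tilt_itv (a b : R) : (0 < a)%R -> (a <= b)%R ->
  tilt P f s (ind `]a, b]) = (fine V * (b `^ ((size s)%:R / 2) - a `^ ((size s)%:R / 2)))%:E.
Proof.
move=> a0 ab; have b0 : (0 < b)%R by exact: lt_le_trans ab.
have : tilt P f s (ind `]-oo, b]) = tilt P f s (ind `]-oo, a]) + tilt P f s (ind `]a, b]).
  rewrite /tilt -ge0_integralD//.
  - apply: eq_integral => w _; rewrite -ge0_muleDl//; congr (_ * _).
    rewrite /ind -EFinD !indicE; congr EFin.
    have e y z : (y \in `]-oo, z]%classic) = (y <= z)%R.
      by apply/idP/idP; rewrite inE/= in_itv.
    have e' y : (y \in `]a, b]%classic) = (a < y <= b)%R.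
      by apply/idP/idP; rewrite inE/= in_itv.
    rewrite !e e'; case: (leP (sqsum f s w) a) => ha /=.
      by rewrite (le_trans ha ab) addr0.
    by rewrite add0r.
  - by move=> w _; rewrite mule_ge0// lee_fin expR_ge0.
  - by apply: emeasurable_funM => //; exact: mindS.
  - by move=> w _; rewrite mule_ge0// lee_fin expR_ge0.
  - by apply: emeasurable_funM => //; exact: mindS.
rewrite !tilt_le// => h.
have : tilt P f s (ind `]a, b]) = (fine V * b `^ ((size s)%:R / 2))%:E - (fine V * a `^ ((size s)%:R / 2))%:E.
  by rewrite h addeAC subee// add0e.
by move=> ->; rewrite -EFinB mulrBr.
Qed.

Lemma sqsum_increment (a b : R) : (a <= b)%R ->
  P (S @^-1` `]a, b]) = (F b - F a)%:E.
Proof.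
move=> ab; rewrite EFinB -!FE.
have -> : S @^-1` `]a, b] = S @^-1` `]-oo, b] `\` S @^-1` `]-oo, a].
  apply/seteqP; split => w /=; rewrite !in_itv/=.
    by move=> /andP[h ->]; split => //; apply/negP; rewrite -ltNge.
  by move=> [-> /negP]; rewrite -ltNge => ->.
have mA y : measurable (S @^-1` `]-oo, y]) by exact: mSA.
rewrite measureD//; last by rewrite -ge0_fin_numE// fin_num_measure.
rewrite setIidr// => w /=; rewrite !in_itv/= => h; exact: le_trans ab.
Qed.

Let Fincr (a b : R) : (0 < a)%R -> (a <= b)%R ->
  (expR (- b / 2) * (fine V * (b `^ ((size s)%:R / 2) - a `^ ((size s)%:R / 2))) <= F b - F a <=
   expR (- a / 2) * (fine V * (b `^ ((size s)%:R / 2) - a `^ ((size s)%:R / 2))))%R.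
Proof.
move=> a0 ab; have h := tilt_itv a0 ab; have hP := sqsum_increment ab.
apply/andP; split.
  have := @tilt_indic_le `]a, b] b; rewrite h hP -EFinM lee_fin => /(_ _ _)h1.
  rewrite mulNr expRN ler_pdivrMl ?expR_gt0//; apply: h1 => // x.
  by rewrite /= in_itv/= => /andP[].
have := @tilt_indic_ge `]a, b] a; rewrite h hP -EFinM lee_fin => /(_ _ _)h1.
rewrite mulNr expRN ler_pdivlMl ?expR_gt0//; apply: h1 => // x.
by rewrite /= in_itv/= => /andP[/ltW].
Qed.

Let F0 (b : R) : (0 < b)%R -> (0 <= F b <= fine V * b `^ ((size s)%:R / 2))%R.
Proof.
move=> b0; rewrite fine_ge0//= -lee_fin -FE -tilt_le//.
(* Squares are nonnegative, so the event may be cut to [0, b], where the tilt is at least one. *)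
have -> : S @^-1` `]-oo, b] = S @^-1` `[0%R, b].
  apply/seteqP; split => w /=; rewrite !in_itv/=; first by move=> ->; rewrite sqsum_ge0.
  by move=> /andP[].
apply: (@le_trans _ _ (tilt P f s (ind `[0%R, b]))).
  have := @tilt_indic_ge `[0%R, b] 0%R; rewrite mul0r expR0 mul1e; apply => // x.
  by rewrite /= in_itv/= => /andP[].
apply: ge0_le_integral => //.
- by move=> w _; rewrite mule_ge0// lee_fin expR_ge0.
- by apply: emeasurable_funM => //; exact: mindS.
- by apply: emeasurable_funM => //; exact: mindS.
move=> w _; rewrite lee_wpmul2r ?lee_fin ?expR_ge0// /ind !indicE ler_nat.
case: (boolP (_ \in `[0%R, b]%classic)) => //; rewrite inE/= in_itv/= => /andP[_ h].
by rewrite mem_set//= in_itv.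
Qed.

Let F1 : (F x @[x --> +oo] --> (1 : R))%R.
Proof.
have := cvg_cdfy1 (mfun_of mS : {RV P >-> R}).
move=> /fine_cvg; exact.
Qed.

Lemma chi2_law (x : R) : (0 < x)%R -> P (S @^-1` `]-oo, x]) = (chi2_cdf (size s) x)%:E.
Proof.
move=> x0; rewrite FE; congr EFin.
by apply: (chi2_cdf_unique s0 _ Fincr F0 F1) => //; rewrite fine_ge0// tilt_ge0.
Qed.

Lemma chi2_cdf_continuous (x : R) : (0 < x)%R -> {for x, continuous (chi2_cdf (size s) : R -> R)}.
Proof.
move=> x0; have V0 : (0 <= fine V)%R by rewrite fine_ge0// tilt_ge0.
have cF := continuous_cdf Fincr x0.
have e y : (0 < y)%R -> F y = chi2_cdf (size s) y by move=> y0; exact: (chi2_cdf_unique s0 V0 Fincr F0 F1).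
rewrite /prop_for /continuous_at -e//; apply: cvg_trans cF.
apply: near_eq_cvg; near=> y; apply: e; near: y; exact: lt_nbhsr.
Unshelve. all: end_near. Qed.

End ChiSquareDistribution.

(** * The noise *)

Lemma dot_delta (R : realFieldType) N (t : 'I_N) (u : 'cV[R]_N) : dot (delta_mx t 0) u = u t 0.
Proof. by rewrite /dot trmx_delta -rowE mxE. Qed.

Section MeanBound.
Context d (T : measurableType d) (R : realType) (P : probability T R).
Local Open Scope ereal_scope.

(** Measurability and sign travel with the bound, so bounds add and scale without further side
    conditions. *)
Definition mean_le (h : T -> R) (c : R) : Prop :=
  [/\ measurable_fun setT h, forall w, (0 <= h w)%R & \int[P]_w (h w)%:E <= c%:E].

Lemma mean_le_scale (t : R) h c : (0 <= t)%R -> mean_le h c ->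
  mean_le (fun w => h w * t)%R (c * t)%R.
Proof.
move=> t0 [mh h0 hc]; split.
- exact: measurable_funM.
- by move=> w; rewrite mulr_ge0.
under eq_integral do rewrite mulrC EFinM.
rewrite ge0_integralZ//; last exact/measurable_EFinP.
by rewrite mulrC EFinM lee_wpmul2l ?lee_fin.
Qed.

Lemma mean_le_add h1 c1 h2 c2 : mean_le h1 c1 -> mean_le h2 c2 ->
  mean_le (fun w => h1 w + h2 w)%R (c1 + c2)%R.
Proof.
move=> [m1 p1 b1] [m2 p2 b2]; split.
- exact: measurable_funD.
- by move=> w; rewrite addr_ge0.
under eq_integral do rewrite EFinD.
rewrite ge0_integralD//.
- by rewrite EFinD leeD.
- by move=> w _; rewrite lee_fin.
- exact/measurable_EFinP.
- by move=> w _; rewrite lee_fin.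
- exact/measurable_EFinP.
Qed.

Lemma mean_le_sum (J : eqType) (r : seq J) (h : J -> T -> R) (c : J -> R) :
  (forall j, j \in r -> mean_le (h j) (c j)) ->
  mean_le (fun w => \sum_(j <- r) h j w)%R (\sum_(j <- r) c j)%R.
Proof.
elim: r => [_|j r IH H].
  under [X in mean_le X]eq_fun do rewrite big_nil.
  by rewrite big_nil; split => //; rewrite integral0.
under [X in mean_le X]eq_fun do rewrite big_cons.
rewrite big_cons; apply: mean_le_add; first by apply: H; rewrite mem_head.
by apply: IH => k kr; apply: H; rewrite in_cons kr orbT.
Qed.

Lemma mean_le_trans h c c' : mean_le h c -> (c <= c')%R -> mean_le h c'.
Proof. by move=> [h1 h2 h3] cc; split => //; apply: le_trans h3 _; rewrite lee_fin. Qed.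

Lemma mean_le_markov h c L : (0 < L)%R -> mean_le h c ->
  P [set w | (L < h w)%R] <= (c / L)%:E.
Proof.
move=> L0 [mh h0 hc].
have mA : measurable [set w | (L < h w)%R].
  rewrite (_ : [set w | _] = h @^-1` `]L, +oo[%classic).
    by rewrite -[X in measurable X]setTI; exact: mh.
  by apply/seteqP; split => w /=; rewrite in_itv/= andbT.
rewrite -(lee_pmul2l (_ : L%:E \is a fin_num))// ?lte_fin//.
rewrite -EFinM mulrCA divff ?gt_eqF// mulr1; apply: le_trans hc.
rewrite -[X in P X]setIT -integral_indic//.
rewrite -ge0_integralZ//; last 2 first.
- exact: ltW.
- by apply/measurable_EFinP; exact: measurable_indic.
apply: ge0_le_integral => //.
- by move=> w _; rewrite mule_ge0// lee_fin ltW.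
- by apply: emeasurable_funM => //; apply/measurable_EFinP; exact: measurable_indic.
- exact/measurable_EFinP.
move=> w _; rewrite indicE; case: (boolP (_ \in _)) => [|_].
  by rewrite inE/= mule1 lee_fin => /ltW.
by rewrite mule0 lee_fin.
Qed.

End MeanBound.

Section NormalTail.
Variable R : realType.
Notation N01 := (normal_prob (0 : R)%R 1%R).

Lemma normal_prob_small (h : R) : 0 < h ->
  (N01 [set x : R | (`|x| < h)%R] <= (normal_peak 1 * (2 * h))%:E)%E.
Proof.
move=> h0; have -> : [set x : R | `|x| < h] = `]- h, h[%classic.
  by apply/seteqP; split => x /=; rewrite in_itv/= ltr_norml.
rewrite /normal_prob.
apply: (@le_trans _ _ (\int[lebesgue_measure]_(x in `](- h)%R, h[) (normal_peak 1%R)%:E)%E).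
  apply: ge0_le_integral => //=.
  - by move=> x _; rewrite lee_fin normal_pdf_ge0.
  - by apply/measurable_EFinP/measurable_funTS; exact: measurable_normal_pdf.
  - by move=> x _; rewrite lee_fin normal_pdf_ub.
rewrite integral_cst//= lebesgue_measure_itv/= lte_fin ifT; last by lra.
by rewrite -EFinB -EFinM lee_fin; rewrite le_eqVlt; apply/orP; left; apply/eqP; ring.
Qed.
End NormalTail.

Section OneModel.
Context d (T : measurableType d) (R : realType) (P : probability T R).
Variables (m : nat) (n : 'I_m -> nat) (p q : nat).
Variables (X : forall i : 'I_m, 'M[R]_(n i, p)) (Z : forall i : 'I_m, 'M[R]_(n i, q)).
Variables (beta0 : 'cV[R]_p) (sigma02 : nat -> R) (v02 : R).
Variables (xi : forall i : 'I_m, 'I_q -> T -> R) (eta : forall i : 'I_m, 'I_(n i) -> T -> R).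
Arguments eta : clear implicits.
Hypothesis v02p : 0 < v02.
Hypothesis nxi : forall i k, std_normal P (xi i k).
Hypothesis neta : forall i j, std_normal P (eta i j).
Hypothesis indep : mutual_indep P (noise_family xi eta).

Let f := noise_family xi eta.

Lemma std_normal_noise s : std_normal P (f s).
Proof. by case: s => [[i k]|[i j]]; [exact: nxi|exact: neta]. Qed.

Definition noise_vec (w : T) : 'cV[R]_(\sum_(i < m) n i) :=
  \mxcol_(i < m) \col_(j < n i) (Num.sqrt v02 * eta i j w).

Definition random_effect (w : T) (s : 'I_m * 'I_q) : R := Num.sqrt (sigma02 s.2) * xi s.1 s.2 w.

Lemma ydata_decomp (a : {set 'I_p}) (bb : 'cV[R]_#|a|) w :
  stackX X *m beta0 = Xsub (stackX X) a *m bb ->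
  ydata X Z beta0 sigma02 v02 xi eta w =
    Xsub (stackX X) a *m bb + \sum_s random_effect w s *: zcol Z s + noise_vec w.
Proof.
move=> <-; rewrite /ydata !mxcolD; congr (_ + _ + _).
  by rewrite /stackX -mxcol_mul.
have -> : \sum_s random_effect w s *: zcol Z s =
    \sum_(s : 'I_m * 'I_q | s.2 \in [set: 'I_q]%SET) random_effect w s *: zcol Z s.
  by apply: eq_bigl => s; rewrite finset.in_setT.
rewrite mxcol_sum_zcol.
apply: eq_mxcol => i; apply/matrixP => j c.
rewrite !mxE summxE; apply: eq_big => [k|k _]; first by rewrite finset.in_setT.
by rewrite !mxE mulrC.
Qed.

(** Zero on the random effects, so that a projection of the error vector is a combination of the
    whole independent family and [second_moment] applies. *)
Let coef (zt : 'cV[R]_(\sum_(i < m) n i)) (s : ('I_m * 'I_q) + {i : 'I_m & 'I_(n i)}) : R :=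
  match s with
  | inl _ => 0
  | inr ij => Num.sqrt v02 * submxcol zt (tag ij) (tagged ij) 0
  end.

Lemma noise_lin zt w : dot zt (noise_vec w) = \sum_s coef zt s * f s w.
Proof.
rewrite -{1}(submxcolK zt) dot_mxcol big_sumType/= [X in _ = X + _]big1 ?add0r => [|s _]; last by rewrite mul0r.
transitivity (\sum_i \sum_(j < n i) Num.sqrt v02 * submxcol zt i j 0 * eta i j w); last first.
  by rewrite sig_big_dep/=; apply: eq_bigr => -[i j] _.
apply: eq_bigr => i _; rewrite dotE; apply: eq_bigr => j _.
by rewrite [X in _ * X]mxE mulrCA mulrA.
Qed.

Lemma noise_coef_sq zt : \sum_s coef zt s ^+ 2 = v02 * dot zt zt.
Proof.
rewrite -{2 3}(submxcolK zt) dot_mxcol big_sumType/= [X in X + _ = _]big1 ?add0r => [|s _]; last by rewrite expr0n.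
transitivity (\sum_i \sum_(j < n i) (Num.sqrt v02 * submxcol zt i j 0) ^+ 2).
  by rewrite sig_big_dep/=; apply: eq_bigr => -[i j] _.
rewrite mulr_sumr; apply: eq_bigr => i _; rewrite dotE mulr_sumr; apply: eq_bigr => j _.
by rewrite exprMn sqr_sqrtr ?(ltW v02p)// expr2.
Qed.

Definition normal_var : R := fine (normal_m2 R).

Lemma normal_var_ge0 : 0 <= normal_var.
Proof. by rewrite fine_ge0// normal_m2_ge0. Qed.

Lemma mean_noise zt : mean_le P (fun w => dot zt (noise_vec w) ^+ 2) (v02 * normal_var * dot zt zt).
Proof.
split.
- apply: measurable_funX.
  rewrite (_ : (fun w => _) = (fun w => \sum_s coef zt s * f s w)); last first.
    by apply/funext => w; exact: noise_lin.
  apply: measurable_sum => s; apply: measurable_funM => //.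
  by case: (std_normal_noise s).
- by move=> w; exact: sqr_ge0.
under eq_integral do rewrite noise_lin.
rewrite (second_moment indep std_normal_noise) noise_coef_sq.
have -> : normal_m2 R = normal_var%:E.
  by rewrite /normal_var fineK// ge0_fin_numE ?normal_m2_ge0 ?normal_m2_lt.
by rewrite -EFinM lee_fin le_eqVlt; apply/orP; left; apply/eqP; ring.
Qed.

(** The squared length is a sum of squared projections on unit vectors, each covered by
    [mean_noise]. *)
Lemma mean_eps : mean_le P (fun w => dot (noise_vec w) (noise_vec w)) (v02 * normal_var * (\sum_(i < m) n i)%:R).
Proof.
have e w : dot (noise_vec w) (noise_vec w) = \sum_(t < \sum_(i < m) n i) dot (delta_mx t 0) (noise_vec w) ^+ 2.
  by rewrite dotE; apply: eq_bigr => t _; rewrite dot_delta expr2.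
have -> : (fun w => dot (noise_vec w) (noise_vec w)) =
    (fun w => \sum_(t < \sum_(i < m) n i) dot (delta_mx t 0) (noise_vec w) ^+ 2).
  by apply/funext => w; exact: e.
have -> : v02 * normal_var * (\sum_(i < m) n i)%:R =
    \sum_(t < \sum_(i < m) n i) v02 * normal_var * dot (delta_mx t 0) (delta_mx t 0).
  rewrite -mulr_sumr; congr (_ * _).
  apply/esym; transitivity (\sum_(t < \sum_(i < m) n i) (1 : R)).
    by apply: eq_bigr => t _; rewrite dot_delta mxE !eqxx.
  by rewrite sumr_const card_ord.
by apply: mean_le_sum => t _; exact: mean_noise.
Qed.

Variables (xe le du : R).
Hypothesis n1 : forall i, (0 < n i)%N.
Hypothesis m0 : (0 < m)%N.
Let sx i := (n i)%:R `^ xe : R.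
Let sz i := (n i)%:R `^ le : R.
Let S := \sum_i sx i.
Hypothesis gx : forall i j, dot (col j (X i)) (col j (X i)) <= du * sx i.
Hypothesis gz : forall i j, dot (col j (Z i)) (col j (Z i)) <= du * sz i.

Lemma mean_noise_sq : mean_le P (fun w => noise_sq X Z S sz (noise_vec w))
  (v02 * normal_var * du * (p%:R + m%:R * q%:R)).
Proof.
have n0 i : 0 < (n i)%:R :> R by rewrite ltr0n.
have S0 : 0 < S.
  rewrite /S (bigD1 (Ordinal m0))//= ltr_pwDl ?powR_gt0//.
  by apply: sumr_ge0 => i _; exact: powR_ge0.
have sz0 i : 0 < sz i by exact: powR_gt0.
have vm : 0 <= v02 * normal_var by rewrite mulr_ge0 ?normal_var_ge0// ltW.
apply: (mean_le_trans (c := \sum_(j < p) v02 * normal_var * dot (col j (stackX X)) (col j (stackX X)) / S +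
   \sum_(s : 'I_m * 'I_q) v02 * normal_var * dot (zcol Z s) (zcol Z s) / sz s.1)).
  apply: mean_le_add.
    by apply: mean_le_sum => j _; apply: mean_le_scale; [rewrite invr_ge0 ltW|exact: mean_noise].
  by apply: mean_le_sum => s _; apply: mean_le_scale; [rewrite invr_ge0 ltW|exact: mean_noise].
rewrite mulrDr; apply: lerD.
  apply: (@le_trans _ _ (\sum_(j < p) v02 * normal_var * du)); last first.
    by rewrite sumr_const card_ord -[_ *+ _]mulr_natr.
  apply: ler_sum => j _; rewrite -mulrA ler_wpM2l// ler_pdivrMr//.
  rewrite /stackX col_mxcol dot_mxcol /S mulr_sumr; apply: ler_sum => i _; exact: gx.
apply: (@le_trans _ _ (\sum_(s : 'I_m * 'I_q) v02 * normal_var * du)); last first.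
  by rewrite sumr_const card_prod !card_ord -[_ *+ _]mulr_natr natrM.
apply: ler_sum => s _; rewrite -mulrA ler_wpM2l// ler_pdivrMr// dot_zcol.
exact: gz.
Qed.

End OneModel.

(** * An event of small probability, uniformly in the sample sizes *)

Section BadEvent.
Context d (T : measurableType d) (R : realType) (P : probability T R).
Variables (m : nat) (n : 'I_m -> nat) (p q : nat).
Variables (X : forall i : 'I_m, 'M[R]_(n i, p)) (Z : forall i : 'I_m, 'M[R]_(n i, q)).
Variables (sigma02 : nat -> R) (v02 : R).
Variables (xi : forall i : 'I_m, 'I_q -> T -> R) (eta : forall i : 'I_m, 'I_(n i) -> T -> R).
Arguments eta : clear implicits.
Hypothesis v02p : 0 < v02.
Hypothesis nxi : forall i k, std_normal P (xi i k).
Hypothesis neta : forall i j, std_normal P (eta i j).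
Hypothesis indep : mutual_indep P (noise_family xi eta).
Variables (xe le du lo hi : R) (N0 : nat).
Hypothesis n1 : forall i, (0 < n i)%N.
Hypothesis m0 : (0 < m)%N.
Hypothesis du0 : 0 <= du.
Let sx i := (n i)%:R `^ xe : R.
Let sz i := (n i)%:R `^ le : R.
Let S := \sum_i sx i.
Hypothesis gx : forall i j, dot (col j (X i)) (col j (X i)) <= du * sx i.
Hypothesis gz : forall i j, dot (col j (Z i)) (col j (Z i)) <= du * sz i.
Hypothesis lo0 : 0 < lo.
Hypothesis hi0 : 0 <= hi.
Hypothesis sigb : forall j, 0 < sigma02 j -> lo <= sigma02 j <= hi.
Let G0 := [set j : 'I_q | 0 < sigma02 j]%SET.
Hypothesis cG0 : (#|G0| <= N0)%N.

Lemma mean_random_effect_sq (s : 'I_m * 'I_q) : 0 < sigma02 s.2 ->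
  mean_le P (fun w => random_effect sigma02 xi w s ^+ 2) (hi * normal_var R).
Proof.
move=> sp; have [mx lx] := nxi s.1 s.2.
have mx2 : measurable_fun [set: R] (fun x : R => ((Num.sqrt (sigma02 s.2) * x) ^+ 2)%:E).
  by apply/measurable_EFinP; apply: measurable_funX; exact: measurable_funM.
split.
- by apply: measurable_funX; exact: measurable_funM.
- by move=> w; exact: sqr_ge0.
(* A single variable is an independent family over [unit], which lets [second_moment] supply its
   variance. *)
have ind1 : mutual_indep P (fun _ : unit => xi s.1 s.2).
  move=> J B mB; have [J0|J1] := boolP (tt \in J).
    have -> : J = [set tt]%SET by apply/setP => -[]; rewrite J0 finset.set11.
    rewrite big_set1; congr (P _); apply/seteqP; split => w /=.
      by apply; rewrite /= finset.set11.
    by move=> h [] /=.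
  have -> : J = finset.set0 by apply/setP => -[]; rewrite (negPf J1) finset.in_set0.
  rewrite big_set0 (_ : \bigcap_(i in _) _ = setT) ?probability_setT//.
  by apply/seteqP; split => // w _ j /=; rewrite finset.in_set0.
have := second_moment ind1 (fun _ => nxi s.1 s.2) (fun=> Num.sqrt (sigma02 s.2)).
under eq_integral do rewrite big_const card_unit/= addr0.
rewrite big_const card_unit/= addr0 => ->.
rewrite sqr_sqrtr ?(ltW sp)//.
have -> : normal_m2 R = (normal_var R)%:E.
  by rewrite /normal_var fineK// ge0_fin_numE ?normal_m2_ge0 ?normal_m2_lt.
rewrite -EFinM lee_fin ler_wpM2r ?normal_var_ge0//.
by case/andP: (sigb sp).
Qed.

(** The normal density is bounded by its peak, so an interval of width of order e has probability of
    order e. *)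
Lemma mean_small_random_effect (s : 'I_m * 'I_q) (e : R) : 0 < sigma02 s.2 -> 0 < e ->
  mean_le P (\1_[set w | `|random_effect sigma02 xi w s| < e]) (normal_peak 1 * (2 * (e / Num.sqrt lo))).
Proof.
move=> sp e0; have [mx lx] := nxi s.1 s.2.
have sl : 0 < Num.sqrt lo by rewrite sqrtr_gt0.
have ss : 0 < Num.sqrt (sigma02 s.2) by rewrite sqrtr_gt0.
have sls : Num.sqrt lo <= Num.sqrt (sigma02 s.2).
  by rewrite ler_sqrt ?(ltW sp)//; case/andP: (sigb sp).
have eA : [set w | `|random_effect sigma02 xi w s| < e] =
    xi s.1 s.2 @^-1` [set x : R | `|x| < e / Num.sqrt (sigma02 s.2)].
  apply/seteqP; split => w /=; rewrite /random_effect normrM (gtr0_norm ss);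
  by rewrite ltr_pdivlMr// mulrC.
have mB : measurable [set x : R | `|x| < e / Num.sqrt (sigma02 s.2)].
  rewrite (_ : [set x : R | _] = `]- (e / Num.sqrt (sigma02 s.2)), e / Num.sqrt (sigma02 s.2)[%classic)//.
  by apply/seteqP; split => x /=; rewrite in_itv/= ltr_norml.
have mA : measurable [set w | `|random_effect sigma02 xi w s| < e].
  by rewrite eA -[X in measurable X]setTI; exact: mx.
split; [exact: measurable_indic|by move=> w; rewrite indicE|].
rewrite integral_indic// setIT eA.
apply: (@le_trans _ _ (normal_prob 0 1 [set x : R | (`|x| < e / Num.sqrt (sigma02 s.2))%R])).
  by rewrite le_eqVlt; apply/orP; left; apply/eqP; exact: lx.
apply: le_trans (normal_prob_small _) _; first by rewrite divr_gt0.
rewrite lee_fin ler_wpM2l ?normal_peak_ge0// ler_pM2l// ler_pM2l//.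
by rewrite lef_pV2 ?posrE.
Qed.

Let C0 := v02 * normal_var R * du + v02 * normal_var R + (m%:R * N0%:R) * (hi * normal_var R).
Let C1 := (m%:R * N0%:R) * (normal_peak 1 * (4 / Num.sqrt lo)).

Lemma bad_event (L e : R) : 1 <= L -> 0 < e -> exists2 B : set T,
  measurable B /\ (P B <= (C0 / L + C1 * e)%:E)%E & forall w, ~ B w ->
  [/\ noise_sq X Z S sz (noise_vec v02 eta w) <= L * (p%:R + m%:R * q%:R + 1),
      dot (noise_vec v02 eta w) (noise_vec v02 eta w) <= L * (\sum_(i < m) n i)%:R &
      forall s : 'I_m * 'I_q, 0 < sigma02 s.2 -> e <= `|random_effect sigma02 xi w s| <= L].
Proof.
move=> L1 e0; have L0 : 0 < L by exact: lt_le_trans L1.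
have N0' : 0 < (\sum_(i < m) n i)%:R :> R.
  by rewrite ltr0n (bigD1 (Ordinal m0))//= addn_gt0 n1.
have pq0 : 0 < p%:R + m%:R * q%:R + 1 :> R by rewrite ltr_wpDl// addr_ge0// mulr_ge0.
have vm : 0 <= v02 * normal_var R by rewrite mulr_ge0 ?normal_var_ge0// ltW.
(* All the bad events are contained in [L < h1 + h2 + h3 + h4]. *)
pose r := [seq s <- index_enum _ | (s : 'I_m * 'I_q).2 \in G0].
pose h1 w := noise_sq X Z S sz (noise_vec v02 eta w) / (p%:R + m%:R * q%:R + 1).
pose h2 w := dot (noise_vec v02 eta w) (noise_vec v02 eta w) / (\sum_(i < m) n i)%:R.
pose h3 w := \sum_(s <- r) random_effect sigma02 xi w s ^+ 2.
(* The weight 2L lets a single small effect push the sum above L, while Markov's inequality at level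
   L reduces it to a factor 2. *)
pose h4 w := \sum_(s <- r) \1_[set w | `|random_effect sigma02 xi w s| < e] w * (2 * L).
have rG s : s \in r -> 0 < sigma02 s.2.
  by rewrite mem_filter finset.inE => /andP[].
have b1 : mean_le P h1 (v02 * normal_var R * du).
  have : 0 <= (p%:R + m%:R * q%:R + 1)^-1 :> R by rewrite invr_ge0 ltW.
  move=> /mean_le_scale/(_ (mean_noise_sq v02p nxi neta indep n1 m0 gx gz)) => h; apply: (mean_le_trans h).
  have A0 : 0 <= v02 * normal_var R * du by rewrite mulr_ge0.
  by rewrite -mulrA ler_piMr// ler_pdivrMr// mul1r lerDl.
have b2 : mean_le P h2 (v02 * normal_var R).
  have : 0 <= (\sum_(i < m) n i)%:R^-1 :> R by rewrite invr_ge0 ltW.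
  move=> /mean_le_scale/(_ (mean_eps v02p nxi neta indep)).
  by rewrite mulfK// gt_eqF.
have sumc (c : R) : 0 <= c -> \sum_(s <- r) c <= (m%:R * N0%:R) * c.
  move=> c0; rewrite big_filter (sum_fst G0 (fun=> c)) sumr_const card_ord -[_ *+ m]mulr_natl.
  by rewrite mulrCA mulrA ler_wpM2r// ler_wpM2l// ler_nat.
have hm : 0 <= hi * normal_var R by rewrite mulr_ge0 ?normal_var_ge0.
have pk : 0 <= normal_peak 1 :> R by exact: normal_peak_ge0.
have sl : 0 < Num.sqrt lo by rewrite sqrtr_gt0.
have b3 : mean_le P h3 (\sum_(s <- r) hi * normal_var R).
  by apply: mean_le_sum => s /rG; exact: mean_random_effect_sq.
have b4 : mean_le P h4 (\sum_(s <- r) normal_peak 1 * (2 * (e / Num.sqrt lo)) * (2 * L)).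
  apply: mean_le_sum => s /rG sp; apply: mean_le_scale; first by rewrite mulr_ge0// ltW.
  exact: mean_small_random_effect.
have hb := mean_le_add (mean_le_add (mean_le_add b1 b2) b3) b4.
set h := (fun w => _) in hb.
have mh : measurable_fun setT h by case: hb.
exists [set w | L < h w].
  split.
    rewrite (_ : [set w | _] = h @^-1` `]L, +oo[%classic).
      by rewrite -[X in measurable X]setTI; exact: mh.
    by apply/seteqP; split => w /=; rewrite in_itv/= andbT.
  apply: le_trans (mean_le_markov L0 hb) _; rewrite lee_fin.
  rewrite ler_pdivrMr// [leRHS]mulrDl divfK ?gt_eqF// /C0.
  have s3 : \sum_(s <- r) hi * normal_var R <= m%:R * N0%:R * (hi * normal_var R).
    exact: sumc.
  have s4 : \sum_(s <- r) normal_peak 1 * (2 * (e / Num.sqrt lo)) * (2 * L) <= C1 * e * L.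
    apply: le_trans (sumc _ _) _; first by rewrite !mulr_ge0// ?invr_ge0 ltW.
    rewrite /C1 le_eqVlt; apply/orP; left; apply/eqP; field.
    by rewrite gt_eqF.
  by rewrite lerD// lerD.
move=> w /= /negP; rewrite -leNgt => hL.
have p1 : 0 <= h1 w by case: b1.
have p2 : 0 <= h2 w by case: b2.
have p3 : 0 <= h3 w by case: b3.
have p4 : 0 <= h4 w by case: b4.
rewrite /h in hL; split.
- by rewrite -ler_pdivrMr// -/(h1 w); lra.
- by rewrite -ler_pdivrMr// -/(h2 w); lra.
move=> s sp.
have sr : s \in r by rewrite mem_filter finset.inE sp mem_index_enum.
apply/andP; split.
  rewrite leNgt; apply/negP => be.
  have : 2 * L <= h4 w.
    rewrite /h4 (big_rem s)//= indicE mem_set//= mul1r lerDl.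
    by apply: sumr_ge0 => t _; rewrite mulr_ge0 ?mulr_ge0 ?(ltW L0)// indicE.
  by lra.
have : random_effect sigma02 xi w s ^+ 2 <= L.
  apply: (@le_trans _ _ (h3 w)); last by lra.
  by rewrite /h3 (big_rem s)//= lerDl; apply: sumr_ge0 => t _; exact: sqr_ge0.
(* From b^2 <= L and L >= 1 one gets b^2 <= L^2. *)
move=> b2L; rewrite -(@ler_pXn2r _ 2)// ?nnegrE ?(ltW L0)// real_normK ?num_real//.
by apply: le_trans b2L _; rewrite expr2 ler_peMr// ltW.
Qed.

End BadEvent.

(** * Asymptotics *)

Section Sandwich.
Context d (T : measurableType d) (R : realType) (P : probability T R).
Variables (S W : T -> R) (B : set T) (F : R -> R) (qlo qhi rho beta : R).
Hypothesis mS : measurable_fun setT S.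
Let A := [set w | qlo < W w < qhi].
Hypothesis mA : measurable A.
Hypothesis mB : measurable B.
Hypothesis law : forall x, 0 < x -> P (S @^-1` `]-oo, x]) = (F x)%:E.
Hypothesis rho0 : 0 < rho.
Hypothesis rlo : 2 * rho < qlo.
Hypothesis lohi : qlo <= qhi.
Hypothesis close : forall w, ~ B w -> `|W w - S w| <= rho.
Hypothesis PB : (P B <= beta%:E)%E.

Let mSx x : measurable (S @^-1` `]-oo, x]).
Proof. by rewrite -[X in measurable X]setTI; exact: mS. Qed.

(** Off [B], qlo + rho < S <= qhi - 2 rho implies qlo < W < qhi: the left inequality is already
    strict, and the doubled margin makes the right one strict. *)
Lemma coverage_ge : F (qhi - 2 * rho) - F (qlo + rho) - beta <= fine (P A).
Proof.
have rlo' := rlo; have lohi' := lohi; have rho0' := rho0.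
have x1 : 0 < qhi - 2 * rho by lra.
have x2 : 0 < qlo + rho by lra.
have h : (P (S @^-1` `]-oo, (qhi - 2 * rho)%R]) <= P (S @^-1` `]-oo, (qlo + rho)%R]) + (P A + P B))%E.
  have mAB : measurable (A `|` B) by exact: measurableU.
  apply: le_trans (_ : _ <= P (S @^-1` `]-oo, (qlo + rho)%R] `|` (A `|` B)))%E _.
    apply: le_measure; rewrite ?inE//; first exact: measurableU.
    move=> w /=; rewrite !in_itv/= => h1.
    have [|h2] := leP (S w) (qlo + rho); first by left.
    right; have [Bw|nB] := pselect (B w); first by right.
    left; have := close nB; rewrite ler_norml => /andP[c1 c2] /=.
    by apply/andP; split; lra.
  apply: (@le_trans _ _ (P (S @^-1` `]-oo, (qlo + rho)%R]) + P (A `|` B))%E).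
    by apply: measureU2.
  by rewrite leeD2l//; apply: measureU2.
move: h; rewrite !law// -(fineK (fin_num_measure P _ mA)) => h.
have {}h := le_trans h (leeD2l _ (leeD2l _ PB)).
by move: h; rewrite -!EFinD lee_fin; lra.
Qed.

Lemma coverage_le : fine (P A) <= F (qhi + rho) - F (qlo - 2 * rho) + beta.
Proof.
have rlo' := rlo; have lohi' := lohi; have rho0' := rho0.
have x1 : 0 < qhi + rho by lra.
have x2 : 0 < qlo - 2 * rho by lra.
have sub : S @^-1` `]-oo, qlo - 2 * rho] `<=` S @^-1` `]-oo, qhi + rho].
  by move=> w /=; rewrite !in_itv/=; lra.
have h : (P A <= (F (qhi + rho))%:E - (F (qlo - 2 * rho))%:E + P B)%E.
  rewrite -!law//.
  have <- : P (S @^-1` `]-oo, (qhi + rho)%R] `\` S @^-1` `]-oo, (qlo - 2 * rho)%R]) =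
      (P (S @^-1` `]-oo, (qhi + rho)%R]) - P (S @^-1` `]-oo, (qlo - 2 * rho)%R]))%E.
    rewrite measureD//; last by rewrite -ge0_fin_numE// fin_num_measure.
    by rewrite setIidr.
  apply: (@le_trans _ _ (P ((S @^-1` `]-oo, (qhi + rho)%R] `\` S @^-1` `]-oo, (qlo - 2 * rho)%R]) `|` B))); last first.
    by apply: measureU2 => //; exact: measurableD.
  apply: le_measure; rewrite ?inE//; first by apply: measurableU => //; exact: measurableD.
  move=> w /= /andP[h1 h2]; have [Bw|nB] := pselect (B w); first by right.
  left; have := close nB; rewrite ler_norml => /andP[c1 c2] /=.
  rewrite !in_itv/=; split; first by lra.
  by apply/negP; rewrite -ltNge; lra.
move: h; rewrite -(fineK (fin_num_measure P _ mA)) => h.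
have {}h := le_trans h (leeD2l _ PB).
by move: h; rewrite -EFinB -EFinD lee_fin.
Qed.

End Sandwich.

Lemma powRN_small (R : realType) (e t : R) : 0 < e -> 0 < t ->
  exists M : nat, forall n : nat, (M <= n)%N -> n%:R `^ (- e) <= t.
Proof.
move=> e0 t0; exists (Num.truncn (t^-1 `^ e^-1)).+1 => n hn.
have n0 : 0 < n%:R :> R by rewrite ltr0n; apply: leq_trans hn.
rewrite powRN -[leRHS]invrK lef_pV2 ?posrE ?invr_gt0 ?powR_gt0//.
have -> : t^-1 = (t^-1 `^ e^-1) `^ e.
  by rewrite -powRrM mulVf ?gt_eqF// powRr1// invr_ge0 ltW.
rewrite ge0_ler_powR ?nnegrE ?powR_ge0 ?(ltW e0) ?(ltW n0)//.
apply: le_trans (ltW (truncnS_gt _)) _; by rewrite ler_nat.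
Qed.

Lemma gram_eventually (R : realType) (m : nat) (n : nat -> 'I_m -> nat) (p : nat -> nat)
    (Y : forall nu (i : 'I_m), 'M[R]_(n nu i, p nu)) (tau e : R) : gram_cond Y tau e ->
  2 * tau < e <= 1 /\ exists lo hi, [/\ 0 < lo, 0 < hi & forall rho, 0 < rho -> \forall nu \near \oo,
    forall i, (forall j, lo * (n nu i)%:R `^ e <= dot (col j (Y nu i)) (col j (Y nu i))
                            <= hi * (n nu i)%:R `^ e) /\
       forall j j', j != j' -> `|dot (col j (Y nu i)) (col j' (Y nu i))| <= rho * (n nu i)%:R `^ (e - tau)].
Proof.
move=> [dd [dl [du [te dl0 db H]]]]; split => //.
(* The error min(rho, dl/2) costs at most half of the lower constant; the upper one is positive
   whatever the sign of [du]. *)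
exists (dl / 2), (`|du| + dl); split; [by rewrite divr_gt0|by rewrite ltr_wpDl|].
move=> rho rho0; have e0 : 0 < Num.min rho (dl / 2) by rewrite lt_min rho0 divr_gt0.
have := H _ e0; apply: filterS => nu h i; split.
  move=> j; have := h i j j; rewrite /= eqxx -/(dot _ _) ler_norml => /andP[h1 h2].
  have n0 : 0 <= (n nu i)%:R `^ e :> R by exact: powR_ge0.
  have h3 : Num.min rho (dl / 2) * (n nu i)%:R `^ e <= dl / 2 * (n nu i)%:R `^ e.
    by rewrite ler_wpM2r// ge_min lexx orbT.
  have /andP[d1 d2] := db i j.
  have h4 : dl * (n nu i)%:R `^ e <= dd i j * (n nu i)%:R `^ e by rewrite ler_wpM2r.
  have h5 : dd i j * (n nu i)%:R `^ e <= `|du| * (n nu i)%:R `^ e.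
    by rewrite ler_wpM2r// (le_trans d2)// ler_norm.
  by apply/andP; split; rewrite ?mulrDl; lra.
move=> j j' /negPf jj; have := h i j j'; rewrite /= jj -/(dot _ _) => h1.
apply: le_trans h1 _; rewrite ler_wpM2r ?powR_ge0//.
by rewrite ge_min lexx.
Qed.

Lemma dim_eventually (R : realType) (m : nat) (n : nat -> 'I_m -> nat) (r : nat -> nat) (tau : R) :
  0 <= tau -> dim_cond n r tau -> (forall M : nat, \forall nu \near \oo, forall i, (M <= n nu i)%N) ->
  exists2 D, 0 < D & \forall nu \near \oo, forall i, (r nu)%:R <= D * (n nu i)%:R `^ tau.
Proof.
move=> tau0 [c c0 H] ninf; exists (c + 1); first by rewrite addr_gt0.
near=> nu => i.
have n1 : 1 <= (n nu i)%:R :> R by rewrite ler1n; move: i; near: nu; exact: ninf.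
have h : forall i, `|(r nu)%:R - c| <= 1 * (n nu i)%:R `^ tau by near: nu; exact: H.
have := h i; rewrite mul1r ler_norml => /andP[_ h1].
have p1 : 1 <= (n nu i)%:R `^ tau by rewrite -[leLHS](powRr0 (n nu i)%:R) ler_powR.
have : c <= c * (n nu i)%:R `^ tau by rewrite ler_peMr// ltW.
rewrite mulrDl mul1r; lra.
Unshelve. all: end_near. Qed.

(** The variances do not vary with the sample index, so finitely many positive ones give uniform
    bounds; [N0] also bounds the number of true effects. *)
Lemma finite_pos_bounds (R : realType) (sigma : nat -> R) :
  finite_set [set j | 0 < sigma j] ->
  exists N0 lo hi, [/\ 0 < lo, 0 <= hi & forall j, 0 < sigma j -> (j < N0)%N /\ lo <= sigma j <= hi].
Proof.
move=> fin.
have bnd N : exists lo hi, [/\ 0 < lo, 0 <= hi & forall j, (j < N)%N -> 0 < sigma j -> lo <= sigma j <= hi].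
  elim: N => [|N [lo [hi [lo0 hi0 h]]]]; first by exists 1, 1; split.
  exists (if 0 < sigma N then Num.min lo (sigma N) else lo), (Num.max hi (sigma N)); split.
  - by case: ifP => // s; rewrite lt_min lo0.
  - by rewrite le_max hi0.
  move=> j; rewrite ltnS leq_eqVlt => /orP[/eqP -> s|jN s].
    by rewrite s ge_min lexx orbT le_max lexx orbT.
  have /andP[h1 h2] := h _ jN s; rewrite le_max h2 andbT.
  by case: ifP => // _; rewrite ge_min h1.
have [N0 hN] : exists N0, forall j, 0 < sigma j -> (j < N0)%N.
  have /finite_seqP[s sE] := fin.
  exists (\max_(j <- s) j).+1 => j sj; rewrite ltnS.
  have js : j \in s.
    have h : [set` s] j by rewrite -sE.
    exact: h.
  by rewrite (big_rem j)//= leq_maxl.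
have [lo [hi [lo0 hi0 h]]] := bnd N0.
by exists N0, lo, hi; split => // j sj; split; [exact: hN|apply: h => //; exact: hN].
Qed.

Lemma powRN_small_scaled (R : realType) (C e t : R) : 0 < e -> 0 < t ->
  exists M : nat, forall n : nat, (M <= n)%N -> C * n%:R `^ (- e) <= t.
Proof.
move=> e0 t0; have c0 : 0 < `|C| + 1 by rewrite ltr_wpDl.
have [M hM] := powRN_small e0 (divr_gt0 t0 c0); exists M => n /hM h.
apply: (@le_trans _ _ ((`|C| + 1) * n%:R `^ (- e))).
  by rewrite ler_wpM2r ?powR_ge0//; have := ler_norm C; lra.
by rewrite mulrC -ler_pdivlMr.
Qed.

Lemma lt_quarter (R : realFieldType) (x y : R) : 0 < y -> x <= y / 4 -> 2 * x < y.
Proof. lra. Qed.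

(** * Chi-square law of one random effect across clusters *)

Section RowLaw.
Context d (T : measurableType d) (R : realType) (P : probability T R).
Variables (m : nat) (n : 'I_m -> nat) (q : nat).
Variables (xi : forall i : 'I_m, 'I_q -> T -> R) (eta : forall i : 'I_m, 'I_(n i) -> T -> R).
Arguments eta : clear implicits.
Hypothesis m0 : (0 < m)%N.
Hypothesis nxi : forall i k, std_normal P (xi i k).
Hypothesis neta : forall i j, std_normal P (eta i j).
Hypothesis indep : mutual_indep P (noise_family xi eta).
Variable k : 'I_q.

Let row : seq (('I_m * 'I_q) + {i : 'I_m & 'I_(n i)}) := [seq inl (i, k) | i <- enum 'I_m].

Let row_uniq : uniq row.
Proof. by rewrite map_inj_uniq ?enum_uniq// => i j []. Qed.

Let row_size : size row = m.
Proof. by rewrite size_map size_enum_ord. Qed.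

Let row_sum w : sqsum (noise_family xi eta) row w = \sum_i xi i k w ^+ 2.
Proof. by rewrite /sqsum /partial_sum big_map big_enum. Qed.

Let nf := std_normal_noise nxi neta.

Lemma measurable_row_sum : measurable_fun setT (fun w => \sum_i xi i k w ^+ 2).
Proof. by under eq_fun do rewrite -row_sum; exact: measurable_sqsum nf row. Qed.

Lemma row_law x : 0 < x ->
  P ((fun w => \sum_i xi i k w ^+ 2) @^-1` `]-oo, x]) = (chi2_cdf m x)%:E.
Proof.
move=> x0; have := chi2_law indep nf row_uniq _ x0; rewrite row_size => /(_ m0) <-.
by congr (P _); apply/seteqP; split => w /=; rewrite row_sum.
Qed.

Lemma row_continuous x : 0 < x -> {for x, continuous (chi2_cdf m : R -> R)}.
Proof.
by move=> x0; have := chi2_cdf_continuous indep nf row_uniq _ x0; rewrite row_size; apply.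
Qed.

(** Monotonicity is read off from the law just identified, through inclusion of events. *)
Lemma chi2_cdf_lt (x y : R) : 0 < x -> 0 < y -> chi2_cdf m x < chi2_cdf m y -> x <= y.
Proof.
move=> x0 y0; rewrite -lte_fin -!row_law// => h; rewrite leNgt; apply/negP => /ltW yx.
move: h; rewrite ltNge => /negP; apply.
have mS z : measurable ((fun w => \sum_i xi i k w ^+ 2) @^-1` `]-oo, z]).
  by rewrite -[X in measurable X]setTI; apply: measurable_row_sum.
apply: le_measure; rewrite ?inE//.
by move=> w /=; rewrite !in_itv/= => h; exact: le_trans yx.
Qed.

End RowLaw.

Theorem theorem2 (R : realType) (d : measure_display) (T : measurableType d)
  (P : probability T R)
  (m : nat) (n : nat -> 'I_m -> nat) (p q : nat -> nat)
  (X : forall nu (i : 'I_m), 'M[R]_(n nu i, p nu))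
  (Z : forall nu (i : 'I_m), 'M[R]_(n nu i, q nu))
  (beta0 : forall nu, 'cV[R]_(p nu))
  (sigma02 : nat -> R) (v02 : R)
  (alpha : forall nu, {set 'I_(p nu)}) (gamma : forall nu, {set 'I_(q nu)})
  (xi : forall nu (i : 'I_m), 'I_(q nu) -> T -> R)
  (eta : forall nu (i : 'I_m), 'I_(n nu i) -> T -> R)
  (thhat : forall nu, T -> 'I_(q nu) -> R) (v2hat : nat -> T -> R)
  (a qlo qhi : R) (k : nat) :
  (0 < m)%N ->
  (* X and Z = diag(Z_1,...,Z_m) have full column rank *)
  (forall nu, row_full (stackX (X nu))) ->
  (forall nu, row_full (blockZ (Z nu))) ->
  (* true parameters; gamma_0 = {k | sigma_{k,0}^2 > 0}, finite, nonempty,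
     contained in {0, ..., q - 1} *)
  0 < v02 -> (forall j, 0 <= sigma02 j) ->
  finite_set [set j | 0 < sigma02 j] -> [set j | 0 < sigma02 j] !=set0 ->
  (forall nu j, 0 < sigma02 j -> (j < q nu)%N) ->
  (* data generation: independent standard normal latent variables *)
  (forall nu i kk, std_normal P (xi nu i kk)) ->
  (forall nu i j, std_normal P (eta nu i j)) ->
  (forall nu, mutual_indep P (noise_family (xi nu) (eta nu))) ->
  (* asymptotic regime: n_min -> oo (m fixed) *)
  (forall M : nat, \forall nu \near \oo, forall i, (M <= n nu i)%N) ->
  (* (A0)-(A3) *)
  (exists tau xie l : R,
     [/\ 0 <= tau < 1 / 2, dim_cond n p tau & dim_cond n q tau] /\
     [/\ gram_cond X tau xie, gram_cond Z tau l & cross_cond X Z tau xie l]) ->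
  (* alpha is correct *)
  (forall nu, exists bb : 'cV[R]_#|alpha nu|,
      stackX (X nu) *m beta0 nu = Xsub (stackX (X nu)) (alpha nu) *m bb) ->
  (* gamma is correct *)
  (forall nu (j : 'I_(q nu)), 0 < sigma02 j -> j \in gamma nu) ->
  (* (thhat, v2hat) are (measurable) ML estimators *)
  (forall nu kk, measurable_fun setT (fun w => thhat nu w kk)) ->
  (forall nu, measurable_fun setT (v2hat nu)) ->
  (forall nu, {ae P, forall w,
      is_ML (X nu) (Z nu) (alpha nu) (gamma nu)
        (ydata (X nu) (Z nu) (beta0 nu) sigma02 v02 (xi nu) (eta nu) w)
        (thhat nu w) (v2hat nu w)}) ->
  (* chi-square percentiles *)
  0 < a < 1 -> 0 < qlo -> 0 < qhi ->
  chi2_cdf m qlo = a / 2 -> chi2_cdf m qhi = 1 - a / 2 ->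
  (* k in gamma /\ gamma_0 *)
  0 < sigma02 k ->
  (fun nu => P [set w | m%:R * (compk (thhat nu w) k * v2hat nu w) / qhi < sigma02 k
                        < m%:R * (compk (thhat nu w) k * v2hat nu w) / qlo])
    @ \oo --> (1 - a)%:E.
Proof.
move=> m0 _ _ v0 sig0 fin _ kq nxi neta indep ninf [tau [xe [l [[/andP[tau0 _] dimp dimq] [gX gZ gXZ]]]]].
move=> acor gcor mth mv2 ml /andP[a0 a1] qlo0 qhi0 clo chi sk.
have [tex [lox [hix [lox0 hix0 HX]]]] := gram_eventually gX.
have [tez [loz [hiz [loz0 hiz0 HZ]]]] := gram_eventually gZ.
have [Dp Dp0 HDp] := dim_eventually tau0 dimp ninf.
have [Dq Dq0 HDq] := dim_eventually tau0 dimq ninf.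
have [N0 [lo [hi [lo0 hi0 sigb]]]] := finite_pos_bounds fin.
have mR : 0 < m%:R :> R by rewrite ltr0n.
have m1R : 1 <= m%:R :> R by rewrite ler1n.
pose dl := Num.min lox loz; pose du := Num.max hix hiz.
have dl0 : 0 < dl by rewrite lt_min lox0.
have du0 : 0 < du by rewrite lt_max hix0.
pose D := Dp + m%:R * Dq + 1.
have D0 : 0 < D by rewrite !addr_gt0// mulr_gt0.
(* With off-diagonal entries of this size, p + m q + 1 <= D n_i^tau yields the dominance condition
   [dims] with loss dl / 2. *)
pose rho := dl / (2 * D).
have rho0 : 0 < rho by rewrite divr_gt0// mulr_gt0.
pose kk nu : 'I_(q nu) := Ordinal (kq nu k sk).
pose W nu w := m%:R * (compk (thhat nu w) k * v2hat nu w) / sigma02 k.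
pose S nu w := \sum_i xi nu i (kk nu) w ^+ 2.
have compE nu w : compk (thhat nu w) k = thhat nu w (kk nu).
  by rewrite /compk (insubT (fun j => j < q nu)%N (kq nu k sk)).
have mW nu : measurable_fun setT (W nu).
  apply: measurable_funM => //; apply: measurable_funM => //; apply: measurable_funM => //.
  by under eq_fun do rewrite compE; exact: mth.
(* Since sigma_{k,0}^2, [qlo] and [qhi] are positive, coverage says that the pivot [W] lies strictly
   between the percentiles. *)
have setE nu : [set w | m%:R * (compk (thhat nu w) k * v2hat nu w) / qhi < sigma02 k
      < m%:R * (compk (thhat nu w) k * v2hat nu w) / qlo] = [set w | qlo < W nu w < qhi].
  apply/seteqP; split => w /=; rewrite /W.
    by rewrite !ltr_pdivrMr// !ltr_pdivlMr// ![_ * sigma02 k]mulrC => /andP[-> ->].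
  by rewrite !ltr_pdivrMr// !ltr_pdivlMr// ![_ * sigma02 k]mulrC => /andP[-> ->].
have mA nu : measurable [set w | qlo < W nu w < qhi].
  rewrite (_ : [set w | _] = W nu @^-1` `]qlo, qhi[%classic).
    by rewrite -[X in measurable X]setTI; exact: mW.
  by apply/seteqP; split => w /=; rewrite in_itv.
rewrite (_ : (fun nu => _) = (fun nu => (fine (P [set w | qlo < W nu w < qhi]))%:E)); last first.
  by apply/funext => nu; rewrite setE fineK// fin_num_measure.
apply: cvg_EFin; first exact: nearW.
apply/cvgrPdist_le => /= ep ep0.
have Flaw nu := row_law m0 (nxi nu) (neta nu) (indep nu) (kk nu).
(* [chi2_cdf m] does not depend on the sample index, so the model at index 0 provides its
   continuity. *)
have Fcont := row_continuous m0 (nxi 0%N) (neta 0%N) (indep 0%N) (kk 0%N).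
have lohi : qlo <= qhi.
  by apply: (chi2_cdf_lt m0 (nxi 0%N) (neta 0%N) (indep 0%N) (kk 0%N)) => //; rewrite clo chi; lra.
have ep4 : 0 < ep / 4 by rewrite divr_gt0.
have [d1 /= d10 hd1] : nbhs_ball qlo [set x | `|chi2_cdf m qlo - chi2_cdf m x| <= ep / 4].
  by apply/nbhs_ballP; move/cvgrPdist_le: (Fcont _ qlo0) => /(_ _ ep4).
have [d2 /= d20 hd2] : nbhs_ball qhi [set x | `|chi2_cdf m qhi - chi2_cdf m x| <= ep / 4].
  by apply/nbhs_ballP; move/cvgrPdist_le: (Fcont _ qhi0) => /(_ _ ep4).
(* The distribution function is evaluated within 2 rr of the percentiles; the divisor 4 keeps this
   below [d1], [d2] and [qlo], so all arguments stay positive. *)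
pose rr := Num.min (Num.min d1 d2) qlo / 4.
have rr0 : 0 < rr by rewrite divr_gt0// !lt_min d10 d20.
have rr1 : 2 * rr < d1.
  by apply: lt_quarter d10 _; rewrite ler_pM2r ?invr_gt0// !ge_min lexx.
have rr2 : 2 * rr < d2.
  by apply: lt_quarter d20 _; rewrite ler_pM2r ?invr_gt0// !ge_min lexx !orbT.
have rrlo : 2 * rr < qlo.
  by apply: lt_quarter qlo0 _; rewrite ler_pM2r ?invr_gt0// !ge_min lexx !orbT.
have F1 x : `|qlo - x| < d1 -> `|chi2_cdf m qlo - chi2_cdf m x| <= ep / 4 by move=> h; exact: hd1.
have F2 x : `|qhi - x| < d2 -> `|chi2_cdf m qhi - chi2_cdf m x| <= ep / 4 by move=> h; exact: hd2.
pose C0 := v02 * normal_var R * du + v02 * normal_var R + (m%:R * N0%:R) * (hi * normal_var R).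
pose C1 := (m%:R * N0%:R) * (normal_peak 1 * (4 / Num.sqrt lo)) : R.
have m2 : 0 <= normal_var R by exact: normal_var_ge0.
have C00 : 0 <= C0 by rewrite /C0 !addr_ge0 ?mulr_ge0 ?(ltW v0) ?(ltW du0).
have C10 : 0 <= C1 by rewrite /C1 !mulr_ge0 ?normal_peak_ge0 ?invr_ge0.
(* [L] and [e] below make the two parts of the bad probability at most ep / 4 each; the added ones
   ensure L >= 1 and a nonzero denominator in [e]. *)
pose L := 1 + 4 * C0 / ep.
have L1 : 1 <= L by rewrite lerDl divr_ge0 ?mulr_ge0 ?(ltW ep0).
have L0 : 0 < L by exact: lt_le_trans L1.
pose e := ep / (4 * (C1 + 1)).
have e0 : 0 < e by rewrite divr_gt0// mulr_gt0// ltr_wpDl.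
have bet : C0 / L + C1 * e <= ep / 2.
  have h1 : C0 / L <= ep / 4.
    rewrite ler_pdivrMr// /L mulrDr mulr1.
    have -> : ep / 4 * (4 * C0 / ep) = C0 by field; rewrite gt_eqF.
    by rewrite lerDr ltW.
  have h2 : C1 * e <= ep / 4.
    have -> : C1 * e = ep / 4 * (C1 / (C1 + 1)) by rewrite /e; field; rewrite gt_eqF// ltr_wpDl.
    by rewrite ler_piMr ?(ltW ep4)// ler_pdivrMr ?ltr_wpDl// mul1r lerDl.
  by move: (lerD h1 h2); clear; lra.
(* Accuracy of the predicted effects such that, after division by sigma_{k,0}^2, the pivot errs by
   at most [rr]. *)
pose r := Num.min 1 (rr * sigma02 k / (m%:R * (2 + 2 * L))).
have mL : 0 < m%:R * (2 + 2 * L) by rewrite mulr_gt0// addr_gt0// mulr_gt0.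
have r0 : 0 < r <= 1 by rewrite /r lt_min ltr01 ge_min lexx divr_gt0// mulr_gt0.
have rP : m%:R * (2 + 2 * L) * r <= rr * sigma02 k.
  by rewrite mulrC -ler_pdivlMr// /r ge_min lexx orbT.
(* The constants of [ml_consistent] with eta = [e] and at most [N0] true effects. They are free of
   nu, so the thresholds on the n_i are fixed in advance. *)
pose kap := dl / 2.
pose V := 2 * L + 2 * (m%:R * N0%:R) * (L ^+ 2 * du * N0%:R).
pose K1 := 2 / kap * (2 * (L * D) / kap + (V * (du * (m%:R * N0%:R)) + (m%:R * N0%:R) * L ^+ 2)).
pose t0 := e ^+ 2 / 4 / (m%:R * V).
pose K2 := 2 / kap * (2 * (L * D) / kap + (m%:R * N0%:R) * L ^+ 2 / t0).
have le0 : 0 < l / 2.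
  by rewrite divr_gt0//; case/andP: tez => h _; apply: le_lt_trans h; rewrite mulr_ge0.
have e24 : 0 < e ^+ 2 / 4 by rewrite divr_gt0// exprn_gt0.
have [rp r1] := andP r0.
have [M1 hM1] := powRN_small_scaled K1 le0 e24.
have r2 : 0 < r ^+ 2 by rewrite exprn_gt0.
have [M2 hM2] := powRN_small_scaled K2 le0 r2.
have [M3 hM3] := powRN_small_scaled (V / kap) le0 rp.
near=> nu.
have n1 : forall i, (0 < n nu i)%N by near: nu; exact: (ninf 1%N).
have s1 : forall i, (M1 <= n nu i)%N by near: nu; exact: ninf.
have s2 : forall i, (M2 <= n nu i)%N by near: nu; exact: ninf.
have s3 : forall i, (M3 <= n nu i)%N by near: nu; exact: ninf.
have hX : forall i, (forall j, lox * (n nu i)%:R `^ xe <= dot (col j (X nu i)) (col j (X nu i))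
              <= hix * (n nu i)%:R `^ xe) /\
       forall j j', j != j' -> `|dot (col j (X nu i)) (col j' (X nu i))| <= rho * (n nu i)%:R `^ (xe - tau).
  by near: nu; exact: HX.
have hZ : forall i, (forall j, loz * (n nu i)%:R `^ l <= dot (col j (Z nu i)) (col j (Z nu i))
              <= hiz * (n nu i)%:R `^ l) /\
       forall j j', j != j' -> `|dot (col j (Z nu i)) (col j' (Z nu i))| <= rho * (n nu i)%:R `^ (l - tau).
  by near: nu; exact: HZ.
have hXZ : forall i j j', `|dot (col j (X nu i)) (col j' (Z nu i))| <= rho * (n nu i)%:R `^ ((xe + l) / 2 - tau).
  by near: nu; exact: gXZ.
have hp : forall i, (p nu)%:R <= Dp * (n nu i)%:R `^ tau by near: nu.
have hq : forall i, (q nu)%:R <= Dq * (n nu i)%:R `^ tau by near: nu.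
have pow0 i u : 0 < (n nu i)%:R `^ u :> R by rewrite powR_gt0// ltr0n.
have pq i : (p nu)%:R + m%:R * (q nu)%:R + 1 <= D * (n nu i)%:R `^ tau.
  have p1 : 1 <= (n nu i)%:R `^ tau :> R by rewrite -[leLHS](powRr0 (n nu i)%:R) ler_powR// ler1n.
  have h1 := hp i.
  have h2 : m%:R * (q nu)%:R <= m%:R * (Dq * (n nu i)%:R `^ tau) by rewrite ler_pM2l.
  rewrite /D !mulrDl mul1r -mulrA; apply: lerD => //; exact: lerD.
have dims i : rho * ((p nu)%:R + (q nu)%:R) * (n nu i)%:R `^ (- tau) <= dl / 2.
  rewrite powRN ler_pdivrMr// /rho.
  have h : (p nu)%:R + (q nu)%:R <= D * (n nu i)%:R `^ tau.
    apply: le_trans (pq i); rewrite -addrA lerD2l ler_wpDr//.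
    by rewrite ler_peMl.
  have -> : dl / 2 * (n nu i)%:R `^ tau = dl / (2 * D) * (D * (n nu i)%:R `^ tau).
    by field; rewrite gt_eqF.
  by rewrite ler_pM2l.
pose G0 := [set j : 'I_(q nu) | 0 < sigma02 j]%SET.
have cG0 : (#|G0| <= N0)%N.
  rewrite cardE -(size_map val) -(size_iota 0 N0); apply: uniq_leq_size.
    by rewrite map_inj_uniq ?enum_uniq//; exact: val_inj.
  move=> x /mapP[j]; rewrite mem_enum finset.inE => /sigb[jN _] ->.
  by rewrite mem_iota.
have gxd i j : dl * (n nu i)%:R `^ xe <= dot (col j (X nu i)) (col j (X nu i)) <= du * (n nu i)%:R `^ xe.
  have [/(_ j)/andP[h1 h2] _] := hX i; apply/andP; split.
    by apply: le_trans h1; rewrite ler_pM2r// ge_min lexx.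
  by apply: le_trans h2 _; rewrite ler_pM2r// le_max lexx.
have gzd i j : dl * (n nu i)%:R `^ l <= dot (col j (Z nu i)) (col j (Z nu i)) <= du * (n nu i)%:R `^ l.
  have [/(_ j)/andP[h1 h2] _] := hZ i; apply/andP; split.
    by apply: le_trans h1; rewrite ler_pM2r// ge_min lexx orbT.
  by apply: le_trans h2 _; rewrite ler_pM2r// le_max lexx orbT.
have [B [mB PB] hB] := bad_event v0 (nxi nu) (neta nu) (indep nu) n1 m0 (ltW du0)
  (fun i j => proj2 (andP (gxd i j))) (fun i j => proj2 (andP (gzd i j)))
  lo0 hi0 (fun j h => proj2 (sigb j h)) cG0 L1 e0.
(* The likelihood is maximized only almost surely; the exceptional null set joins the bad event. *)
have [Nn [mN PN hN]] := ml nu.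
have mBN : measurable (B `|` Nn) by exact: measurableU.
have PBN : (P (B `|` Nn) <= (ep / 2)%:E)%E.
  apply: (@le_trans _ _ (P B + P Nn)%E); first by apply: measureU2.
  by rewrite PN adde0; apply: le_trans PB _; rewrite lee_fin.
have close w : ~ (B `|` Nn) w -> `|W nu w - S nu w| <= rr.
  move=> nBN; have nB : ~ B w by move=> h; apply: nBN; left.
  have nN : ~ Nn w by move=> h; apply: nBN; right.
  have mlw : is_ML (X nu) (Z nu) (alpha nu) (gamma nu)
        (ydata (X nu) (Z nu) (beta0 nu) sigma02 v02 (xi nu) (eta nu) w)
        (thhat nu w) (v2hat nu w).
    by apply: contrapT => h; apply: nN; apply: hN.
  have [g1 g2 g3] := hB w nB.
  have [bb bbE] := acor nu.
  have sG0 : G0 \subset gamma nu.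
    by apply/fintype.subsetP => j; rewrite finset.inE; exact: gcor.
  have bG0 s : s.2 \notin G0 -> random_effect sigma02 (xi nu) w s = 0.
    rewrite finset.inE -leNgt => h; rewrite /random_effect.
    have -> : sigma02 s.2 = 0 by apply/eqP; rewrite eq_le h sig0.
    by rewrite sqrtr0 mul0r.
  have bL s : `|random_effect sigma02 (xi nu) w s| <= L.
    have [sG|/bG0 ->] := boolP (s.2 \in G0); last by rewrite normr0 ltW.
    by move: sG; rewrite finset.inE => /g3/andP[].
  have be s : s.2 \in G0 -> e <= `|random_effect sigma02 (xi nu) w s|.
    by rewrite finset.inE => /g3/andP[].
  have kG : kk nu \in G0 by rewrite finset.inE.
  have hc := ml_consistent m0 n1 (ltW rho0) (fun i j => proj1 (andP (gxd i j))) gzd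
    (fun i => proj2 (hX i)) (fun i => proj2 (hZ i)) hXZ dims tez tau0 dl0 du0 L0 D0 e0 r0 pq
    sG0 cG0 bG0 (ydata_decomp (Z nu) sigma02 v02 (xi nu) (eta nu) w bbE) mlw bL be g2 g1
    (fun i => hM1 _ (s1 i)) (fun i => hM2 _ (s2 i)) (fun i => hM3 _ (s3 i)) kG.
  have {}hc := le_trans hc rP.
  (* Division by sigma_{k,0}^2 turns the squared effects b_ik^2 into the squared standard normals
     summed in [S]. *)
  rewrite /W /S compE -(ler_pM2r sk) -[X in _ * X <= _](gtr0_norm sk) -normrM mulrBl.
  rewrite divfK ?gt_eqF//; apply: le_trans hc; rewrite le_eqVlt; apply/orP; left.
  rewrite mulr_suml; apply/eqP; congr (`|_ - _|); apply: eq_bigr => i _.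
  by rewrite /random_effect exprMn sqr_sqrtr ?(ltW sk)// mulrC.
have mSn := measurable_row_sum (nxi nu) (neta nu) (kk nu).
have hge := coverage_ge mSn (mA nu) mBN (Flaw nu) rr0 rrlo lohi close PBN.
have hle := coverage_le mSn (mA nu) mBN (Flaw nu) rr0 rrlo lohi close PBN.
have f1 := F1 (qlo + rr); have f2 := F1 (qlo - 2 * rr).
have f3 := F2 (qhi + rr); have f4 := F2 (qhi - 2 * rr).
have {}f1 : `|chi2_cdf m qlo - chi2_cdf m (qlo + rr)| <= ep / 4.
  by apply: f1; rewrite opprD addNKr normrN gtr0_norm// (le_lt_trans _ rr1)// ler_peMl// ?ler1n ?ltW.
have {}f2 : `|chi2_cdf m qlo - chi2_cdf m (qlo - 2 * rr)| <= ep / 4.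
  by apply: f2; rewrite subKr gtr0_norm// mulr_gt0.
have {}f3 : `|chi2_cdf m qhi - chi2_cdf m (qhi + rr)| <= ep / 4.
  by apply: f3; rewrite opprD addNKr normrN gtr0_norm// (le_lt_trans _ rr2)// ler_peMl// ?ler1n ?ltW.
have {}f4 : `|chi2_cdf m qhi - chi2_cdf m (qhi - 2 * rr)| <= ep / 4.
  by apply: f4; rewrite subKr gtr0_norm// mulr_gt0.
(* Coverage differs from (1 - a/2) - a/2 by at most ep/4 at each percentile plus ep/2 for the bad
   event. *)
move: f1 f2 f3 f4 hge hle; rewrite clo chi.
set c1 := chi2_cdf m (qlo + rr); set c2 := chi2_cdf m _; set c3 := chi2_cdf m _; set c4 := chi2_cdf m _.
move: c1 c2 c3 c4 (fine _) => c1 c2 c3 c4 PA; rewrite !ler_norml; clear.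
move=> /andP[? ?] /andP[? ?] /andP[? ?] /andP[? ?] ? ?; apply/andP; split; lra.
Unshelve. all: end_near. Qed.
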